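(* Let $m_1,m_2,n_1,n_2\ge1$, $a,b,c,d>0$, let $f_1:\mathbb{S}^{m_1}\to\mathbb{S}^{n_1}$ and $f_2:\mathbb{S}^{m_2}\to\mathbb{S}^{n_2}$ be symphonic maps, and let $J$, $X$, $X_0$ be the functional and spaces defined in the context. Set $$c_0=\inf\{J(\varphi):\varphi\in X,\ 0\le\varphi(t)\le\tfrac{\pi}{2}\text{ for }t\in(0,\tfrac{\pi}{2})\}.$$ If $J(0)\le J(\frac{\pi}{2})$ (the values of $J$ at the constant functions $0$ and $\frac{\pi}{2}$), then $c_0<J(0)$, and thus there exists a nonconstant solution $\varphi\in X_0$ of $$\frac{k(\varphi)^2}{h(t)^2}\bigl(\varphi'(t)^3\bigr)'-\frac{k(\varphi)^2}{h(t)^2}\Bigl(m_1\frac{\sin t}{\cos t}-m_2\frac{\cos t}{\sin t}-2\frac{h'(t)}{h(t)}\Bigr)\varphi'(t)^3+\frac{2k(\varphi)k'(\varphi)}{h(t)^2}\varphi'(t)^4+\Bigl(\frac{c^4}{a^4}\frac{\cos^2\varphi(t)}{\cos^4t}\|f_1^*g_{\mathbb{S}^{n_1}}\|^2-\frac{d^4}{b^4}\frac{\sin^2\varphi(t)}{\sin^4t}\|f_2^*g_{\mathbb{S}^{n_2}}\|^2\Bigr)\sin\varphi(t)\cos\varphi(t)=0.$$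
   Context: $\mathbb{S}^m$ is the unit sphere with standard metric $g_{\mathbb{S}^m}$. A map $f:(M,g)\to(N,h)$ between Riemannian manifolds is symphonic if it is a critical point of $F(f)=\int_M\frac{\|f^*h\|^2}{2}\,dv_g$. $h(t)=[a^2\sin^2t+b^2\cos^2t]^{1/2}$ and $k(\varphi)=[c^2\sin^2\varphi+d^2\cos^2\varphi]^{1/2}$. The prime on $\varphi$ and $h$ is $d/dt$, and $k'(\varphi)$ is the derivative of $k$ with respect to its argument. $a_1=\frac{c^4}{a^4}\frac{\mathcal{F}(f_1)}{\operatorname{Vol}(\mathbb{S}^{m_1})}$ and $a_2=\frac{d^4}{b^4}\frac{\mathcal{F}(f_2)}{\operatorname{Vol}(\mathbb{S}^{m_2})}$, with $\mathcal{F}(f_i)=\int_{\mathbb{S}^{m_i}}\|f_i^*g_{\mathbb{S}^{n_i}}\|^2$. $$J(\varphi)=\frac14\int_0^{\pi/2}\Bigl(\frac{k^4(\varphi(t))}{h^4(t)}\varphi'(t)^4+a_1\frac{\cos^4\varphi(t)}{\cos^4t}+a_2\frac{\sin^4\varphi(t)}{\sin^4t}\Bigr)\cos^{m_1}t\,\sin^{m_2}t\,dt,$$ where the value $+\infty$ is allowed. $X=\{\alpha\in W^{1,4}_v([0,\pi/2],\mathbb{R}):\int_0^{\pi/2}(\dot\alpha^4+\alpha^4)\,v\,dt<\infty\}$ is the weighted Sobolev space with weight $v(t)=\cos^{m_1}t\,\sin^{m_2}t$, and $X_0=\{\varphi\in X:0\le\varphi(t)\le\frac{\pi}{2}\text{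 for }t\in(0,\frac{\pi}{2})\}$.
   Formalization: f_1 is assumed nonconstant: for constant f_1 one has J(0)=0≤c_0, so c_0<J(0) fails. In the equation the norms ‖f_i^*g‖² are taken as their means over the spheres, and also as the pointwise values when both are constant. *)

(* Defs.v *)
From HB Require Import structures.
From mathcomp Require Import all_boot all_order all_algebra.
From mathcomp Require Import all_classical all_reals all_analysis.
From mathcomp Require Import ring lra.

Set Implicit Arguments.
Unset Strict Implicit.
Unset Printing Implicit Defensive.

Import Order.TTheory GRing.Theory Num.Theory.
Import numFieldNormedType.Exports.

Local Open Scope ring_scope.
Local Open Scope classical_set_scope.

Section smoothness.
Context {R : realType} {V W : normedModType R}.

(* For an open set U: all iterated directional derivatives of order <= k exist
   and are continuous on U. *)
Fixpoint Ck (k : nat) (U : set V) (f : V -> W) : Prop :=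
  if k is k'.+1 then
    (forall x, U x -> differentiable f x) /\ (forall v, Ck k' U ('D_v f))
  else forall x, U x -> {for x, continuous f}.

Definition smooth_on (U : set V) (f : V -> W) : Prop := forall k, Ck k U f.

End smoothness.

Section spheres.
Context {R : realType}.

(* The norm `|_| of 'rV[R]_n is the sup norm, hence the explicit Euclidean
   structure. *)
Definition dotv n (x y : 'rV[R]_n) : R := \sum_(i < n) x ord0 i * y ord0 i.

Definition enorm n (x : 'rV[R]_n) : R := Num.sqrt (dotv x x).

Definition sphere m : set 'rV[R]_m.+1 := [set x | dotv x x = 1].

(* Integral over S^m for the Riemannian volume measure, in polar coordinates
   x = (cos r, sin r * y) with 0 <= r <= pi and y in S^(m-1), where the volume
   element is sin^(m-1) r dr dy; S^0 is {1, -1} with the counting measure. *)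
Fixpoint sphere_integral (m : nat) : ('rV[R]_m.+1 -> \bar R) -> \bar R :=
  match m return ('rV[R]_m.+1 -> \bar R) -> \bar R with
  | 0%N => fun u => (u (const_mx 1%R) + u (const_mx (-1)%R))%E
  | m'.+1 => fun u =>
      (\int[lebesgue_measure]_(r in `[0%R, (pi : R)])
         ((sin r ^+ m')%:E *
          sphere_integral
            (fun y : 'rV[R]_m'.+1 =>
               u (row_mx (cos r)%:M (sin r *: y) : 'rV[R]_(1 + m'.+1)))))%E
  end.

Definition sphere_vol m : R := fine (@sphere_integral m (fun=> 1%E)).

(* Maps S^m -> S^n are functions on R^(m+1) of which only the values on S^m
   matter. *)
Definition maps_spheres m n (f : 'rV[R]_m.+1 -> 'rV[R]_n.+1) : Prop :=
  forall x, sphere x -> sphere (f x).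

(* The extension of f from S^m to R^(m+1) \ {0} that is constant on rays.
   It is smooth iff f is smooth on S^m; its differential at x in S^m is
   the differential of f on the tangent space x^\perp and vanishes at x. *)
Definition radial m n (f : 'rV[R]_m.+1 -> 'rV[R]_n.+1) (x : 'rV[R]_m.+1) :=
  f ((enorm x)^-1 *: x).

Definition smooth_sphere_map m n (f : 'rV[R]_m.+1 -> 'rV[R]_n.+1) : Prop :=
  maps_spheres f /\ smooth_on [set x | x != 0] (radial f).

(* (f^* g_{S^n})_x (v, w) *)
Definition pullback m n (f : 'rV[R]_m.+1 -> 'rV[R]_n.+1) (x v w : 'rV[R]_m.+1)
  : R := dotv ('d (radial f) x v) ('d (radial f) x w).

(* || f^* g_{S^n} ||^2 at x.  Since pullback f x vanishes in the direction of x,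
   the sum over the standard basis of R^(m+1) is the sum over any orthonormal
   basis of the tangent space at x: see pullback_sqnorm_frame. *)
Definition pullback_sqnorm m n (f : 'rV[R]_m.+1 -> 'rV[R]_n.+1)
    (x : 'rV[R]_m.+1) : R :=
  \sum_(i < m.+1) \sum_(j < m.+1)
    (pullback f x (delta_mx ord0 i) (delta_mx ord0 j)) ^+ 2.

Lemma radial_differentiable m n (f : 'rV[R]_m.+1 -> 'rV[R]_n.+1) x :
  smooth_sphere_map f -> sphere x -> differentiable (radial f) x.
Proof.
move=> [_ fS] xS; have [+ _] := fS 1%N; apply => /=.
apply/eqP => x0; move: xS; rewrite /sphere /= x0 /dotv big1 => [/esym/eqP|i _].
  by rewrite oner_eq0.
by rewrite mxE mul0r.
Qed.

Lemma diff_radial0 m n (f : 'rV[R]_m.+1 -> 'rV[R]_n.+1) x :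
  differentiable (radial f) x -> 'd (radial f) x x = 0.
Proof.
move=> df; rewrite -deriveE// /derive.
apply/lim_near_cst => //.
near=> h.
have h1 : 0 < h + 1 :> R.
  have : `|h| < 1 by near: h; exact: dnbhs0_lt.
  by rewrite ltr_norml => /andP[? _]; lra.
have -> : (radial f \o shift x) (h *: x) = radial f x.
  rewrite /= /radial -[X in h *: x + X]scale1r -scalerDl; congr f.
  have -> : enorm ((h + 1) *: x) = (h + 1) * enorm x.
    rewrite /enorm.
    have -> : dotv ((h + 1) *: x) ((h + 1) *: x) = (h + 1) ^+ 2 * dotv x x.
      by rewrite /dotv mulr_sumr; apply: eq_bigr => i _; rewrite !mxE; ring.
    by rewrite sqrtrM ?sqr_ge0// sqrtr_sqr gtr0_norm.
  rewrite scalerA invfM mulrAC mulVf ?mul1r//; exact: lt0r_neq0.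
by rewrite subrr scaler0.
Unshelve. all: by end_near. Qed.

Lemma dotvE n (x y : 'rV[R]_n) : dotv x y = (x *m y^T) ord0 ord0.
Proof. by rewrite mxE; apply: eq_bigr => i _; rewrite mxE. Qed.

Lemma mxtrace_sqr k (A : 'M[R]_k) :
  \sum_i \sum_j A i j ^+ 2 = \tr (A *m A^T).
Proof.
by apply: eq_bigr => i _; rewrite mxE; apply: eq_bigr => j _; rewrite mxE.
Qed.

Lemma pullback_sqnorm_frame m n (f : 'rV[R]_m.+1 -> 'rV[R]_n.+1)
    (x : 'rV[R]_m.+1) (E : 'M[R]_(m, m.+1)) :
  smooth_sphere_map f -> sphere x -> E *m E^T = 1%:M -> E *m x^T = 0 ->
  pullback_sqnorm f x =
  \sum_(i < m) \sum_(j < m) pullback f x (row i E) (row j E) ^+ 2.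
Proof.
move=> fS xS EE Ex; have df := radial_differentiable fS xS.
set D := jacobian (radial f) x.
have pD k l (A : 'M[R]_(k, _)) (B : 'M[R]_(l, _)) i j :
    pullback f x (row i A) (row j B) = (A *m D *m (B *m D)^T) i j.
  rewrite /pullback -!mul_rV_lin1 -/D dotvE -!row_mul !mxE.
  by apply: eq_bigr => u _; rewrite !mxE.
have xD : x *m D = 0 by rewrite mul_rV_lin1 diff_radial0.
pose P := col_mx E x : 'M[R]_(m + 1, m.+1).
have xx : x *m x^T = 1%:M.
  by apply/matrixP => i j; rewrite !ord1 -dotvE xS mxE eqxx.
have PP : P *m P^T = 1%:M.
  rewrite tr_col_mx mul_col_row EE Ex xx.
  have -> : x *m E^T = 0 by rewrite -[x]trmxK -trmx_mul Ex trmx0.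
  by rewrite -scalar_mx_block.
have PP' : E^T *m E + x^T *m x = 1%:M.
  rewrite -mul_row_col -tr_col_mx -/P.
  move: P PP; rewrite addn1 => P; exact: mulmx1C.
have ED : E^T *m (E *m D) = D.
  rewrite mulmxA -[E^T *m E](addrK (x^T *m x)) PP' mulmxBl mul1mx.
  by rewrite -mulmxA xD mulmx0 subr0.
have DE : D^T *m E^T *m E = D^T.
  by apply: trmx_inj; rewrite !trmx_mul !trmxK ED.
have -> : pullback_sqnorm f x = \tr (D *m D^T *m (D *m D^T)^T).
  rewrite -mxtrace_sqr; apply: eq_bigr => i _; apply: eq_bigr => j _.
  by rewrite -[in X in pullback _ _ X _]row1 -[in X in pullback _ _ _ X]row1
    pD !mul1mx.
under eq_bigr do under eq_bigr do rewrite pD.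
rewrite mxtrace_sqr !trmx_mul !trmxK.
have -> : E *m D *m (D^T *m E^T) *m (E *m D *m (D^T *m E^T))
    = E *m (D *m (D^T *m (E^T *m (E *m D)) *m D^T) *m E^T).
  by rewrite !mulmxA.
rewrite ED [RHS]mxtrace_mulC; congr (\tr _).
by rewrite -!mulmxA [in RHS](mulmxA D^T E^T E) DE.
Qed.

Definition total_sqnorm m n (f : 'rV[R]_m.+1 -> 'rV[R]_n.+1) : R :=
  fine (sphere_integral (fun x => (pullback_sqnorm f x)%:E)).

Definition symphonic_energy m n (f : 'rV[R]_m.+1 -> 'rV[R]_n.+1) : R :=
  fine (sphere_integral (fun x => (pullback_sqnorm f x / 2)%:E)).

Definition smooth_variation m n (f : 'rV[R]_m.+1 -> 'rV[R]_n.+1) (e : R)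
    (G : R -> 'rV[R]_m.+1 -> 'rV[R]_n.+1) : Prop :=
  [/\ forall s, `|s| < e -> maps_spheres (G s),
      smooth_on [set p : R * 'rV[R]_m.+1 | `|p.1| < e /\ p.2 != 0]
        (fun p => radial (G p.1) p.2) &
      forall x, sphere x -> G 0 x = f x].

Definition symphonic m n (f : 'rV[R]_m.+1 -> 'rV[R]_n.+1) : Prop :=
  smooth_sphere_map f /\
  forall e G, 0 < e -> smooth_variation f e G ->
    is_derive (0 : R) (1 : R) (fun s : R => symphonic_energy (G s)) (0 : R).

Definition nonconstant_sphere_map m n (f : 'rV[R]_m.+1 -> 'rV[R]_n.+1) : Prop :=
  exists x y, [/\ sphere x, sphere y & f x <> f y].

Definition constant_pullback_norm m n (f : 'rV[R]_m.+1 -> 'rV[R]_n.+1) : Prop :=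
  forall x y, sphere x -> sphere y ->
    pullback_sqnorm f x = pullback_sqnorm f y.

Definition mean_sqnorm m n (f : 'rV[R]_m.+1 -> 'rV[R]_n.+1) : R :=
  total_sqnorm f / sphere_vol m.

End spheres.

Section functional.
Context {R : realType}.

Notation mu := (@lebesgue_measure R).

Definition arc : set R := `]0%R, (pi / 2 : R)[.

(* h is ell a b and k is ell c d. *)
Definition ell (a b t : R) : R :=
  Num.sqrt (a ^+ 2 * sin t ^+ 2 + b ^+ 2 * cos t ^+ 2).

Definition weight (m1 m2 : nat) (t : R) : R := cos t ^+ m1 * sin t ^+ m2.

Definition test_function (eta : R -> R) : Prop :=
  smooth_on setT eta /\
  exists u v, [/\ 0 < u, v < pi / 2 & forall t, ~ (u <= t <= v) -> eta t = 0].

Definition weak_derivative (alpha dalpha : R -> R) : Prop :=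
  [/\ locally_integrable arc alpha, locally_integrable arc dalpha &
      forall eta, test_function eta ->
        (\int[mu]_(t in arc) (alpha t * derive1 eta t)%:E
         = - \int[mu]_(t in arc) (dalpha t * eta t)%:E)%E].

(* alpha belongs to X, with weak derivative dalpha *)
Definition in_X (m1 m2 : nat) (alpha dalpha : R -> R) : Prop :=
  weak_derivative alpha dalpha /\
  (\int[mu]_(t in arc) ((dalpha t ^+ 4 + alpha t ^+ 4) * weight m1 m2 t)%:E
   < +oo)%E.

Definition in_X0 (m1 m2 : nat) (phi dphi : R -> R) : Prop :=
  in_X m1 m2 phi dphi /\ forall t, arc t -> 0 <= phi t <= pi / 2.

(* J(phi), with dphi the weak derivative of phi.  As dphi is unique up to
   null sets, this value depends on phi only. *)
Definition J (m1 m2 : nat) (a b c d a1 a2 : R) (phi dphi : R -> R) : \bar R :=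
  ((4^-1)%:E * \int[mu]_(t in arc)
    ((ell c d (phi t) ^+ 4 / ell a b t ^+ 4 * dphi t ^+ 4
      + a1 * (cos (phi t) ^+ 4 / cos t ^+ 4)
      + a2 * (sin (phi t) ^+ 4 / sin t ^+ 4))
     * weight m1 m2 t)%:E)%E.

Definition J_cst (m1 m2 : nat) (a b c d a1 a2 s : R) : \bar R :=
  J m1 m2 a b c d a1 a2 (cst s) (cst 0).

Definition J_inf (m1 m2 : nat) (a b c d a1 a2 : R) : \bar R :=
  ereal_inf [set y | exists phi dphi, in_X0 m1 m2 phi dphi /\
                       y = J m1 m2 a b c d a1 a2 phi dphi].

(* Left-hand side of the equation at t, where e1 and e2 stand for
   || f_i^* g_{S^n_i} ||^2. *)
Definition ode_lhs (m1 m2 : nat) (a b c d e1 e2 : R) (phi : R -> R) (t : R)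
  : R :=
  let h := ell a b in
  let k := ell c d in
  let dphi := derive1 phi in
  k (phi t) ^+ 2 / h t ^+ 2 * derive1 (fun s => dphi s ^+ 3) t
  - k (phi t) ^+ 2 / h t ^+ 2
    * (m1%:R * (sin t / cos t) - m2%:R * (cos t / sin t)
       - 2 * (derive1 h t / h t)) * dphi t ^+ 3
  + 2 * k (phi t) * derive1 k (phi t) / h t ^+ 2 * dphi t ^+ 4
  + (c ^+ 4 / a ^+ 4 * (cos (phi t) ^+ 2 / cos t ^+ 4) * e1
     - d ^+ 4 / b ^+ 4 * (sin (phi t) ^+ 2 / sin t ^+ 4) * e2)
    * sin (phi t) * cos (phi t).

Definition ode_solution (m1 m2 : nat) (a b c d e1 e2 : R) (phi : R -> R)
  : Prop :=
  forall t, arc t ->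
    [/\ derivable phi t 1, derivable (fun s => derive1 phi s ^+ 3) t 1 &
        ode_lhs m1 m2 a b c d e1 e2 phi t = 0].

Definition nonconstant_on_arc (phi : R -> R) : Prop :=
  exists s t, [/\ arc s, arc t & phi s <> phi t].

End functional.

(* Main.v *)
(** Since [f1] is nonconstant, [a1 > 0].  Along [e sin^2 t cos t] the second term of the
    density of [J] decreases by a multiple of [e^2 sin^4 t] at least, while the two other
    terms increase by at most a multiple of [e^4 sin^4 t]; hence [0 <= c_0 < J(0)].  By the
    hypothesis [J(pi/2) > 0], which forces [a2 > 0].

    With the weight [w], the equation reads [(h^2 w k(phi)^2 phi'^3)' = force(phi, t)].  For
    [psi] with [psi' = k(phi)^(2/3) phi'] this is the Euler-Lagrange equation of
    [\int h^2 w psi'^4 / 4 + V(psi, t)], a functional other than [J].  Its discretisations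
    on uniform grids are minimised between a subsolution and a supersolution (the
    barriers); the minimisers satisfy the discrete equation, their fluxes [h^2 w psi'^3]
    are bounded on compact subintervals, and their limit along an ultrafilter solves the
    equation.  The barriers are positive near [pi/2] and below the maximum near [0], so
    that the limit is neither of the constants [0] and [pi/2]; no constant in between is a
    solution when [a1, a2 > 0]. *)
Require Import Defs.
From mathcomp Require Import all_boot all_order all_algebra.
From mathcomp Require Import all_classical all_reals all_analysis.
From mathcomp Require Import measurable_realfun.
From mathcomp Require Import ring lra.
Set Implicit Arguments.
Unset Strict Implicit.
Unset Printing Implicit Defensive.

Import Order.TTheory GRing.Theory Num.Theory.
Import numFieldNormedType.Exports.
Local Open Scope classical_set_scope.
Local Open Scope ring_scope.

(** The exponent 2/3 gives psi'^3 = k(phi)^2 phi'^3, so the unknown leaves the leading coefficient.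
    The kinetic part is then a sum of convex functions of the increments, its derivative at a node
    is monotone in the two neighbouring values, and this alone yields comparison with barriers. The
    weight h^2 w vanishes at both ends and the force may blow up there, so pointwise estimates are
    local and no boundary condition is imposed; the one global estimate is an energy bound, obtained
    from the competitor phi(t) = t, along which the potential cancels the poles 1/cos^4 t and
    1/sin^4 t. Both 0 and pi/2 are critical points, hence the barriers. Near phi = 0, for t away
    from 0, the force points away from 0 up to t = pi/2, because 1/cos^4 t >= 1 while 1/sin^4 t is
    bounded there; near pi/2 the situation is the mirror image. A barrier of height eps has a force
    linear in eps and a flux cubic in eps, so a small eps succeeds. The equation degenerates where
    phi' = 0: fluxes are Lipschitz, slopes only Hoelder of exponent 1/3, which still makes the limit
    continuously differentiable. *)

(** * Derivatives as increment estimates, one-sided minima, elementary algebra *)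

Lemma is_derive1P (R : realType) (f : R -> R) (x l : R) :
  is_derive x 1 f l <->
  forall e, 0 < e -> exists2 d, 0 < d &
    forall y, `|y - x| < d -> `|f y - f x - (y - x) * l| <= e * `|y - x|.
Proof.
split.
  move=> /is_derive1_caratheodory[g [fE gC <-]] e e0.
  have /cvgrPdist_le/(_ _ e0)/nbhs_ballP[d /= d0 dg] := gC.
  exists d => // y xy; rewrite fE (mulrC (y - x)) -mulrBl normrM ler_wpM2r//.
  by rewrite distrC; apply: dg; rewrite /ball/= distrC.
move=> H; apply/is_derive1_caratheodory.
exists (fun z => if z == x then l else (f z - f x) / (z - x)); split.
- move=> z; case: eqP => [->|/eqP]; first by rewrite !subrr mulr0.
  by rewrite -subr_eq0 => /divfK->.
- apply/cvgrPdist_le => e e0; have [d d0 dP] := H _ e0.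
  rewrite eqxx; apply/nbhs_ballP; exists d => //= y; rewrite /ball/= distrC => xy.
  case: eqP => [_|/eqP yx]; first by rewrite subrr normr0 ltW.
  have yx0 : 0 < `|y - x| by rewrite normr_gt0 subr_eq0.
  rewrite -(ler_pM2r yx0) distrC -normrM mulrBl divfK ?subr_eq0// (mulrC l).
  exact: dP.
- by rewrite eqxx.
Qed.

Lemma derive1_ge0_right_min (R : realType) (f : R -> R) (x l b : R) :
  is_derive x 1 f l -> x < b -> (forall y, x <= y <= b -> f x <= f y) -> 0 <= l.
Proof.
move=> /is_derive1P H xb fmin; rewrite leNgt; apply/negP => l0.
have [d d0 dP] := H (- l / 2) ltac:(lra).
pose y := x + Num.min (d / 2) (b - x).
have y0 : 0 < y - x by rewrite /y addrAC subrr add0r lt_min; lra.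
have yd : y - x <= d / 2 by rewrite /y addrAC subrr add0r ge_min lexx.
have yb : y - x <= b - x by rewrite /y addrAC subrr add0r ge_min lexx orbT.
have := dP y; rewrite gtr0_norm// => /(_ ltac:(lra)).
have := fmin y ltac:(lra).
move=> ?; rewrite ler_norml => /andP[? ?]; nra.
Qed.

Lemma derive1_le0_left_min (R : realType) (f : R -> R) (x l b : R) :
  is_derive x 1 f l -> b < x -> (forall y, b <= y <= x -> f x <= f y) -> l <= 0.
Proof.
move=> /is_derive1P H bx fmin; rewrite leNgt; apply/negP => l0.
have [d d0 dP] := H (l / 2) ltac:(lra).
pose y := x - Num.min (d / 2) (x - b).
have y0 : y - x < 0 by rewrite /y addrAC subrr add0r oppr_lt0 lt_min; lra.
have yd : x - y <= d / 2 by rewrite /y opprB addrCA subrr addr0 ge_min lexx.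
have yb : x - y <= x - b by rewrite /y opprB addrCA subrr addr0 ge_min lexx orbT.
have := dP y; rewrite ltr0_norm// => /(_ ltac:(lra)).
have := fmin y ltac:(lra).
move=> ?; rewrite ler_norml => /andP[? ?]; nra.
Qed.

(** Moving the value at one node [i] changes only the increments over the cells [i.-1] and [i]; this
    isolates their two terms. *)
Lemma big_ord_two (R : nmodType) (n i : nat) (F : nat -> R) :
  (0 < i < n)%N -> (forall j, (j < n)%N -> j != i.-1 -> j != i -> F j = 0) ->
  \sum_(j < n) F j = F i.-1 + F i.
Proof.
move=> /andP[i0 iltn] F0.
have i1n : (i.-1 < n)%N by rewrite (leq_ltn_trans (leq_pred _)).
rewrite (bigD1 (Ordinal i1n))//= (bigD1 (Ordinal iltn))/=; last first.
  by apply/eqP => -[]; case: i i0 {iltn F0 i1n} => //= i _ /eqP; rewrite eqn_leq ltnn.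
by rewrite big1 ?addr0// => j /andP[ji1 ji]; apply: F0.
Qed.

Lemma cube_subE (R : comNzRingType) (u v : R) :
  v ^+ 3 - u ^+ 3 = (v - u) * (v ^+ 2 + v * u + u ^+ 2).
Proof. ring. Qed.

Lemma ler_cube (R : realFieldType) (u v : R) : u <= v -> u ^+ 3 <= v ^+ 3.
Proof.
move=> uv; rewrite -subr_ge0 cube_subE mulr_ge0 ?subr_ge0//.
by have := sqr_ge0 (v + u / 2); have := sqr_ge0 u; rewrite !expr2; lra.
Qed.

Lemma continuous_at_sum (R : numFieldType) (T : topologicalType) (I : Type) (r : seq I)
    (P : pred I) (F : I -> T -> R) (x : T) :
  (forall i, {for x, continuous (F i)}) ->
  {for x, continuous (fun y => \sum_(i <- r | P i) F i y)}.
Proof.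
by move=> Fx; apply: cvg_big => [|i _]; [exact: add_continuous|exact: Fx].
Qed.

(** * Minimisers of a discrete energy in a box *)

Section discrete_minimizer.
Context {R : realType}.
Variables (n : nat) (beta : nat -> R) (V W : nat -> R -> R).

Definition discrete_energy (x : nat -> R) : R :=
  \sum_(i < n) beta i * (x i.+1 - x i) ^+ 4 + \sum_(i < n.+1) V i (x i).

(** For [0 < i < n] this is the partial derivative of the energy in the value at node [i], with
    [W i] the derivative of [V i]. It is nonincreasing in the two neighbouring values, which is what
    the comparison with [lo] and [hi] uses. *)
Definition discrete_slope (i : nat) (x : nat -> R) : R :=
  4 * beta i.-1 * (x i - x i.-1) ^+ 3 - 4 * beta i * (x i.+1 - x i) ^+ 3
  + W i (x i).

Variables (lo hi : nat -> R).
Hypothesis beta_ge0 : forall i, (i < n)%N -> 0 <= beta i.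
Hypothesis lohi : forall i, (i <= n)%N -> lo i <= hi i.
Hypothesis VW : forall i y, (i <= n)%N -> lo i <= y <= hi i ->
  is_derive y 1 (V i) (W i y).

Let box (x : nat -> R) := forall i, (i <= n)%N -> lo i <= x i <= hi i.
Let update (x : nat -> R) i y := fun j => if j == i then y else x j.

Lemma discrete_energy_update x i y : (0 < i < n)%N ->
  discrete_energy (update x i y) - discrete_energy x =
  (beta i.-1 * (y - x i.-1) ^+ 4 + beta i * (x i.+1 - y) ^+ 4 + V i y)
  - (beta i.-1 * (x i - x i.-1) ^+ 4 + beta i * (x i.+1 - x i) ^+ 4 + V i (x i)).
Proof.
move=> /andP[i0 iltn].
have i1 : (i.-1 == i) = false by case: i i0 {iltn} => //= i _; rewrite ltn_eqF.
have i2 : (i.+1 == i) = false by rewrite gtn_eqF.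
rewrite /discrete_energy opprD addrACA -!sumrB.
rewrite (@big_ord_two _ n i (fun j => beta j * (update x i y j.+1 - update x i y j) ^+ 4
  - beta j * (x j.+1 - x j) ^+ 4)) ?i0//; last first.
  move=> j jn ji1 ji; rewrite /update (negbTE ji).
  by rewrite -(prednK i0) eqSS (negbTE ji1) subrr.
rewrite (@big_ord_two _ n.+1 i (fun j => V j (update x i y j) - V j (x j)))
  ?i0 ?ltnS 1?ltnW//; last first.
  by move=> j jn ji1 ji; rewrite /update (negbTE ji) subrr.
rewrite /update (prednK i0) eqxx i1 i2 subrr add0r; ring.
Qed.

Lemma local_energy_derive i (x : nat -> R) : (i <= n)%N -> lo i <= x i <= hi i ->
  is_derive (x i) 1
    (fun y => beta i.-1 * (y - x i.-1) ^+ 4 + beta i * (x i.+1 - y) ^+ 4 + V i y)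
    (discrete_slope i x).
Proof.
move=> iltn xi; have := VW iltn xi => dV.
have -> : (fun y => beta i.-1 * (y - x i.-1) ^+ 4 + beta i * (x i.+1 - y) ^+ 4 + V i y)
  = (beta i.-1 \*: (id - cst (x i.-1)) ^+ 4 + beta i \*: (cst (x i.+1) - id) ^+ 4 + V i).
  by apply/funext => y.
apply: is_derive_eq; rewrite /discrete_slope /= !fctE /GRing.scale/=; ring.
Qed.

Hypothesis slope_lo : forall i, (0 < i < n)%N -> discrete_slope i lo <= 0.
Hypothesis slope_hi : forall i, (0 < i < n)%N -> 0 <= discrete_slope i hi.

(* At a node where the constraint [lo] is active, the neighbours lie above [lo], so the
   slope is at most that of [lo]; elsewhere one may move down.  Symmetrically for [hi]. *)
Lemma minimizer_slope0 x : box x ->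
    (forall y, box y -> discrete_energy x <= discrete_energy y) ->
  forall i, (0 < i < n)%N -> discrete_slope i x = 0.
Proof.
move=> bx xmin i iP; have /andP[i0 iltn] := iP.
have xi := bx i (ltnW iltn).
have xi1 := bx i.-1 (leq_trans (leq_pred _) (ltnW iltn)).
have xi2 := bx i.+1 iltn.
have D := local_energy_derive (ltnW iltn) xi.
have beta1 : 0 <= beta i.-1 by apply: beta_ge0; rewrite (leq_ltn_trans (leq_pred _)).
have beta2 : 0 <= beta i by exact: beta_ge0.
have locmin y : lo i <= y <= hi i ->
  beta i.-1 * (x i - x i.-1) ^+ 4 + beta i * (x i.+1 - x i) ^+ 4 + V i (x i) <=
  beta i.-1 * (y - x i.-1) ^+ 4 + beta i * (x i.+1 - y) ^+ 4 + V i y.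
  move=> yb; rewrite -subr_ge0 -discrete_energy_update// subr_ge0; apply: xmin.
  by move=> j jn; rewrite /update; case: eqP => [->//|_]; exact: bx.
apply: le_anti; apply/andP; split.
  have [lx|xl] := ltP (lo i) (x i).
    apply: (derive1_le0_left_min D lx) => y yP; apply: locmin; lra.
  have {}xl : x i = lo i by apply: le_anti; lra.
  apply: le_trans (slope_lo iP); rewrite /discrete_slope xl lerD2r.
  apply: lerB; rewrite ler_wpM2l ?mulr_ge0//; apply: ler_cube; lra.
have [lx|xl] := ltP (x i) (hi i).
  apply: (derive1_ge0_right_min D lx) => y yP; apply: locmin; lra.
have {}xl : x i = hi i by apply: le_anti; lra.
apply: le_trans (slope_hi iP) _; rewrite /discrete_slope xl lerD2r.
apply: lerB; rewrite ler_wpM2l ?mulr_ge0//; apply: ler_cube; lra.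
Qed.

(** The box is compact as a set of row vectors, where the extreme value theorem applies. Rows are
    read as functions on [nat] through [inord]; beyond index [n] their values are irrelevant to the
    energy. *)
Lemma discrete_minimizer_exists : exists x, [/\ box x,
  forall y, box y -> discrete_energy x <= discrete_energy y &
  forall i, (0 < i < n)%N -> discrete_slope i x = 0].
Proof.
suff [x bx xmin] : exists2 x, box x &
    forall y, box y -> discrete_energy x <= discrete_energy y.
  by exists x; split => //; exact: minimizer_slope0.
pose seqof (v : 'rV[R]_n.+1) (i : nat) : R := v ord0 (inord i).
pose A := [set v : 'rV[R]_n.+1 | forall i : 'I_n.+1, [set` `[lo i, hi i]] (v ord0 i)].
have Abox v : A v -> box (seqof v).
  move=> Av i iltn; have := Av (inord i).
  by rewrite /= in_itv/= inordK.
have key (v : 'rV[R]_n.+1) : A v -> {for v, continuous (discrete_energy \o seqof)}.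
  move=> Av.
  have cs (i : nat) : {for v, continuous (fun u : 'rV[R]_n.+1 => seqof u i)} by exact: coord_continuous.
  apply: continuousD.
    apply: (continuous_at_sum (F := fun (i : 'I_n) u =>
      beta i * (seqof u i.+1 - seqof u i) ^+ 4)) => i.
    apply: continuousM; first exact: cst_continuous.
    have cd : {for v, continuous (fun u : 'rV[R]_n.+1 => seqof u i.+1 - seqof u i)}.
      by apply: continuousB; exact: cs.
    exact: (continuous_comp cd (@exprn_continuous _ 4 _)).
  apply: (continuous_at_sum (F := fun (i : 'I_n.+1) u => V i (seqof u i))) => i.
  have iltn : (i <= n)%N by rewrite -ltnS.
  have dV := VW iltn (Abox _ Av i iltn).
  have cV : {for seqof v i, continuous (V i)}.
    apply: differentiable_continuous; apply/derivable1_diffP.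
    by case: dV.
  exact: (continuous_comp (cs i) cV).
have [||| v vA vmin] := @EVT_min_rV R _ (discrete_energy \o seqof) A.
- exists (\row_i lo i) => i; by rewrite /= in_itv/= mxE lexx lohi// -ltnS ltn_ord.
- by apply: (@rV_compact R n.+1 (fun i => [set` `[lo i, hi i]])) => i; exact: segment_compact.
- apply: continuous_in_subspaceT => v; rewrite inE; exact: key.
rewrite inE in vA.
exists (seqof v); first exact: Abox.
move=> y by_.
have yE : forall i, (i <= n)%N -> seqof (\row_(i < n.+1) y i) i = y i.
  by move=> i iltn; rewrite /seqof mxE inordK.
have <- : discrete_energy (seqof (\row_(i < n.+1) y i)) = discrete_energy y.
  congr (_ + _); apply: eq_bigr => -[i iltn] _ /=; last by rewrite yE.
  by rewrite !yE// ltnW.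
by apply: vmin; rewrite inE => i; rewrite /= in_itv/= mxE; apply: by_; rewrite -ltnS.
Qed.

End discrete_minimizer.

(** * Cube inequalities and uniform grids *)

(** Since 4 (a^2 + a b + b^2) - (a - b)^2 = 3 (a + b)^2. It says that the cube root is Hoelder of
    exponent 1/3, and replaces a Lipschitz inverse of the cube, which fails at slope 0. *)
Lemma cube_dist_le (R : realFieldType) (a b : R) :
  `|a - b| ^+ 3 <= 4 * `|a ^+ 3 - b ^+ 3|.
Proof.
rewrite (cube_subE b a) exprS normrM [4 * _]mulrCA ler_wpM2l// real_normK ?num_real//.
have q0 : 0 <= a ^+ 2 + a * b + b ^+ 2.
  by have := sqr_ge0 (a + b / 2); have := sqr_ge0 b; rewrite !expr2; lra.
by rewrite ger0_norm//; have := sqr_ge0 (a + b); rewrite !expr2; lra.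
Qed.

Lemma ltr_cube_cancel (R : realFieldType) (a b : R) : a ^+ 3 < b ^+ 3 -> a < b.
Proof. by rewrite !ltNge; apply: contra; exact: ler_cube. Qed.

Lemma ler_cube_cancel (R : realFieldType) (a b : R) :
  0 <= b -> a ^+ 3 <= b ^+ 3 -> a <= b.
Proof.
move=> b0 ab; rewrite leNgt; apply/negP => ba; move: ab; apply/negP.
by rewrite -ltNge ltrXn2r// ltW.
Qed.

Section grid.
Context {R : realType}.
Variable dt : R.
Hypothesis dt0 : 0 < dt.

Definition node (i : nat) : R := i%:R * dt.

Lemma nodeS i : node i.+1 = node i + dt.
Proof. by rewrite /node -natr1 mulrDl mul1r. Qed.

Lemma le_node i j : (node i <= node j) = (i <= j)%N.
Proof. by rewrite ler_pM2r// ler_nat. Qed.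

Lemma lt_node i j : (node i < node j) = (i < j)%N.
Proof. by rewrite ltr_pM2r// ltr_nat. Qed.

(** A discrete mean value inequality by telescoping. It serves for the values, the fluxes and the
    accumulated energy alike. *)
Lemma node_increment (y r : nat -> R) (i j : nat) (r0 e : R) : (i <= j)%N ->
  (forall l, (i <= l < j)%N -> y l.+1 - y l = dt * r l /\ `|r l - r0| <= e) ->
  `|y j - y i - (node j - node i) * r0| <= e * (node j - node i).
Proof.
elim: j => [|j IH] ij H.
  by move: ij; rewrite leqn0 => /eqP ->; rewrite !subrr mul0r subr0 normr0 mulr0.
move: ij; rewrite leq_eqVlt => /predU1P[<-|].
  by rewrite !subrr mul0r subr0 normr0 mulr0.
rewrite ltnS => ij; have [yS rS] := H j ltac:(by rewrite ij ltnSn).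
have {}IH := IH ij (fun l lP => H l ltac:(by case/andP: lP => -> /ltnW; rewrite ltnS => ->)).
rewrite nodeS.
have -> : y j.+1 - y i - (node j + dt - node i) * r0 =
  (y j - y i - (node j - node i) * r0) + dt * (r j - r0).
  by rewrite -[y j.+1](subrK (y j)) yS; ring.
apply: le_trans (ler_normD _ _) _.
rewrite normrM (gtr0_norm dt0).
have : dt * `|r j - r0| <= dt * e by rewrite ler_pM2l.
by move: IH; lra.
Qed.

(** Rounding inwards to nodes loses at most [dt] at each end, hence at most half of the length. *)
Lemma nodes_between (u v : R) : 0 <= u -> u < v -> 4 * dt <= v - u ->
  exists j0 j1, [/\ (j0 <= j1)%N, u <= node j0, node j1.+1 <= v &
                   (v - u) / 2 <= node j1.+1 - node j0].
Proof.
move=> u0 uv duv.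
have v0 : 0 <= v / dt by apply: divr_ge0; [lra|exact: ltW].
have u0p : 0 <= u / dt by apply: divr_ge0; [lra|exact: ltW].
have /andP[a1 a2] := truncn_itv u0p.
have /andP[b1 b2] := truncn_itv v0.
move: a1 a2 b1 b2; set a := Num.truncn _; set b := Num.truncn _.
rewrite ler_pdivlMr// ltr_pdivrMr// -/(node a) -/(node a.+1).
rewrite ler_pdivlMr// ltr_pdivrMr// -/(node b) -/(node b.+1).
rewrite !nodeS => a1 a2 b1 b2.
have ab : (a.+1 < b)%N by rewrite -lt_node nodeS; lra.
exists a.+1, b.-1; case: b ab b1 b2 => // b ab b1 b2 /=.
by rewrite -ltnS ab nodeS; split => //; lra.
Qed.

End grid.

(** * Estimates for discrete solutions on a compact subinterval, uniform in the mesh *)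

Section local_estimates.
Context {R : realType}.
Variables (M dt u v b0 b1 lB w1 lW : R) (n : nat) (B : R -> R) (W : R -> R -> R).
Variable x : nat -> R.
Hypotheses (dt0 : 0 < dt) (M0 : 0 <= M) (u0 : 0 < u) (duv : 4 * dt <= v - u)
  (vn : v < node dt n).
Hypotheses (b00 : 0 < b0) (lB0 : 0 <= lB) (w10 : 0 <= w1) (lW0 : 0 <= lW).
Hypothesis Bb : forall t, u <= t <= v -> b0 <= B t <= b1.
Hypothesis Blip : forall s t, u <= s <= v -> u <= t <= v ->
  `|B t - B s| <= lB * `|t - s|.
Hypothesis Wb : forall y t, 0 <= y <= M -> u <= t <= v -> `|W y t| <= w1.
Hypothesis Wlip : forall y z s t, 0 <= y <= M -> 0 <= z <= M ->
  u <= s <= v -> u <= t <= v -> `|W z t - W y s| <= lW * (`|z - y| + `|t - s|).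
Hypothesis xb : forall i, (i <= n)%N -> 0 <= x i <= M.

(** Sampling [B] at midpoints of cells makes the scheme invariant under the reflection t -> L - t,
    which later turns lower barriers into upper ones. *)
Definition midweight (i : nat) : R := B (node dt i + dt / 2).
Definition slope (i : nat) : R := (x i.+1 - x i) / dt.
Definition flux (i : nat) : R := midweight i * slope i ^+ 3.

Hypothesis EL : forall i, (0 < i < n)%N ->
  flux i - flux i.-1 = dt * W (x i) (node dt i).

Definition inner (i : nat) : Prop := u <= node dt i /\ node dt i.+1 <= v.

Let inner_between i j l : inner i -> inner j -> (i <= l <= j)%N -> inner l.
Proof.
move=> [ui _] [_ jv] /andP[il lj]; split.
  by apply: le_trans ui _; rewrite le_node.
by apply: le_trans jv; rewrite le_node.
Qed.

Let inner_lt i : inner i -> (0 < i)%N /\ (i.+1 < n)%N.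
Proof.
move=> [ui iv]; split; first by rewrite -(lt_node dt0) /node mul0r; apply: lt_le_trans ui.
by rewrite -(lt_node dt0); apply: le_lt_trans vn.
Qed.

Let inner_mid i : inner i -> u <= node dt i + dt / 2 <= v.
Proof. by rewrite /inner nodeS => -[ui iv]; move: dt0; lra. Qed.

Let inner_node i : inner i -> u <= node dt i <= v.
Proof. by rewrite /inner nodeS => -[ui iv]; move: dt0; lra. Qed.

Let inner_x i : inner i -> 0 <= x i <= M.
Proof. by move=> /inner_lt[_ iltn]; apply: xb; rewrite ltnW// ltnW. Qed.

Let slopeE i : x i.+1 - x i = dt * slope i.
Proof. by rewrite /slope mulrCA divff ?mulr1// gt_eqF. Qed.

Let fluxS i : inner i.+1 -> flux i.+1 - flux i = dt * W (x i.+1) (node dt i.+1).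
Proof.
move=> /inner_lt[_ iltn]; rewrite -EL//.
by apply/andP; split => //; rewrite (ltn_trans _ iltn).
Qed.

Lemma flux_variation i j : inner i -> inner j -> (i <= j)%N ->
  `|flux j - flux i| <= w1 * (node dt j - node dt i).
Proof.
move=> gi gj ij.
have := @node_increment _ _ dt0 flux (fun l => W (x l.+1) (node dt l.+1)) i j 0 w1 ij.
rewrite mulr0 subr0; apply => l /andP[il lj].
have gl : inner l.+1 by apply: (inner_between gi gj); rewrite (leq_trans il).
split; first exact: fluxS.
by rewrite subr0 Wb//; [exact: inner_x|exact: inner_node].
Qed.

Let uv : u < v. Proof. by move: dt0 duv; lra. Qed.

(** A slope of at least [lam] along half of [u, v] would raise the values by (4 M + 1) / 2 > M. The
    second term of [flux_bound] is the largest variation of the flux over [u, v]. *)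
Let lam := (4 * M + 1) / (v - u).

Definition flux_bound : R := b1 * lam ^+ 3 + w1 * (v - u).

(* A flux exceeding the bound would stay large on all of [u, v], and the values would
   leave [0, M]. *)
Lemma flux_le i : inner i -> `|flux i| <= flux_bound.
Proof.
move=> gi; have [dt0' M0' uv'] := And3 dt0 M0 uv; have b00' := b00.
have [j0 [j1 [j01 uj jv jlen]]] := nodes_between dt0 (ltW u0) uv duv.
have gj j : (j0 <= j <= j1)%N -> inner j.
  move=> /andP[jj0 jj1]; split.
    by apply: le_trans uj _; rewrite le_node.
  by apply: le_trans jv; rewrite le_node.
have var j : (j0 <= j <= j1)%N -> `|flux j - flux i| <= w1 * (v - u).
  move=> /gj gj'; have [ij|/ltnW ji] := leqP i j.
    apply: le_trans (flux_variation gi gj' ij) _; rewrite ler_wpM2l//.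
    by move: (inner_node gi) (inner_node gj'); lra.
  rewrite distrC; apply: le_trans (flux_variation gj' gi ji) _; rewrite ler_wpM2l//.
  by move: (inner_node gi) (inner_node gj'); lra.
have lam0 : 0 <= lam by rewrite /lam divr_ge0//; lra.
have lamE : lam * ((v - u) / 2) > M.
  have -> : lam * ((v - u) / 2) = (4 * M + 1) / 2 by rewrite /lam; field; lra.
  lra.
have xj0 : 0 <= x j0 <= M by apply: inner_x; apply: gj; rewrite leqnn.
have xj1 : 0 <= x j1.+1 <= M.
  by apply: xb; have [_ /ltnW] := inner_lt (gj j1 ltac:(by rewrite leqnn j01)).
have mono k : (j0 <= k <= j1.+1)%N ->
    (forall j, (j0 <= j <= j1)%N -> lam <= slope j) ->
    lam * (node dt k - node dt j0) <= x k - x j0.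
  elim: k => [|k IH] /andP[k0 k1] H.
    by move: k0; rewrite leqn0 => /eqP ->; rewrite !subrr mulr0.
  move: k0; rewrite leq_eqVlt => /predU1P[<-|]; first by rewrite !subrr mulr0.
  rewrite ltnS => k0.
  have {}IH := IH ltac:(by rewrite k0 ltnW) H.
  have := slopeE k; have := H k ltac:(by rewrite k0).
  by rewrite nodeS; move: dt0 IH; nra.
have monoN k : (j0 <= k <= j1.+1)%N ->
    (forall j, (j0 <= j <= j1)%N -> slope j <= - lam) ->
    lam * (node dt k - node dt j0) <= x j0 - x k.
  elim: k => [|k IH] /andP[k0 k1] H.
    by move: k0; rewrite leqn0 => /eqP ->; rewrite !subrr mulr0.
  move: k0; rewrite leq_eqVlt => /predU1P[<-|]; first by rewrite !subrr mulr0.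
  rewrite ltnS => k0.
  have {}IH := IH ltac:(by rewrite k0 ltnW) H.
  have := slopeE k; have := H k ltac:(by rewrite k0).
  by rewrite nodeS; move: dt0 IH; nra.
have big : lam * (node dt j1.+1 - node dt j0) > M.
  by apply: lt_le_trans lamE _; rewrite ler_wpM2l.
have j1P : (j0 <= j1.+1 <= j1.+1)%N by rewrite leqnn leqW.
have cubelam : 0 <= lam ^+ 3 by rewrite exprn_ge0.
rewrite leNgt; apply/negP; rewrite ltr_normr => /orP[] big1.
  have : lam * (node dt j1.+1 - node dt j0) <= x j1.+1 - x j0; last by lra.
  apply: mono => // j jP; rewrite leNgt; apply/negP => sj.
  have := var j jP; rewrite ler_norml => /andP[vj _].
  have Bj := Bb (inner_mid (gj j jP)).
  have : flux j <= b1 * lam ^+ 3; last by move: big1; rewrite /flux_bound; lra.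
  have : slope j ^+ 3 <= lam ^+ 3 by apply: ler_cube; exact: ltW.
  by rewrite /flux /midweight; move: Bj cubelam b00; nra.
have : lam * (node dt j1.+1 - node dt j0) <= x j0 - x j1.+1; last by lra.
apply: monoN => // j jP; rewrite leNgt; apply/negP => sj.
have := var j jP; rewrite ler_norml => /andP[_ vj].
have Bj := Bb (inner_mid (gj j jP)).
have : - (b1 * lam ^+ 3) <= flux j; last by move: big1; rewrite /flux_bound; lra.
have : (- lam) ^+ 3 <= slope j ^+ 3 by apply: ler_cube; exact: ltW.
have -> : (- lam) ^+ 3 = - lam ^+ 3 by ring.
by rewrite /flux /midweight; move: Bj cubelam b00; nra.
Qed.

Let flux_bound_ge0 : 0 <= flux_bound.
Proof.
have [M0' uv'] := conj M0 uv; have b00' := b00.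
have lam0 : 0 <= lam by rewrite /lam divr_ge0//; lra.
have := Bb (t := u) ltac:(lra) => Bu.
by rewrite /flux_bound addr_ge0// mulr_ge0 ?exprn_ge0//; lra.
Qed.

(** The cube of a slope is at most [flux_bound / b0]. Adding 1 makes the bound at least 1, hence at
    most its own cube, so that no cube root has to be taken. *)
Definition slope_bound : R := 1 + flux_bound / b0.

Let slope_bound_ge1 : 1 <= slope_bound.
Proof. by rewrite /slope_bound lerDl divr_ge0// ltW. Qed.

Lemma slope_le i : inner i -> `|slope i| <= slope_bound.
Proof.
move=> gi; have Bi := Bb (inner_mid gi).
apply: ler_cube_cancel; first by move: slope_bound_ge1; lra.
have : b0 * `|slope i| ^+ 3 <= b0 * slope_bound.
  apply: le_trans (_ : flux_bound <= _); last first.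
    by rewrite /slope_bound mulrDr mulr1 mulrCA divff ?gt_eqF// mulr1 lerDr ltW.
  apply: le_trans (flux_le gi).
  have -> : `|flux i| = `|midweight i| * `|slope i| ^+ 3 by rewrite -normrX -normrM.
  rewrite ler_wpM2r ?exprn_ge0//.
  by rewrite ger0_norm /midweight; move: b00; lra.
rewrite ler_pM2l// => /le_trans; apply.
exact: ler_eXnr.
Qed.

Definition slope_modulus : R := 4 * ((w1 + lB * slope_bound ^+ 3) / b0).

(** The flux and [B] are Lipschitz and [B] is bounded below, so the cubes of the slopes are
    Lipschitz; [cube_dist_le] passes to the slopes at the price of the exponent 1/3. *)
Lemma slope_variation i j : inner i -> inner j -> (i <= j)%N ->
  `|slope j - slope i| ^+ 3 <= slope_modulus * (node dt j - node dt i).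
Proof.
move=> gi gj ij; apply: le_trans (cube_dist_le _ _) _.
rewrite /slope_modulus -mulrA ler_pM2l//.
have nij : 0 <= node dt j - node dt i by rewrite subr_ge0 le_node.
have Bj := Bb (inner_mid gj).
rewrite mulrAC ler_pdivlMr// mulrC.
apply: le_trans (_ : `|midweight j * (slope j ^+ 3 - slope i ^+ 3)| <= _).
  by rewrite normrM ler_wpM2r// ger0_norm /midweight; move: b00; lra.
have -> : midweight j * (slope j ^+ 3 - slope i ^+ 3) =
  (flux j - flux i) - (midweight j - midweight i) * slope i ^+ 3.
  by rewrite /flux; ring.
apply: le_trans (ler_normB _ _) _; rewrite [leRHS]mulrDl lerD ?flux_variation//.
have := Blip (inner_mid gi) (inner_mid gj); rewrite -/(midweight j) -/(midweight i).
have -> : node dt j + dt / 2 - (node dt i + dt / 2) = node dt j - node dt i by ring.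
rewrite (ger0_norm nij) => Bv; rewrite normrM normrX [leRHS]mulrAC; apply: ler_pM => //.
by rewrite lerXn2r ?nnegrE// ?slope_le//; move: slope_bound_ge1; lra.
Qed.

Let slope_close i j l c e : inner i -> inner j -> (i <= l <= j)%N -> (i <= c <= j)%N ->
  0 <= e -> slope_modulus * (node dt j - node dt i) <= e ^+ 3 ->
  `|slope l - slope c| <= e.
Proof.
move=> gi gj lP cP e0 eP.
have gl := inner_between gi gj lP; have gc := inner_between gi gj cP.
have sm0 : 0 <= slope_modulus.
  have sb0 : 0 <= slope_bound by move: slope_bound_ge1; lra.
  by rewrite /slope_modulus mulr_ge0// divr_ge0 ?(ltW b00)// addr_ge0// mulr_ge0// exprn_ge0.
have {}cP := cP; case/andP: lP => il lj; case/andP: cP => ic cj.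
move: il lj ic cj; rewrite -!(le_node dt0) => il lj ic cj.
apply: ler_cube_cancel => //; apply: le_trans eP.
have [lc|/ltnW cl] := leqP l c.
  by rewrite distrC; apply: le_trans (slope_variation gl gc lc) _; rewrite ler_wpM2l//; lra.
by apply: le_trans (slope_variation gc gl cl) _; rewrite ler_wpM2l//; lra.
Qed.

(** The oscillation of the slopes, a cube root of [slope_modulus] times the span, enters through any
    [e] whose cube dominates that product. The reference cell [c] may lie anywhere between [i] and
    [j]. *)
Lemma value_increment i j c e : inner i -> inner j -> (i <= c <= j)%N ->
  0 <= e -> slope_modulus * (node dt j - node dt i) <= e ^+ 3 ->
  `|x j - x i - (node dt j - node dt i) * slope c| <= e * (node dt j - node dt i).
Proof.
move=> gi gj cP e0 eP; have ij : (i <= j)%N by case/andP: cP; exact: leq_trans.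
apply: node_increment => // l /andP[il lj]; split; first exact: slopeE.
by apply: (slope_close gi gj) => //; rewrite il ltnW.
Qed.

Lemma value_variation i j : inner i -> inner j -> (i <= j)%N ->
  `|x j - x i| <= slope_bound * (node dt j - node dt i).
Proof.
move=> gi gj ij.
have := @node_increment _ _ dt0 x slope i j 0 slope_bound ij.
rewrite mulr0 subr0; apply => l /andP[il lj]; split; first exact: slopeE.
by rewrite subr0 slope_le//; apply: (inner_between gi gj); rewrite il ltnW.
Qed.

Lemma flux_increment i j c : inner i -> inner j -> (i <= c <= j)%N ->
  `|flux j - flux i - (node dt j - node dt i) * W (x c) (node dt c)|
    <= lW * (slope_bound + 1) * (node dt j - node dt i) * (node dt j - node dt i).
Proof.
move=> gi gj cP; have ij : (i <= j)%N by case/andP: cP; exact: leq_trans.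
apply: (@node_increment _ _ dt0 _ (fun l => W (x l.+1) (node dt l.+1))) => // l /andP[il lj].
have lP : (i <= l.+1 <= j)%N by rewrite (leq_trans il).
have gl := inner_between gi gj lP; have gc := inner_between gi gj cP.
split; first exact: fluxS.
apply: le_trans (Wlip (inner_x gc) (inner_x gl) (inner_node gc) (inner_node gl)) _.
rewrite -mulrA ler_wpM2l// mulrDl mul1r.
case/andP: lP => il' lj'; case/andP: cP => ic cj.
have [lc|/ltnW cl] := leqP l.+1 c.
  have := value_variation gl gc lc.
  rewrite distrC (distrC (node dt l.+1)) [`|node dt c - _|]ger0_norm ?subr_ge0 ?le_node//.
  move: il' lj' ic cj; rewrite -!(le_node dt0) => il' lj' ic cj H.
  apply: lerD; last by lra.
  by apply: le_trans H _; rewrite ler_wpM2l//; [move: slope_bound_ge1|]; lra.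
have := value_variation gc gl cl.
rewrite [`|node dt l.+1 - _|]ger0_norm ?subr_ge0 ?le_node//.
move: il' lj' ic cj; rewrite -!(le_node dt0) => il' lj' ic cj H.
apply: lerD; last by lra.
by apply: le_trans H _; rewrite ler_wpM2l//; [move: slope_bound_ge1|]; lra.
Qed.

(** Its limit will be a bounded primitive of B psi'^4: this is how the energy bound on the grids
    reaches the limit. *)
Definition cumulative_energy (i : nat) : R :=
  \sum_(j < i) dt * (midweight j * slope j ^+ 4).

Lemma energy_increment i j c e : inner i -> inner j -> (i <= c <= j)%N ->
  0 <= e -> slope_modulus * (node dt j - node dt i) <= e ^+ 3 ->
  `|cumulative_energy j - cumulative_energy i
    - (node dt j - node dt i) * (midweight c * slope c ^+ 4)|
  <= (w1 * (node dt j - node dt i) * slope_bound + flux_bound * e)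
     * (node dt j - node dt i).
Proof.
move=> gi gj cP e0 eP; have ij : (i <= j)%N by case/andP: cP; exact: leq_trans.
apply: (@node_increment _ _ dt0 _ (fun l => midweight l * slope l ^+ 4)) => // l /andP[il lj].
split; first by rewrite /cumulative_energy big_ord_recr/= addrAC subrr add0r.
have lP : (i <= l <= j)%N by rewrite il ltnW.
have gl := inner_between gi gj lP; have gc := inner_between gi gj cP.
(* The density is flux times slope; the flux is Lipschitz and the slope varies by at most [e]. *)
have -> : midweight l * slope l ^+ 4 - midweight c * slope c ^+ 4 =
  (flux l - flux c) * slope l + flux c * (slope l - slope c) by rewrite /flux; ring.
apply: le_trans (ler_normD _ _) _.
rewrite [`|(flux l - flux c) * _|]normrM [`|flux c * _|]normrM; apply: lerD.
  apply: ler_pM => //; last exact: slope_le.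
  case/andP: lP => il' lj'; case/andP: cP => ic cj.
  have [lc|/ltnW cl] := leqP l c.
    rewrite distrC; apply: le_trans (flux_variation gl gc lc) _; rewrite ler_wpM2l//.
    by move: il' lj' ic cj; rewrite -!(le_node dt0); lra.
  apply: le_trans (flux_variation gc gl cl) _; rewrite ler_wpM2l//.
  by move: il' lj' ic cj; rewrite -!(le_node dt0); lra.
by apply: ler_pM => //; [exact: flux_le|exact: (slope_close gi gj)].
Qed.

End local_estimates.

(** * Passage to the limit along an ultrafilter *)

Lemma fmap_ultra (T V : Type) (f : T -> V) (F : set_system T) :
  UltraFilter F -> UltraFilter (f @ F).
Proof.
move=> FU; split=> [|G GF FG]; first exact: fmap_proper_filter.
rewrite eqEsubset; split => // A GA.
have [//|FnA] := in_ultra_setVsetC (f @^-1` A) FU.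
have /filter_ex[x []//] : G (A `&` ~` A) by apply: filterI => //; exact: FG.
Qed.

(** The image ultrafilter lives on a compact interval. One ultrafilter thus makes the bounded
    sequences at all points t converge simultaneously, where subsequences would call for a diagonal
    extraction and an equicontinuity argument. *)
Lemma ultra_bounded_cvg (R : realType) (T : Type) (F : set_system T) (f : T -> R)
    (C : R) :
  UltraFilter F -> (\forall x \near F, `|f x| <= C) -> cvg (f @ F).
Proof.
move=> FU fC; have FfU := fmap_ultra f FU.
have := @segment_compact R (- C) C; rewrite compact_ultra => /(_ _ FfU).
case; last by move=> l [_ fl]; apply/cvg_ex; exists l.
by apply: filterS fC => x; rewrite /= in_itv/= ler_norml.
Qed.

Lemma cvg_pos_lt (R : realType) (T : Type) (F : set_system T) (FF : Filter F)
    (f : T -> R) (l b : R) : f @ F --> l -> l < b -> \forall x \near F, f x < b.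
Proof. by move=> fl lb; apply: (cvgr_lt l). Qed.

Definition mesh (R : realType) (L : R) (n : nat) : R := L / n.+1%:R.

Section limit.
Context {R : realType}.
Variables (L M C0 : R) (B : R -> R) (W : R -> R -> R) (x : nat -> nat -> R).
Hypotheses (L0 : 0 < L) (M0 : 0 <= M).
Hypothesis B_ge0 : forall t, 0 <= t <= L -> 0 <= B t.

(** Control is asked on compact subintervals of ]0, L[ only: at the ends [B] degenerates and [W] may
    be unbounded. *)
Definition locally_controlled (u v b0 b1 lB w1 lW : R) : Prop :=
  [/\ [/\ 0 < b0, 0 <= lB, 0 <= w1 & 0 <= lW],
      forall t, u <= t <= v -> b0 <= B t <= b1,
      forall s t, u <= s <= v -> u <= t <= v -> `|B t - B s| <= lB * `|t - s|,
      forall y t, 0 <= y <= M -> u <= t <= v -> `|W y t| <= w1 &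
      forall y z s t, 0 <= y <= M -> 0 <= z <= M ->
        u <= s <= v -> u <= t <= v ->
        `|W z t - W y s| <= lW * (`|z - y| + `|t - s|)].

Hypothesis loc : forall u v, 0 < u -> u < v -> v < L ->
  exists b0 b1 lB w1 lW, locally_controlled u v b0 b1 lB w1 lW.

Local Notation dt := (mesh L).
Let D (n : nat) := slope (dt n) (x n).
Let p (n : nat) := flux (dt n) B (x n).
Let Fc (n : nat) := cumulative_energy (dt n) B (x n).
Definition cell (n : nat) (t : R) : nat := Num.truncn (t / dt n).

Hypothesis xb : forall n i, (i <= n.+1)%N -> 0 <= x n i <= M.
Hypothesis EL : forall n i, (0 < i < n.+1)%N ->
  p n i - p n i.-1 = dt n * W (x n i) (node (dt n) i).
Hypothesis energy : forall n, Fc n n.+1 <= C0.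

Let dt0 n : 0 < dt n. Proof. by rewrite /mesh divr_gt0. Qed.

Let dtL n : node (dt n) n.+1 = L.
Proof. by rewrite /node /mesh mulrCA divff ?mulr1. Qed.

Let cell_itv n t : 0 <= t -> node (dt n) (cell n t) <= t < node (dt n) (cell n t) + dt n.
Proof.
move=> t0; have /truncn_itv : 0 <= t / dt n by rewrite divr_ge0// ltW.
by rewrite ler_pdivlMr// ltr_pdivrMr// -/(node _ _) -/(node _ (cell n t).+1) nodeS.
Qed.

Let cell_le n s t : s <= t -> (cell n s <= cell n t)%N.
Proof. by move=> st; apply: le_truncn; rewrite ler_pM2r// invr_gt0. Qed.

Let cell_ltn n t : 0 <= t < L -> (cell n t < n.+1)%N.
Proof.
by move=> /andP[t0 tL]; rewrite -(lt_node (dt0 n)) dtL; have := cell_itv n t0; lra.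
Qed.

Let Fc_bound n i : (i <= n.+1)%N -> 0 <= Fc n i <= C0.
Proof.
move=> iltn; have term0 j : (j < n.+1)%N ->
    0 <= dt n * (midweight (dt n) B j * slope (dt n) (x n) j ^+ 4).
  move=> jn; apply: mulr_ge0; first exact: ltW.
  apply: mulr_ge0; last by rewrite exprn_even_ge0.
  apply: B_ge0; have dn := dt0 n.
  have j0 : 0 <= node (dt n) j by rewrite mulr_ge0// ltW.
  have : node (dt n) j.+1 <= L by rewrite -[leRHS](dtL n) le_node.
  by rewrite nodeS; lra.
apply/andP; split.
  by apply: sumr_ge0 => j _; apply: term0; rewrite (leq_trans (ltn_ord j)).
apply: le_trans (energy n); rewrite /Fc /cumulative_energy.
rewrite -!(big_mkord xpredT (fun j => dt n * (midweight (dt n) B j * slope (dt n) (x n) j ^+ 4))).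
rewrite (big_cat_nat (leq0n i) iltn)/= lerDl big_nat sumr_ge0// => j /andP[_ jn].
exact: term0.
Qed.

Variable U : set_system nat.
Hypotheses (UU : UltraFilter U) (Uoo : \oo `<=` U).
#[local] Existing Instance UU.

Definition limit_value (t : R) : R := lim ((fun n => x n (cell n t)) @ U).
Definition limit_slope (t : R) : R := lim ((fun n => D n (cell n t)) @ U).
Definition limit_energy (t : R) : R := lim ((fun n => Fc n (cell n t)) @ U).

Local Notation psi := limit_value.
Local Notation DD := limit_slope.
Local Notation FF := limit_energy.

Let dt_cvg : dt @ U --> (0 : R).
Proof.
apply: (cvg_trans (cvg_app dt Uoo)); rewrite -(mulr0 L).
by apply: cvgMr; exact: cvg_harmonic.
Qed.

Let dt_near e : 0 < e -> \forall n \near U, dt n < e.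
Proof. by move=> e0; exact: cvg_pos_lt dt_cvg e0. Qed.

Let node_cvg t : 0 <= t -> (fun n => node (dt n) (cell n t)) @ U --> t.
Proof.
move=> t0; apply/cvgrPdist_lt => e e0.
apply: filterS (dt_near e0) => n dn; have := cell_itv n t0 => cn.
by rewrite /= ger0_norm; lra.
Qed.

Let inner_near u v t : 0 < u -> v < L -> u < t < v ->
  \forall n \near U, inner (dt n) u v (cell n t).
Proof.
move=> u0 vL /andP[ut tv].
have [ut' tv'] : 0 < t - u /\ 0 < v - t by rewrite !subr_gt0.
near=> n.
have d1 : dt n < t - u by near: n; exact: dt_near.
have d2 : dt n < v - t by near: n; exact: dt_near.
have := cell_itv n (t := t) ltac:(lra).
by rewrite /inner nodeS => ?; split; lra.
Unshelve. all: by end_near. Qed.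

Let duv_near u v : u < v -> \forall n \near U, 4 * dt n <= v - u.
Proof.
move=> uv; have uv0 : 0 < (v - u) / 4 by lra.
by apply: filterS (dt_near uv0) => n; lra.
Qed.

Let psi_cvg t : 0 < t < L -> (fun n => x n (cell n t)) @ U --> psi t.
Proof.
move=> tP; apply: (@ultra_bounded_cvg _ _ _ _ M UU); apply: nearW => n.
have := xb (ltnW (cell_ltn n (t := t) ltac:(lra))) => xP.
by rewrite /= ger0_norm; lra.
Qed.

Lemma psi_bound t : 0 < t < L -> 0 <= psi t <= M.
Proof.
move=> tP; have xP n := xb (ltnW (cell_ltn n (t := t) ltac:(lra))).
apply/andP; split.
  by apply: (ler_cvg_to (cvg_cst 0) (psi_cvg tP)); apply: nearW => n; case/andP: (xP n).
by apply: (ler_cvg_to (psi_cvg tP) (cvg_cst M)); apply: nearW => n; case/andP: (xP n).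
Qed.

Let FF_cvg t : 0 < t < L -> (fun n => Fc n (cell n t)) @ U --> FF t.
Proof.
move=> tP; apply: (@ultra_bounded_cvg _ _ _ _ C0 UU); apply: nearW => n.
have := Fc_bound (ltnW (cell_ltn n (t := t) ltac:(lra))) => xP.
by rewrite /= ger0_norm; lra.
Qed.

Lemma FF_bound t : 0 < t < L -> 0 <= FF t <= C0.
Proof.
move=> tP; have xP n := Fc_bound (ltnW (cell_ltn n (t := t) ltac:(lra))).
apply/andP; split.
  by apply: (ler_cvg_to (cvg_cst 0) (FF_cvg tP)); apply: nearW => n; case/andP: (xP n).
by apply: (ler_cvg_to (FF_cvg tP) (cvg_cst C0)); apply: nearW => n; case/andP: (xP n).
Qed.

Section window.
Variables (u v b0 b1 lB w1 lW : R).
Hypotheses (u0 : 0 < u) (uv : u < v) (vL : v < L).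
Hypothesis ctl : locally_controlled u v b0 b1 lB w1 lW.

Let sb := slope_bound M u v b0 b1 w1.
Let sm := slope_modulus M u v b0 b1 lB w1.
Let fb := flux_bound M u v b1 w1.

Let vn n : v < node (dt n) n.+1. Proof. by rewrite dtL. Qed.

Let window_in t : u < t < v -> 0 < t < L.
Proof. by move: u0 vL; lra. Qed.

Let DD_cvg_window t : u < t < v -> (fun n => D n (cell n t)) @ U --> DD t.
Proof.
have [[b00 lB0 w10 lW0] Bb Bl Wb Wl] := ctl.
move=> tP; apply: (@ultra_bounded_cvg _ _ _ _ sb UU).
near=> n; apply: (slope_le (dt0 n) M0 u0 _ (vn n) b00 w10 Bb Wb (@xb n) (@EL n)).
  by near: n; exact: duv_near.
by near: n; exact: inner_near.
Unshelve. all: by end_near. Qed.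

Let B_cvg_window t : u < t < v -> (fun n => midweight (dt n) B (cell n t)) @ U --> B t.
Proof.
have [[b00 lB0 w10 lW0] Bb Bl _ _] := ctl.
move=> tP; apply/cvgrPdist_le => e e0.
have e1 : 0 < e / (lB + 1) by apply: divr_gt0 => //; lra.
near=> n.
have dn : dt n < e / (lB + 1) by near: n; exact: dt_near.
have gn : inner (dt n) u v (cell n t) by near: n; exact: inner_near.
have := cell_itv n (t := t) ltac:(move: (window_in tP); lra) => cn.
move: gn; rewrite /inner nodeS => -[g1 g2]; have d0 := dt0 n.
apply: le_trans (Bl (node (dt n) (cell n t) + dt n / 2) t _ _) _; try lra.
apply: le_trans (_ : (lB + 1) * (e / (lB + 1)) <= _); last first.
  by rewrite mulrC divfK// gt_eqF//; lra.
apply: ler_pM => //; first lra.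
apply: le_trans (ltW dn); rewrite ler_norml; lra.
Unshelve. all: by end_near. Qed.

Let W_cvg_window t : u < t < v ->
  (fun n => W (x n (cell n t)) (node (dt n) (cell n t))) @ U --> W (psi t) t.
Proof.
have [[b00 lB0 w10 lW0] Bb Bl _ Wl] := ctl.
move=> tP; apply/cvgrPdist_le => e e0.
have e1 : 0 < e / (2 * (lW + 1)) by apply: divr_gt0 => //; lra.
have tL := window_in tP.
have /cvgrPdist_le/(_ _ e1) dn' := node_cvg (t := t) ltac:(lra).
have /cvgrPdist_le/(_ _ e1) pn' := psi_cvg tL.
near=> n.
have dn : `|t - node (dt n) (cell n t)| <= e / (2 * (lW + 1)).
  by near: n; exact: dn'.
have pn : `|psi t - x n (cell n t)| <= e / (2 * (lW + 1)).
  by near: n; exact: pn'.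
have [g1 g2] : inner (dt n) u v (cell n t) by near: n; exact: inner_near.
move: g2; rewrite nodeS => g2; have d0 := dt0 n.
have ct := cell_ltn n (t := t) ltac:(lra).
apply: le_trans (Wl _ _ _ _ (xb (ltnW ct)) (psi_bound tL) _ _) _; try lra.
apply: le_trans (_ : (lW + 1) * (e / (lW + 1)) <= _); last first.
  by rewrite mulrC divfK// gt_eqF//; lra.
apply: ler_pM => //; first lra.
have : e / (lW + 1) = e / (2 * (lW + 1)) + e / (2 * (lW + 1)) by field; lra.
lra.
Unshelve. all: by end_near. Qed.

Let flux_cvg_window t : u < t < v ->
  (fun n => p n (cell n t)) @ U --> B t * DD t ^+ 3.
Proof.
move=> tP; apply: cvgM; first exact: B_cvg_window.
exact: (continuous_cvg _ (@exprn_continuous _ 3 _) (DD_cvg_window tP)).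
Qed.

Let span_cvg s t : u < s < v -> u < t < v ->
  (fun n => node (dt n) (cell n t) - node (dt n) (cell n s)) @ U --> t - s.
Proof.
by move=> sP tP; apply: cvgB; apply: node_cvg; move: u0 sP tP; lra.
Qed.

Let increment_cvg (y r : nat -> nat -> R) (s t c Ys Yt Rc : R) :
  u < s < v -> u < t < v ->
  (fun n => y n (cell n s)) @ U --> Ys -> (fun n => y n (cell n t)) @ U --> Yt ->
  (fun n => r n (cell n c)) @ U --> Rc ->
  (fun n => `|y n (cell n t) - y n (cell n s)
     - (node (dt n) (cell n t) - node (dt n) (cell n s)) * r n (cell n c)|) @ U
  --> `|Yt - Ys - (t - s) * Rc|.
Proof.
move=> sP tP ys yt rc; apply: cvg_norm; apply: cvgB; first exact: cvgB.
by apply: cvgM => //; exact: span_cvg.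
Qed.

Let cell_between n s t c : s <= t -> c = s \/ c = t ->
  (cell n s <= cell n c <= cell n t)%N.
Proof. by move=> st [] ->; rewrite leqnn cell_le. Qed.

Let endpoint s t c : u < s < v -> u < t < v -> c = s \/ c = t -> u < c < v.
Proof. by move=> sP tP [] ->. Qed.

(** The condition on [e] is strict so that it holds eventually on the grids, whose spans only
    converge to [t - s]. The reference point [c] is either end, because a two-sided derivative
    compares with the slope at the right end for increments on the left and at the left end for
    increments on the right. *)
Let psi_increment s t c e : u < s < v -> u < t < v -> s <= t -> c = s \/ c = t ->
  0 <= e -> sm * (t - s) < e ^+ 3 ->
  `|psi t - psi s - (t - s) * DD c| <= e * (t - s).
Proof.
have [[b00 lB0 w10 lW0] Bb Bl Wb Wl] := ctl.
move=> sP tP st cP e0 eP; have cin := endpoint sP tP cP.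
apply: (ler_cvg_to (increment_cvg sP tP (psi_cvg (window_in sP)) (psi_cvg (window_in tP))
  (DD_cvg_window cin)) (cvgMr (span_cvg sP tP) (a := e))).
near=> n.
apply: (value_increment (dt0 n) M0 u0 _ (vn n) b00 lB0 w10 Bb Bl Wb (@xb n) (@EL n)) => //.
- by near: n; exact: duv_near.
- by near: n; exact: inner_near.
- by near: n; exact: inner_near.
- exact: cell_between.
- apply: ltW; near: n; apply: cvg_pos_lt eP; apply: cvgMr; exact: span_cvg.
Unshelve. all: by end_near. Qed.

Let flux_increment_lim s t c : u < s < v -> u < t < v -> s <= t -> c = s \/ c = t ->
  `|B t * DD t ^+ 3 - B s * DD s ^+ 3 - (t - s) * W (psi c) c|
    <= lW * (sb + 1) * (t - s) * (t - s).
Proof.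
have [[b00 lB0 w10 lW0] Bb Bl Wb Wl] := ctl.
move=> sP tP st cP; have cin := endpoint sP tP cP.
have sc := span_cvg sP tP.
apply: (ler_cvg_to (increment_cvg (r := fun n i => W (x n i) (node (dt n) i)) sP tP
  (flux_cvg_window sP) (flux_cvg_window tP) (W_cvg_window cin))
  (cvgM (cvgMr sc (a := lW * (sb + 1))) sc)).
near=> n.
apply: (flux_increment (dt0 n) M0 u0 _ (vn n) b00 w10 lW0 Bb Wb Wl (@xb n) (@EL n)) => //.
- by near: n; exact: duv_near.
- by near: n; exact: inner_near.
- by near: n; exact: inner_near.
- exact: cell_between.
Unshelve. all: by end_near. Qed.

Let FF_increment s t c e : u < s < v -> u < t < v -> s <= t -> c = s \/ c = t ->
  0 <= e -> sm * (t - s) < e ^+ 3 ->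
  `|FF t - FF s - (t - s) * (B c * DD c ^+ 4)|
   <= (w1 * (t - s) * sb + fb * e) * (t - s).
Proof.
have [[b00 lB0 w10 lW0] Bb Bl Wb Wl] := ctl.
move=> sP tP st cP e0 eP; have cin := endpoint sP tP cP.
have sc := span_cvg sP tP.
apply: (ler_cvg_to (increment_cvg (r := fun n i => midweight (dt n) B i * D n i ^+ 4) sP tP
  (FF_cvg (window_in sP)) (FF_cvg (window_in tP)) _)
  (cvgM (cvgD (cvgMl (cvgMr sc (a := w1)) (b := sb)) (cvg_cst (fb * e))) sc)).
  apply: cvgM; first exact: B_cvg_window.
  exact: (continuous_cvg _ (@exprn_continuous _ 4 _) (DD_cvg_window cin)).
near=> n.
apply: (energy_increment (dt0 n) M0 u0 _ (vn n) b00 lB0 w10 Bb Bl Wb (@xb n) (@EL n)) => //.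
- by near: n; exact: duv_near.
- by near: n; exact: inner_near.
- by near: n; exact: inner_near.
- exact: cell_between.
- apply: ltW; near: n; apply: cvg_pos_lt eP; apply: cvgMr; exact: span_cvg.
Unshelve. all: by end_near. Qed.

Let bounds_ge0 : [/\ 0 <= sb, 0 <= sm & 0 <= fb].
Proof.
have [[b00 lB0 w10 lW0] Bb Bl Wb Wl] := ctl.
have M0' := M0; have uv' := uv.
have b10 : 0 <= b1 by have := Bb u ltac:(lra); lra.
have fb0 : 0 <= fb.
  by rewrite /fb /flux_bound addr_ge0// mulr_ge0 ?exprn_ge0 ?divr_ge0//; lra.
have sb0 : 0 <= sb by rewrite /sb /slope_bound addr_ge0// divr_ge0// ltW.
by split=> //; rewrite /sm /slope_modulus mulr_ge0// divr_ge0 ?(ltW b00)// addr_ge0// mulr_ge0// exprn_ge0.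
Qed.

(** [E e h] is the relative error over a span [h] for an admissible [e]. A suitable [e1] is fixed
    first; then the radius is cut down so that one stays in the window, [E] is small, and
    [sm * h < e1 ^+ 3]. *)
Let derive_of_increments (f r : R -> R) (E : R -> R -> R) :
  (forall s t c e, u < s < v -> u < t < v -> s <= t -> c = s \/ c = t ->
    0 <= e -> sm * (t - s) < e ^+ 3 ->
    `|f t - f s - (t - s) * r c| <= E e (t - s) * (t - s)) ->
  (forall e, 0 < e -> exists e1 d, [/\ 0 < e1, 0 < d &
     forall h, 0 <= h < d -> E e1 h <= e]) ->
  forall t, u < t < v -> is_derive t 1 f (r t).
Proof.
move=> fr EE t tP; apply/is_derive1P => e e0.
have [e1 [d [e10 d0 dE]]] := EE e e0.
have [_ sm0 _] := bounds_ge0.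
have sm1 : 0 < e1 ^+ 3 / (sm + 1) by rewrite divr_gt0 ?exprn_gt0//; lra.
exists (Num.min (Num.min (t - u) (v - t)) (Num.min d (e1 ^+ 3 / (sm + 1)))).
  by rewrite !lt_min d0 sm1 !andbT; lra.
move=> y; rewrite !lt_min => /andP[/andP[yu yv] /andP[yd ye]].
have hsm h : 0 <= h < e1 ^+ 3 / (sm + 1) -> sm * h < e1 ^+ 3.
  by move=> /andP[h0]; rewrite ltr_pdivlMr; [nra|lra].
have [ty|/ltW yt] := leP t y.
  move: yu yv yd ye; rewrite ger0_norm ?subr_ge0// => yu yv yd ye.
  apply: le_trans (fr t y t e1 tP _ ty (or_introl erefl) (ltW e10) _) _; first lra.
    by apply: hsm; lra.
  by rewrite ler_wpM2r ?dE//; lra.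
move: yu yv yd ye; rewrite ler0_norm ?subr_le0// opprB => yu yv yd ye.
have -> : f y - f t - (y - t) * r t = - (f t - f y - (t - y) * r t) by ring.
rewrite normrN.
apply: le_trans (fr y t t e1 _ tP yt (or_intror erefl) (ltW e10) _) _; first lra.
  by apply: hsm; lra.
by rewrite ler_wpM2r ?dE//; lra.
Qed.

Lemma window_derivatives t : u < t < v ->
  [/\ is_derive t 1 psi (DD t),
      is_derive t 1 (fun s => B s * DD s ^+ 3) (W (psi t) t) &
      is_derive t 1 FF (B t * DD t ^+ 4)].
Proof.
have [sb0 sm0 fb0] := bounds_ge0.
have [[b00 lB0 w10 lW0] _ _ _ _] := ctl.
move=> tP; split.
- apply: (derive_of_increments (E := fun e _ => e) psi_increment) => // e e0.
  by exists e, 1; split.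
- apply: (@derive_of_increments _ (fun t => W (psi t) t) (fun _ h => lW * (sb + 1) * h)) => //.
    by move=> s t' c e *; exact: flux_increment_lim.
  move=> e e0; have C0' : 0 <= lW * (sb + 1) by rewrite mulr_ge0//; lra.
  exists 1, (e / (lW * (sb + 1) + 1)); split => //.
    by rewrite divr_gt0//; lra.
  by move=> h /andP[h0]; rewrite ltr_pdivlMr; [nra|lra].
- apply: (@derive_of_increments _ (fun t => B t * DD t ^+ 4)
    (fun e h => w1 * h * sb + fb * e) FF_increment) => // e e0.
  have w0 : 0 <= w1 * sb by rewrite mulr_ge0.
  exists (e / (2 * (fb + 1))), (e / (2 * (w1 * sb + 1))); split.
  + by rewrite divr_gt0//; lra.
  + by rewrite divr_gt0//; lra.
  + move=> h /andP[h0 h1].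
    have : fb * (e / (2 * (fb + 1))) <= e / 2.
      rewrite mulrA ler_pdivrMr; [nra|lra].
    by move: h1; rewrite ltr_pdivlMr; [nra|lra].
Qed.

End window.

Lemma limit_derivatives t : 0 < t < L ->
  [/\ is_derive t 1 psi (DD t),
      is_derive t 1 (fun s => B s * DD s ^+ 3) (W (psi t) t) &
      is_derive t 1 FF (B t * DD t ^+ 4)].
Proof.
move=> tP; have [b0 [b1 [lB [w1 [lW ctl]]]]] :=
  @loc (t / 2) ((t + L) / 2) ltac:(lra) ltac:(lra) ltac:(lra).
by apply: (window_derivatives _ _ _ ctl); lra.
Qed.

(** Asking for the bound at all nodes within one mesh of [t] covers the left end of the cell of [t]
    without mentioning cells; barriers provide it in this form. *)
Lemma limit_ge t m : 0 < t < L ->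
  (\forall n \near \oo, forall i, `|node (dt n) i - t| <= dt n -> m <= x n i) ->
  m <= psi t.
Proof.
move=> tP /Uoo H; apply: (ler_cvg_to (cvg_cst m) (psi_cvg tP)).
apply: filterS H => n; apply; have := cell_itv n (t := t) ltac:(lra).
by have := dt0 n; rewrite ler_norml; lra.
Qed.

Lemma limit_le t m : 0 < t < L ->
  (\forall n \near \oo, forall i, `|node (dt n) i - t| <= dt n -> x n i <= m) ->
  psi t <= m.
Proof.
move=> tP /Uoo H; apply: (ler_cvg_to (psi_cvg tP) (cvg_cst m)).
apply: filterS H => n; apply; have := cell_itv n (t := t) ltac:(lra).
by have := dt0 n; rewrite ler_norml; lra.
Qed.

End limit.

Lemma discrete_limit (R : realType) (L M C0 : R) (B : R -> R) (W : R -> R -> R)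
    (x : nat -> nat -> R) (dt := mesh L) :
  0 < L -> 0 <= M -> (forall t, 0 <= t <= L -> 0 <= B t) ->
  (forall u v, 0 < u -> u < v -> v < L ->
    exists b0 b1 lB w1 lW, locally_controlled M B W u v b0 b1 lB w1 lW) ->
  (forall n i, (i <= n.+1)%N -> 0 <= x n i <= M) ->
  (forall n i, (0 < i < n.+1)%N ->
    flux (dt n) B (x n) i - flux (dt n) B (x n) i.-1
    = dt n * W (x n i) (node (dt n) i)) ->
  (forall n, cumulative_energy (dt n) B (x n) n.+1 <= C0) ->
  exists psi D F : R -> R,
    [/\ forall t, 0 < t < L -> 0 <= psi t <= M /\ 0 <= F t <= C0,
        forall t, 0 < t < L -> [/\ is_derive t 1 psi (D t),
          is_derive t 1 (fun s => B s * D s ^+ 3) (W (psi t) t) &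
          is_derive t 1 F (B t * D t ^+ 4)],
        forall t m, 0 < t < L ->
          (\forall n \near \oo, forall i,
             `|node (dt n) i - t| <= dt n -> m <= x n i) -> m <= psi t &
        forall t m, 0 < t < L ->
          (\forall n \near \oo, forall i,
             `|node (dt n) i - t| <= dt n -> x n i <= m) -> psi t <= m].
Proof.
move=> L0 M0 B0 loc xb EL en.
have [U [UU Uoo]] := ultraFilterLemma (T := nat) (F := \oo) _.
exists (limit_value L x U), (limit_slope L x U), (limit_energy L B x U); split.
- move=> t tP; split; first exact: psi_bound.
  exact: FF_bound.
- by move=> t tP; exact: (limit_derivatives L0 M0 B0 loc xb EL en UU Uoo).
- by move=> t m tP; exact: (limit_ge L0 xb UU Uoo tP).
- by move=> t m tP; exact: (limit_le L0 xb UU Uoo tP).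
Qed.

(** * Barriers: discrete sub- and supersolutions *)

Lemma ler_sum_nat_const (R : numDomainType) (n : nat) (F : nat -> R) (c : R) :
  (forall i, (i < n)%N -> F i <= c) -> \sum_(i < n) F i <= n%:R * c.
Proof.
move=> Fc; apply: le_trans (_ : \sum_(i < n) c <= _).
  by apply: ler_sum => i _; exact: Fc.
by rewrite sumr_const card_ord mulr_natl.
Qed.

Lemma mesh_gt0 (R : realType) (L : R) n : 0 < L -> 0 < mesh L n.
Proof. by move=> L0; rewrite /mesh divr_gt0. Qed.

Lemma node_mesh (R : realType) (L : R) n : node (mesh L n) n.+1 = L.
Proof. by rewrite /node /mesh mulrCA divff ?mulr1. Qed.

Lemma node_itv (R : realType) (L : R) n i : 0 < L -> (i <= n.+1)%N ->
  0 <= node (mesh L n) i <= L.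
Proof.
move=> L0 iltn; have d0 := mesh_gt0 n L0.
by rewrite -[X in _ && (_ <= X)](node_mesh L n) le_node// iltn andbT mulr_ge0// ltW.
Qed.

Lemma midnode_itv (R : realType) (L : R) n i : 0 < L -> (i < n.+1)%N ->
  0 <= node (mesh L n) i + mesh L n / 2 <= L.
Proof.
move=> L0 iltn; have := node_itv L0 iltn; have := node_itv L0 (ltnW iltn).
by have := mesh_gt0 n L0; rewrite nodeS; lra.
Qed.

Lemma mesh_cvg (R : realType) (L e : R) : 0 < e -> \forall n \near \oo, mesh L n < e.
Proof.
move=> e0; apply: (cvgr_lt 0) => //.
by rewrite -(mulr0 L); apply: cvgMr; exact: cvg_harmonic.
Qed.

Section cube_root.
Context {R : realType}.

Definition cube_root (x : R) : R := x `^ (3^-1).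

Lemma cube_root_ge0 x : 0 <= cube_root x. Proof. exact: powR_ge0. Qed.

Lemma cube_rootK x : 0 <= x -> cube_root x ^+ 3 = x.
Proof. by move=> x0; rewrite /cube_root -powR_mulrn ?powR_ge0// -powRrM mulVf// powRr1. Qed.

End cube_root.

(* Net upward force [flux i.-1 - flux i + dt W] on the node [i]; it vanishes for a discrete solution. *)
Definition residual (R : realType) (dt : R) (B : R -> R) (W : R -> R -> R) (x : nat -> R)
    (i : nat) : R :=
  flux dt B x i.-1 - flux dt B x i + dt * W (x i) (node dt i).

Section barrier.
Context {R : realType}.
Variables (L T1 T4 b0 b1 y1 cW : R) (B : R -> R) (W : R -> R -> R).
Hypotheses (L0 : 0 < L) (T10 : 0 < T1) (T14 : T1 < T4).
Hypotheses (b00 : 0 < b0) (cW0 : 0 < cW).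
Hypothesis Bb : forall t, T1 <= t <= T4 -> b0 <= B t <= b1.
Hypothesis W0 : forall t, 0 <= t <= L -> W 0 t <= 0.
Hypothesis Wle0 : forall y t, T1 <= t <= L -> 0 <= y <= y1 -> W y t <= 0.
Hypothesis Wlt0 : forall y t, T1 <= t <= T4 -> 0 <= y <= y1 -> W y t <= - cW * y.

(** [T1, T4] is cut into thirds of length [ell3]: the flux profile [q] is 1 on the first and falls
    linearly to 0 on the second, so the barrier rises, flattens and stays constant. The last third
    leaves room for the cells that straddle [T3]. *)
Let T2 := T1 + (T4 - T1) / 3.
Let T3 := T1 + (T4 - T1) * 2 / 3.
Let ell3 := (T4 - T1) / 3.

Let ell30 : 0 < ell3. Proof. by rewrite divr_gt0// subr_gt0. Qed.

(* The flux of the barrier (up to a factor): it may jump upwards at [T1], and decreases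
   only where the barrier is bounded away from 0. *)
Let q (t : R) : R := if t < T1 then 0 else Num.max 0 (Num.min 1 ((T3 - t) / ell3)).

Let q_ge0 t : 0 <= q t.
Proof. by rewrite /q; case: ifP => // _; rewrite le_max lexx. Qed.

Let q_le1 t : q t <= 1.
Proof. by rewrite /q; case: ifP => // _; rewrite ge_max ler01 ge_min lexx. Qed.

Let q_left t : t < T1 -> q t = 0. Proof. by rewrite /q => ->. Qed.

Let q_right t : T3 <= t -> q t = 0.
Proof.
move=> t3; rewrite /q; case: ifP => // _; apply/max_idPl.
by rewrite ge_min; apply/orP; right; rewrite pmulr_lle0 ?invr_gt0// subr_le0.
Qed.

Let q_plateau t : T1 <= t <= T2 -> q t = 1.
Proof.
move=> /andP[t1 t2]; rewrite /q ltNge t1/=.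
have -> : Num.min 1 ((T3 - t) / ell3) = 1.
  apply/min_idPl; rewrite ler_pdivlMr//.
  by move: t2 ell30; rewrite /T2 /T3 /ell3; lra.
by apply/max_idPr.
Qed.

Let q_decrease s t : s <= t -> T1 <= t -> q s - q t <= (t - s) / ell3.
Proof.
move=> st t1; have st0 : 0 <= (t - s) / ell3 by rewrite divr_ge0 ?subr_ge0// ltW.
rewrite /q [t < T1]ltNge t1/=; case: ifP => _; first by rewrite sub0r (le_trans _ st0)// oppr_le0 le_max lexx.
have -> : (T3 - s) / ell3 = (T3 - t) / ell3 + (t - s) / ell3 by rewrite -mulrDl; congr (_ / _); ring.
move: st0; set a := (T3 - t) / ell3; set b := (t - s) / ell3 => b0'.
rewrite lerBlDl ge_max ge_min; apply/andP; split.
  by rewrite addr_ge0// le_max lexx.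
have [h1|h1] := leP 1 a.
  by apply/orP; left; rewrite (max_idPr ler01); lra.
by apply/orP; right; rewrite lerD2r le_max lexx orbT.
Qed.

Variable n : nat.
Let dt := mesh L n.
Hypothesis dtT : 2 * dt <= ell3.

Let dt0 : 0 < dt. Proof. exact: mesh_gt0. Qed.

Let sigma (i : nat) : R := cube_root (q (node dt i) / midweight dt B i).

Let mid_in i : q (node dt i) != 0 -> b0 <= midweight dt B i <= b1.
Proof.
move=> qi; have ti : T1 <= node dt i by rewrite leNgt; apply: contra qi => /q_left ->.
have ti3 : node dt i < T3 by rewrite ltNge; apply: contra qi => /q_right ->.
apply: Bb; move: dt0 dtT ti3; rewrite /T3 /ell3; lra.
Qed.

Let sigma3 i : midweight dt B i * sigma i ^+ 3 = q (node dt i).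
Proof.
have [q0|qi] := eqVneq (q (node dt i)) 0.
  by rewrite q0 /sigma q0 mul0r /cube_root powR0 ?invr_eq0// expr0n mulr0.
have mi := mid_in qi; have b00' := b00.
by rewrite /sigma cube_rootK ?mulr_ge0 ?invr_ge0//; [field|]; lra.
Qed.

(** Bounds for the cube root of 1 / B that avoid roots: [s1 >= 1] is below its cube, [s0 <= 1] is
    above its cube. *)
Let s1 := 1 + b0^-1.
Let s0 := (1 + b1)^-1.

Let b10 : 0 < b1.
Proof. by have := Bb (t := T1) ltac:(move: T14; lra); move: b00; lra. Qed.

Let s00 : 0 < s0. Proof. by rewrite invr_gt0; move: b10; lra. Qed.
Let s10 : 0 < s1. Proof. by apply: ltr_pwDl => //; rewrite invr_ge0 ltW. Qed.

Let sigma_le i : 0 <= sigma i <= s1.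
Proof.
rewrite cube_root_ge0/=; apply: ler_cube_cancel; first exact: ltW.
have s11 : 1 <= s1 by rewrite /s1 lerDl invr_ge0 ltW.
apply: le_trans (_ : s1 <= _); last by apply: ler_eXnr.
have [qi|qi] := eqVneq (q (node dt i)) 0.
  by rewrite /sigma qi mul0r /cube_root powR0 ?invr_eq0// expr0n/= ltW.
have mi := mid_in qi; have b00' := b00.
rewrite cube_rootK ?mulr_ge0 ?invr_ge0//; last lra.
apply: le_trans (_ : b0^-1 <= _); last by rewrite /s1 lerDr.
by rewrite -[leRHS]mul1r ler_pM// ?lef_pV2 ?posrE ?invr_ge0//; lra.
Qed.

Let sigma_ge i : T1 <= node dt i <= T2 -> s0 <= sigma i.
Proof.
move=> ti; have qi := q_plateau ti.
have mi := mid_in (i := i) ltac:(by rewrite qi oner_eq0); have b00' := b00.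
apply: ler_cube_cancel; first exact: cube_root_ge0.
rewrite /sigma qi mul1r cube_rootK ?invr_ge0//; last lra.
apply: le_trans (_ : s0 <= _).
  by apply: ler_iXnr => //; [exact: ltW|rewrite invf_le1//; lra].
by rewrite lef_pV2 ?posrE//; lra.
Qed.

Variable eps : R.
Hypothesis eps0 : 0 < eps.
Hypothesis eps2 : eps * s1 * L <= y1.
Hypothesis eps3 : eps ^+ 2 <= cW * s0 * ell3 / 2 * ell3.

Definition barrier (i : nat) : R := \sum_(j < i) eps * (dt * sigma j).

Let barrierS i : barrier i.+1 = barrier i + eps * (dt * sigma i).
Proof. by rewrite /barrier big_ord_recr. Qed.

Let flux_barrier i : flux dt B barrier i = eps ^+ 3 * q (node dt i).
Proof.
rewrite /flux /slope barrierS addrAC subrr add0r -sigma3.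
have -> : eps * (dt * sigma i) / dt = eps * sigma i by field; rewrite gt_eqF.
by ring.
Qed.

Lemma barrier_ge0 i : 0 <= barrier i.
Proof.
apply: sumr_ge0 => j _; apply: mulr_ge0; first exact: ltW.
by apply: mulr_ge0; [exact: ltW|exact: cube_root_ge0].
Qed.

Lemma barrier_le_lin i : barrier i <= eps * s1 * node dt i.
Proof.
elim: i => [|i IH]; first by rewrite /barrier big_ord0 /node mul0r mulr0.
rewrite barrierS nodeS mulrDr lerD// -mulrA ler_pM2l// mulrC ler_pM2r//.
by case/andP: (sigma_le i).
Qed.

Lemma barrier_le i : (i <= n.+1)%N -> barrier i <= eps * s1 * L.
Proof.
move=> iltn; apply: le_trans (barrier_le_lin i) _; rewrite ler_pM2l ?mulr_gt0//.
by case/andP: (node_itv L0 iltn).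
Qed.

Lemma barrier_ge i : T2 <= node dt i -> eps * (s0 * (ell3 / 2)) <= barrier i.
Proof.
(* The loss of [dt] accounts for the cell containing [T1], on which the slope may still be 0. As
   [2 * dt <= ell3], at least half of the first third remains. *)
suff H j : eps * (s0 * (Num.min (node dt j) T2 - T1 - dt)) <= barrier j.
  move=> ti; apply: le_trans (H i); rewrite ler_pM2l// ler_pM2l// (min_idPr ti).
  by move: dtT; rewrite /T2 -/ell3; lra.
elim: j => [|j IH].
  apply: le_trans (barrier_ge0 0); rewrite pmulr_rle0// pmulr_rle0//.
  have : Num.min (node dt 0) T2 <= 0 by rewrite ge_min /node mul0r lexx.
  by move: dt0 T10; lra.
rewrite barrierS; have [jT1|jT1] := ltP (node dt j) T1.
  apply: le_trans (_ : 0 <= _).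
    rewrite pmulr_rle0// pmulr_rle0//.
    have : Num.min (node dt j.+1) T2 <= node dt j + dt by rewrite ge_min nodeS lexx.
    by lra.
  by rewrite addr_ge0 ?barrier_ge0// mulr_ge0 ?(ltW eps0)// mulr_ge0 ?(ltW dt0)// cube_root_ge0.
have [jT2|jT2] := leP (node dt j) T2.
  have sj := sigma_ge (i := j) ltac:(by rewrite jT1 jT2).
  have m1 : Num.min (node dt j.+1) T2 <= Num.min (node dt j) T2 + dt.
    by rewrite (min_idPl jT2) ge_min nodeS lexx.
  apply: le_trans (_ : eps * (s0 * (Num.min (node dt j) T2 - T1 - dt)) + eps * (dt * s0) <= _).
    rewrite -mulrDr ler_pM2l// (mulrC dt) -mulrDr ler_pM2l//; lra.
  by rewrite lerD// ler_pM2l// ler_pM2l.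
have m1 : Num.min (node dt j.+1) T2 = Num.min (node dt j) T2.
  by rewrite !(min_idPr _)// ?nodeS; move: dt0; lra.
rewrite m1; apply: le_trans IH _; rewrite lerDl.
by rewrite mulr_ge0 ?(ltW eps0)// mulr_ge0 ?(ltW dt0)// cube_root_ge0.
Qed.

Let barrier_left i : node dt i <= T1 -> barrier i = 0.
Proof.
move=> ti; apply: big1 => -[j ji] _ /=.
have tj : node dt j < T1 by apply: lt_le_trans ti; rewrite lt_node.
by rewrite /sigma q_left// mul0r /cube_root powR0 ?invr_eq0// !mulr0.
Qed.

(** Where the flux falls, it loses at most eps^3 dt / ell3 across a node, while the barrier already
    has height at least eps s0 ell3 / 2, so that the force compensates with dt cW times this height;
    [eps3] says that the force wins. *)
Lemma barrier_subsolution i : (0 < i < n.+1)%N -> residual dt B W barrier i <= 0.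
Proof.
move=> /andP[i0 iltn].
have iL := node_itv L0 (ltnW iltn).
have bi1 := barrier_ge0 i; have bi2 := barrier_le (ltnW iltn); have eps2' := eps2.
have predE : node dt i = node dt i.-1 + dt by rewrite -{1}(prednK i0) nodeS.
have dt0' := dt0; have dtT' := dtT; have ell30' := ell30.
have T2E : T2 = T1 + ell3 by []. have T3E : T3 = T1 + 2 * ell3 by rewrite /T3 /ell3; lra.
have T4E : T4 = T1 + 3 * ell3 by rewrite /ell3; lra.
rewrite /residual !flux_barrier -mulrBr.
have Wi : W (barrier i) (node dt i) <= 0.
  have [ti|ti] := ltP (node dt i) T1; first by rewrite (barrier_left (ltW ti)); exact: W0.
  by apply: Wle0; rewrite ?bi1; lra.
have e3 : 0 < eps ^+ 3 by rewrite exprn_gt0.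
have dW : dt * W (barrier i) (node dt i) <= 0 by rewrite pmulr_rle0.
(* If the flux does not decrease across the node, the sign of [W] suffices. Otherwise the node lies
   beyond [T2] and its predecessor before [T3]. *)
have [qq|qq] := leP (q (node dt i.-1) - q (node dt i)) 0.
  by rewrite -[0]addr0 lerD// pmulr_rle0.
have ti2 : T2 < node dt i.
  rewrite ltNge; apply/negP => ti2.
  have [ti1|ti1] := ltP (node dt i) T1.
    by move: qq; rewrite !q_left//; lra.
  by move: qq; have := q_le1 (node dt i.-1); rewrite (q_plateau (t := node dt i)) ?ti1//; lra.
have ti3 : node dt i.-1 < T3.
  rewrite ltNge; apply/negP => ti3.
  by move: qq; rewrite !q_right//; lra.
have Wc := Wlt0 (y := barrier i) (t := node dt i) ltac:(lra) ltac:(lra).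
have bg := barrier_ge (ltW ti2).
have qd := q_decrease (s := node dt i.-1) (t := node dt i) ltac:(lra) ltac:(lra).
have dE : node dt i - node dt i.-1 = dt by rewrite predE; ring.
rewrite dE in qd.
apply: le_trans (_ : eps ^+ 3 * (dt / ell3) - dt * (cW * (eps * (s0 * (ell3 / 2)))) <= _).
  apply: lerD; first by rewrite ler_pM2l.
  rewrite -mulrN ler_pM2l//; apply: le_trans Wc _.
  by rewrite mulNr lerN2 ler_pM2l.
have -> : eps ^+ 3 * (dt / ell3) - dt * (cW * (eps * (s0 * (ell3 / 2)))) =
  eps * dt / ell3 * (eps ^+ 2 - cW * s0 * ell3 / 2 * ell3).
  by field; lra.
rewrite pmulr_rle0 ?subr_le0//.
by rewrite divr_gt0// mulr_gt0.
Qed.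

End barrier.

Lemma barriers_exist (R : realType) (L M m0 T1 T4 b0 b1 y1 cW : R) (B : R -> R)
    (W : R -> R -> R) :
  0 < L -> 0 < M -> 0 < m0 -> 0 < T1 -> T1 < T4 -> T4 < L -> 0 < b0 -> 0 < y1 -> 0 < cW ->
  (forall t, T1 <= t <= T4 -> b0 <= B t <= b1) ->
  (forall t, 0 <= t <= L -> W 0 t <= 0) ->
  (forall y t, T1 <= t <= L -> 0 <= y <= y1 -> W y t <= 0) ->
  (forall y t, T1 <= t <= T4 -> 0 <= y <= y1 -> W y t <= - cW * y) ->
  exists (lo : nat -> nat -> R) (delta : R), [/\ 0 < delta,
    forall n i, (i <= n.+1)%N ->
      [/\ 0 <= lo n i, lo n i <= M / 2 & lo n i <= m0 * node (mesh L n) i],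
    forall n i, (0 < i < n.+1)%N -> residual (mesh L n) B W (lo n) i <= 0 &
    \forall n \near \oo, forall i, T4 <= node (mesh L n) i -> delta <= lo n i].
Proof.
move=> L0 M0 m00 T10 T14 T4L b00 y10 cW0 Bb W0 Wle0 Wlt0.
have Bt1 := Bb T1 ltac:(lra).
pose l3 := (T4 - T1) / 3; pose s1 := 1 + b0^-1; pose s0 := (1 + b1)^-1.
have l30 : 0 < l3 by rewrite divr_gt0; lra.
have s10 : 0 < s1 by apply: ltr_pwDl => //; rewrite invr_ge0 ltW.
have s00 : 0 < s0 by rewrite invr_gt0; lra.
pose k := cW * s0 * l3 / 2 * l3.
have k0 : 0 < k by do 4!(apply: mulr_gt0 || apply: divr_gt0) => //.
(* The terms secure, in turn: height at most [M / 2], leaving room for an upper barrier, and at most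
   [y1]; [eps ^+ 2 <= k], through [eps <= 1] and [eps <= k]; slope at most [m0], which puts the
   barrier below the competitor. *)
pose eps := Num.min (Num.min (M / 2) y1 / (s1 * L)) (Num.min (Num.min 1 k) (m0 / s1)).
have s1L : 0 < s1 * L by rewrite mulr_gt0.
have eps0 : 0 < eps by rewrite /eps !lt_min ltr01 k0 (divr_gt0 m00)// !andbT divr_gt0// lt_min y10 andbT; lra.
have epsm : eps * s1 * L <= Num.min (M / 2) y1.
  by rewrite -mulrA -ler_pdivlMr// /eps ge_min lexx.
have eps1 : eps * s1 * L <= M / 2 by apply: le_trans epsm _; rewrite ge_min lexx.
have eps2 : eps * s1 * L <= y1 by apply: le_trans epsm _; rewrite ge_min lexx orbT.
have eps4 : eps * s1 <= m0 by rewrite -ler_pdivlMr// /eps !ge_min lexx !orbT.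
have eps3 : eps ^+ 2 <= k.
  have e1 : eps <= 1 by rewrite /eps !ge_min lexx !orbT.
  have ek : eps <= k by rewrite /eps !ge_min lexx !orbT.
  by rewrite expr2; apply: le_trans ek; rewrite ger_pMr.
(* On coarse grids the constant 0 serves as subsolution, since [W 0 t <= 0]. *)
pose lo n := if 2 * mesh L n <= l3 then barrier L T1 T4 B n eps else cst 0.
exists lo, (eps * (s0 * (l3 / 2))); split.
- by do 3!(apply: mulr_gt0 || apply: divr_gt0) => //.
- move=> n i iltn; rewrite /lo; case: ifPn => dn; last first.
    have ni := node_itv L0 iltn.
    split => //=; first by lra.
    by rewrite mulr_ge0//; lra.
  have nodei := node_itv L0 iltn.
  split; first exact: barrier_ge0.
    exact: le_trans (barrier_le L0 T14 b00 Bb dn eps0 iltn) eps1.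
  apply: le_trans (barrier_le_lin L0 T14 b00 Bb dn eps0 i) _.
  by apply: ler_wpM2r => //; lra.
- move=> n i iP; rewrite /lo; case: ifPn => dn.
    exact: (barrier_subsolution L0 T10 T14 b00 cW0 Bb W0 Wle0 Wlt0 dn eps0 eps2 eps3 iP).
  rewrite /residual /flux /slope /= subrr mul0r expr0n/= !mulr0 subrr add0r.
  rewrite pmulr_rle0 ?mesh_gt0// W0// node_itv// ltnW//.
  by case/andP: iP.
- have : 0 < l3 / 2 by lra.
  move=> /(mesh_cvg L); apply: filterS => n dn i ti.
  rewrite /lo ifT; last by lra.
  by apply: (barrier_ge L0 T10 T14 b00 Bb _ eps0); move: dn; rewrite /l3; lra.
Qed.

(** * From barriers to a solution of (B psi'^3)' = W(psi, t) *)

(** The substitution t -> L - t, y -> M - y sends cell [j] to cell [n.+1 - j.+1], keeps the fluxes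
    and swaps the two at a node. Hence a subsolution of the reflected problem is a supersolution of
    the original one. *)
Lemma residual_reflect (R : realType) (L M : R) (B : R -> R) (W : R -> R -> R)
    (n i : nat) (y : nat -> R) : (0 < i < n.+1)%N ->
  residual (mesh L n) B W (fun j => M - y (n.+1 - j)%N) i =
  - residual (mesh L n) (fun t => B (L - t)) (fun z t => - W (M - z) (L - t)) y
      (n.+1 - i).
Proof.
move=> /andP[i0 iltn]; pose dt := mesh L n.
have nodeN j : (j <= n.+1)%N -> node dt (n.+1 - j) = L - node dt j.
  by move=> jn; rewrite /node natrB// mulrBl -/(node dt n.+1) node_mesh.
have fluxN j : (j < n.+1)%N ->
    flux dt B (fun j => M - y (n.+1 - j)%N) j
    = flux dt (fun t => B (L - t)) y (n.+1 - j.+1)%N.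
  move=> jn; have E1 : (n.+1 - j.+1).+1 = (n.+1 - j)%N by rewrite -subSn// subSS.
  rewrite /flux /slope /midweight E1.
  congr (B _ * (_ / _) ^+ 3); last by ring.
  by rewrite nodeN// nodeS; field.
rewrite /residual -/dt fluxN ?(leq_ltn_trans (leq_pred _))// fluxN// prednK//.
rewrite nodeN ?(ltnW iltn)// subKr.
by rewrite subnS; ring.
Qed.

Lemma cube_rescale (R : realFieldType) (d m m' u v w : R) : d != 0 ->
  4 * (m / (4 * d ^+ 3)) * u ^+ 3 - 4 * (m' / (4 * d ^+ 3)) * v ^+ 3 + w
  = m * (u / d) ^+ 3 - m' * (v / d) ^+ 3 + w.
Proof. by move=> d0; field. Qed.

(** The competitor [test] lies between the barriers, so minimality against it, together with
    [V >= 0], bounds the kinetic energy independently of [n]. *)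
Lemma discrete_solution_exists (R : realType) (L M bmax C1 m1 : R) (B test : R -> R)
    (V W : R -> R -> R) (n : nat) (lo hi : nat -> R) (dt := mesh L n) :
  0 < L -> 0 <= M ->
  (forall t, 0 <= t <= L -> 0 <= B t <= bmax) ->
  (forall y t, 0 <= y <= M -> 0 <= t <= L ->
    0 <= V y t /\ is_derive y 1 (V^~ t) (W y t)) ->
  (forall t, 0 <= t <= L -> 0 <= test t <= M /\ V (test t) t <= C1) ->
  (forall s t, 0 <= s <= L -> 0 <= t <= L -> `|test t - test s| <= m1 * `|t - s|) ->
  (forall i, (i <= n.+1)%N ->
    [/\ 0 <= lo i, lo i <= hi i, hi i <= M &
        lo i <= test (node dt i) <= hi i]) ->
  (forall i, (0 < i < n.+1)%N -> residual dt B W lo i <= 0) ->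
  (forall i, (0 < i < n.+1)%N -> 0 <= residual dt B W hi i) ->
  exists x : nat -> R,
    [/\ forall i, (i <= n.+1)%N -> lo i <= x i <= hi i,
        forall i, (0 < i < n.+1)%N -> residual dt B W x i = 0 &
        cumulative_energy dt B x n.+1 <= L * bmax * m1 ^+ 4 + 8 * (L * C1)].
Proof.
move=> L0 M0 Bb VW VT testL lohi slo shi.
have dt0 : 0 < dt by exact: mesh_gt0.
have dtN : dt != 0 by rewrite gt_eqF.
(* With this factor, 4 beta times the cube of an increment is the flux, so the partial derivatives
   of the energy are the residuals. *)
pose beta i := midweight dt B i / (4 * dt ^+ 3).
pose Vn i y := dt * V y (node dt i).
pose Wn i y := dt * W y (node dt i).
have slopeE y i : (0 < i)%N -> discrete_slope beta Wn i y = residual dt B W y i.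
  by move=> i0; rewrite /discrete_slope /residual /flux /slope /beta /Wn prednK//; exact: cube_rescale.
have beta0 i : (i < n.+1)%N -> 0 <= beta i.
  move=> iltn; rewrite divr_ge0//; last by rewrite mulr_ge0// exprn_ge0// ltW.
  by have /Bb/andP[] := midnode_itv L0 iltn.
have lohi' i : (i <= n.+1)%N -> lo i <= hi i by move=> /lohi[].
have VWn i y : (i <= n.+1)%N -> lo i <= y <= hi i -> is_derive y 1 (Vn i) (Wn i y).
  move=> iltn yP; have [l0 _ hM _] := lohi i iltn.
  have [_ dV] := VW y (node dt i) ltac:(lra) (node_itv L0 iltn).
  rewrite /Vn /Wn; have -> : (fun z => dt * V z (node dt i)) = dt \*: (V^~ (node dt i)) by [].
  exact: is_deriveZ.
have slo' i : (0 < i < n.+1)%N -> discrete_slope beta Wn i lo <= 0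
  by move=> /[dup] /slo + /andP[i0 _]; rewrite slopeE.
have shi' i : (0 < i < n.+1)%N -> 0 <= discrete_slope beta Wn i hi
  by move=> /[dup] /shi + /andP[i0 _]; rewrite slopeE.
have [x [xbox xmin xslope]] := discrete_minimizer_exists beta0 lohi' VWn slo' shi'.
exists x; split => //; first by move=> i /[dup] iP /andP[i0 _]; rewrite -slopeE ?xslope.
pose testn (i : nat) := test (node dt i).
have /xmin : forall i, (i <= n.+1)%N -> lo i <= testn i <= hi i by move=> i /lohi[].
rewrite /discrete_energy => xtest.
(* The factor 2: the [n.+2] nodes carry total weight L + dt <= 2 L. *)
have VnT : \sum_(i < n.+2) Vn i (testn i) <= 2 * (L * C1).
  have C10 : 0 <= C1.
    have : 0 <= (0 : R) <= L by rewrite lexx ltW.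
    move=> T0; have [tb V1] := VT 0 T0; apply: le_trans V1.
    by have [] := VW (test 0) 0 tb T0.
  apply: le_trans (@ler_sum_nat_const _ n.+2 (fun i => Vn i (testn i)) (dt * C1) _) _.
    by move=> i iltn; rewrite /Vn ler_pM2l//; apply: (VT _ _).2; exact: node_itv.
  have : n.+2%:R * dt <= 2 * L.
    have dtL : dt <= L by rewrite /dt /mesh ler_pdivrMr// ler_peMr ?ler1n// ltW.
    by rewrite -/(node dt n.+2) nodeS node_mesh; lra.
  by move=> /(ler_wpM2r C10); lra.
have VnX : 0 <= \sum_(i < n.+2) Vn i (x i).
  apply: sumr_ge0 => -[i iltn] _ /=; rewrite /Vn mulr_ge0 ?(ltW dt0)//.
  have [l0 _ hM _] := lohi i iltn; have xi := xbox i iltn.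
  by have [] := VW (x i) (node dt i) ltac:(lra) (node_itv (i := i) L0 iltn).
have kinT : \sum_(i < n.+1) beta i * (testn i.+1 - testn i) ^+ 4
    <= L * bmax * m1 ^+ 4 / 4.
  have -> : L * bmax * m1 ^+ 4 / 4 = n.+1%:R * (dt * bmax * m1 ^+ 4 / 4).
    by rewrite -{1}(node_mesh L n) /node -/dt; ring.
  apply: (@ler_sum_nat_const _ n.+1 (fun i => beta i * (testn i.+1 - testn i) ^+ 4)) => i iltn.
  have /andP[m0 mb] := Bb _ (midnode_itv L0 iltn).
  apply: le_trans (_ : beta i * (m1 * dt) ^+ 4 <= _).
    apply: ler_wpM2l; first exact: beta0.
    have : `|testn i.+1 - testn i| <= m1 * dt.
      apply: le_trans (testL _ _ (node_itv L0 (ltnW iltn)) (node_itv L0 iltn)) _.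
      by rewrite nodeS addrAC subrr add0r gtr0_norm.
    move=> H; rewrite -[_ ^+ 4]ger0_norm ?exprn_even_ge0// normrX.
    by rewrite lerXn2r ?nnegrE// (le_trans _ H).
  rewrite /beta -/dt.
  have -> : midweight dt B i / (4 * dt ^+ 3) * (m1 * dt) ^+ 4 =
     dt * m1 ^+ 4 / 4 * midweight dt B i by field.
  have -> : dt * bmax * m1 ^+ 4 / 4 = dt * m1 ^+ 4 / 4 * bmax by ring.
  apply: ler_wpM2l => //.
  by rewrite divr_ge0// mulr_ge0 ?(ltW dt0)// exprn_even_ge0.
have -> : cumulative_energy dt B x n.+1 = 4 * \sum_(i < n.+1) beta i * (x i.+1 - x i) ^+ 4.
  rewrite /cumulative_energy mulr_sumr; apply: eq_bigr => i _.
  by rewrite /beta /slope; field.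
by move: xtest VnT VnX kinT; lra.
Qed.

(* The minimisers on finer and finer grids converge to a solution of [(B psi'^3)' = W(psi, t)];
   the barriers keep it away from the constants 0 and M. *)
Lemma variational_solution (R : realType) (L M bmax C1 m0 m1 T1 T4 y1 cW S1 S4 z1 cZ : R)
    (B test : R -> R) (V W : R -> R -> R) :
  0 < L -> 0 < M ->
  (forall t, 0 <= t <= L -> 0 <= B t <= bmax) ->
  (forall u v, 0 < u -> u < v -> v < L ->
    exists b0 b1 lB w1 lW, locally_controlled M B W u v b0 b1 lB w1 lW) ->
  (forall y t, 0 <= y <= M -> 0 <= t <= L ->
    0 <= V y t /\ is_derive y 1 (V^~ t) (W y t)) ->
  (forall t, 0 <= t <= L -> V (test t) t <= C1) ->
  0 < m0 -> (forall t, 0 <= t <= L -> m0 * t <= test t <= M - m0 * (L - t)) ->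
  (forall s t, 0 <= s <= L -> 0 <= t <= L -> `|test t - test s| <= m1 * `|t - s|) ->
  (forall t, 0 <= t <= L -> W 0 t = 0 /\ W M t = 0) ->
  0 < T1 -> T1 < T4 -> T4 < L -> 0 < y1 -> 0 < cW ->
  (forall y t, T1 <= t <= L -> 0 <= y <= y1 -> W y t <= 0) ->
  (forall y t, T1 <= t <= T4 -> 0 <= y <= y1 -> W y t <= - cW * y) ->
  0 < S1 -> S1 < S4 -> S4 < L -> 0 < z1 -> 0 < cZ ->
  (forall y t, S1 <= t <= L -> 0 <= y <= z1 -> 0 <= W (M - y) (L - t)) ->
  (forall y t, S1 <= t <= S4 -> 0 <= y <= z1 -> cZ * y <= W (M - y) (L - t)) ->
  exists (psi D F : R -> R) (C0 delta : R),
    [/\ 0 < delta,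
        forall t, 0 < t < L -> 0 <= psi t <= M /\ 0 <= F t <= C0,
        forall t, 0 < t < L -> [/\ is_derive t 1 psi (D t),
          is_derive t 1 (fun s => B s * D s ^+ 3) (W (psi t) t) &
          is_derive t 1 F (B t * D t ^+ 4)],
        forall t, T4 < t < L -> delta <= psi t &
        forall t, 0 < t < L - S4 -> psi t <= M - delta].
Proof.
move=> L0 M0 Bb loc VW VT m00 testb testL WM T10 T14 T4L y10 cW0 Wle Wlt S10 S14 S4L z10 cZ0 Zle Zlt.
have [b0 [b1 [lB [w1 [lW [[b00 _ _ _] BbT _ _ _]]]]]] := loc T1 T4 T10 T14 T4L.
have W0 t : 0 <= t <= L -> W 0 t <= 0 by move=> /WM[->].
have [lo [d1 [d10 lob los lod]]] :=
  barriers_exist L0 M0 m00 T10 T14 T4L b00 y10 cW0 BbT W0 Wle Wlt.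
have [b0' [b1' [lB' [w1' [lW' [[b00' _ _ _] BbS _ _ _]]]]]] :=
  @loc (L - S4) (L - S1) ltac:(lra) ltac:(lra) ltac:(lra).
have BbS' t : S1 <= t <= S4 -> b0' <= B (L - t) <= b1' by move=> tP; apply: BbS; lra.
have Z0 t : 0 <= t <= L -> - W (M - 0) (L - t) <= 0.
  by move=> tP; rewrite subr0 (WM _ _).2 ?oppr0//; lra.
have Zle' y t : S1 <= t <= L -> 0 <= y <= z1 -> - W (M - y) (L - t) <= 0.
  by move=> tP yP; rewrite oppr_le0; exact: Zle.
have Zlt' y t : S1 <= t <= S4 -> 0 <= y <= z1 -> - W (M - y) (L - t) <= - cZ * y.
  by move=> tP yP; rewrite mulNr lerN2; exact: Zlt.
have [hi' [d2 [d20 hib his hid]]] :=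
  @barriers_exist _ _ _ _ _ _ _ _ _ _ (fun t => B (L - t)) (fun y t => - W (M - y) (L - t))
    L0 M0 m00 S10 S14 S4L b00' z10 cZ0 BbS' Z0 Zle' Zlt'.
(* Both barriers have height at most [M / 2], hence [lo <= hi]; the slope bound [m0] puts [test]
   between them. *)
pose hi n i := M - hi' n (n.+1 - i)%N.
have /choice[x xP] n : exists x : nat -> R,
    [/\ forall i, (i <= n.+1)%N -> lo n i <= x i <= hi n i,
        forall i, (0 < i < n.+1)%N -> residual (mesh L n) B W x i = 0 &
        cumulative_energy (mesh L n) B x n.+1
          <= L * bmax * m1 ^+ 4 + 8 * (L * C1)].
  apply: (@discrete_solution_exists _ _ M _ _ _ _ test V) => //; first exact: ltW.
  - move=> t tP; split; last exact: VT.
    have := testb t tP; have m0t : 0 <= m0 * t by rewrite mulr_ge0//; lra.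
    have : 0 <= m0 * (L - t) by rewrite mulr_ge0//; lra.
    by lra.
  - move=> i iltn; have [a1 a2 a3] := lob n i iltn.
    have [c1 c2 c3] := hib n (n.+1 - i)%N (leq_subr _ _).
    have nodeN : node (mesh L n) (n.+1 - i) = L - node (mesh L n) i.
      by rewrite /node natrB// mulrBl -/(node (mesh L n) n.+1) node_mesh.
    have := testb _ (node_itv L0 iltn).
    by move: c3; rewrite nodeN /hi => c3; split; lra.
  - by move=> i; exact: los.
  - move=> i iP; rewrite residual_reflect// oppr_ge0; apply: his.
    by case/andP: iP => i0 iltn; rewrite subn_gt0 iltn/= ltn_subrL i0.
have xb n i : (i <= n.+1)%N -> 0 <= x n i <= M.
  move=> iltn; have [/(_ i iltn) xi _ _] := xP n.
  have [a1 _ _] := lob n i iltn; have [c1 _ _] := hib n (n.+1 - i)%N (leq_subr _ _).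
  by move: xi; rewrite /hi; lra.
have EL n i : (0 < i < n.+1)%N ->
    flux (mesh L n) B (x n) i - flux (mesh L n) B (x n) i.-1
    = mesh L n * W (x n i) (node (mesh L n) i).
  by move=> iP; have [_ /(_ i iP) + _] := xP n; rewrite /residual; lra.
have en n : cumulative_energy (mesh L n) B (x n) n.+1
    <= L * bmax * m1 ^+ 4 + 8 * (L * C1) by have [] := xP n.
have B0 t : 0 <= t <= L -> 0 <= B t by move=> /Bb/andP[].
have [psi [D [F [bounds deriv psi_ge psi_le]]]] :=
  discrete_limit L0 (ltW M0) B0 loc xb EL en.
exists psi, D, F, (L * bmax * m1 ^+ 4 + 8 * (L * C1)), (Num.min d1 d2).
split => //; first by rewrite lt_min d10.
- move=> t tP; apply: le_trans (_ : d1 <= _); first by rewrite ge_min lexx.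
  apply: psi_ge; first lra.
  have tT4 : 0 < t - T4 by lra.
  have tL : 0 < L - t by lra.
  near=> n => i; rewrite ler_norml => iP.
  have e1 : mesh L n < t - T4 by near: n; exact: mesh_cvg.
  have e2 : mesh L n < L - t by near: n; exact: mesh_cvg.
  have iltn : (i <= n.+1)%N by rewrite -(le_node (mesh_gt0 n L0)) node_mesh; lra.
  have [/(_ i iltn) xi _ _] := xP n.
  apply: le_trans (_ : lo n i <= _); last lra.
  have : T4 <= node (mesh L n) i by lra.
  by move: i {iP iltn xi}; near: n.
- move=> t tP; apply: le_trans (_ : M - d2 <= _); last by rewrite lerB// ge_min lexx orbT.
  apply: psi_le; first lra.
  have t0 : 0 < t by lra.
  have tS : 0 < L - S4 - t by lra.
  near=> n => i; rewrite ler_norml => iP.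
  have e2 : mesh L n < L - S4 - t by near: n; exact: mesh_cvg.
  have iltn : (i <= n.+1)%N by rewrite -(le_node (mesh_gt0 n L0)) node_mesh; lra.
  have [/(_ i iltn) xi _ _] := xP n.
  apply: le_trans (_ : hi n i <= _); first lra.
  rewrite /hi lerD2l lerN2.
  have : S4 <= node (mesh L n) (n.+1 - i).
    by rewrite /node natrB// mulrBl -/(node (mesh L n) n.+1) node_mesh -/(node _ i); lra.
  by move: (n.+1 - i)%N; near: n.
Unshelve. all: by end_near. Qed.

(** * Mean value estimates, Lipschitz functions, and the change of variable psi = Phi(phi) *)

Lemma is_derive_continuous (R : realType) (f : R -> R) (x l : R) :
  is_derive x 1 f l -> {for x, continuous f}.
Proof.
by move=> df; apply: differentiable_continuous; apply/derivable1_diffP; case: df.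
Qed.

Lemma mean_value (R : realType) (f f' : R -> R) (x y : R) : x <= y ->
  (forall z, x <= z <= y -> is_derive z 1 f (f' z)) ->
  exists2 c, x <= c <= y & f y - f x = f' c * (y - x).
Proof.
move=> xy df; have [||c cP E] := @MVT_segment _ f f' x y xy.
- by move=> z; rewrite in_itv/= => zP; apply: df; lra.
- apply: continuous_in_subspaceT => z; rewrite inE/= in_itv/= => zP.
  exact: is_derive_continuous (df z zP).
- by exists c => //; move: cP; rewrite in_itv.
Qed.

Lemma derive_bounded_lipschitz (R : realType) (f f' : R -> R) (u v K : R) :
  (forall z, u <= z <= v -> is_derive z 1 f (f' z) /\ `|f' z| <= K) ->
  forall x y, u <= x <= v -> u <= y <= v -> `|f y - f x| <= K * `|y - x|.
Proof.
move=> df x y xP yP.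
wlog xy : x y xP yP / x <= y.
  move=> H; have [xy|/ltW yx] := leP x y; first exact: H.
  by rewrite distrC (distrC y); exact: H.
have [|c cP ->] := @mean_value _ f f' x y xy.
  by move=> z zP; apply: (df _ _).1; lra.
by rewrite normrM ler_wpM2r//; apply: (df _ _).2; lra.
Qed.

Lemma sin_lipschitz (R : realType) (x y : R) : `|sin y - sin x| <= `|y - x|.
Proof.
have := @derive_bounded_lipschitz _ sin cos (Num.min x y) (Num.max x y) 1 _ x y.
rewrite mul1r; apply; rewrite ?ge_min ?le_max ?lexx ?orbT// => z _.
by split; [exact: is_derive_sin|exact: cos_max].
Qed.

Lemma cos_lipschitz (R : realType) (x y : R) : `|cos y - cos x| <= `|y - x|.
Proof.
have := @derive_bounded_lipschitz _ cos (fun z => - sin z) (Num.min x y) (Num.max x y) 1 _ x y.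
rewrite mul1r; apply; rewrite ?ge_min ?le_max ?lexx ?orbT// => z _.
by split; [exact: is_derive_cos|rewrite normrN sin_max].
Qed.

Section lipschitz_bounded.
Context {R : realType}.
Implicit Types (f g : R -> R) (u v : R).

(** Boundedness is included because it is what makes the class stable under products; one constant
    serves for both properties. *)
Definition lipb (u v : R) (f : R -> R) : Prop := exists2 K, 0 <= K &
  (forall t, u <= t <= v -> `|f t| <= K) /\
  (forall s t, u <= s <= v -> u <= t <= v -> `|f t - f s| <= K * `|t - s|).

Lemma lipb_cst u v (c : R) : lipb u v (fun=> c).
Proof. by exists `|c| => //; split=> // s t _ _; rewrite subrr normr0 mulr_ge0. Qed.

Lemma lipbD u v f g : lipb u v f -> lipb u v g -> lipb u v (fun t => f t + g t).
Proof.
move=> [K K0 [fK fL]] [K' K'0 [gK gL]]; exists (K + K'); first exact: addr_ge0.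
split=> [t tP|s t sP tP].
  by apply: le_trans (ler_normD _ _) _; rewrite lerD ?fK ?gK.
have -> : f t + g t - (f s + g s) = (f t - f s) + (g t - g s) by ring.
by apply: le_trans (ler_normD _ _) _; rewrite [leRHS]mulrDl lerD ?fL ?gL.
Qed.

Lemma lipbM u v f g : lipb u v f -> lipb u v g -> lipb u v (fun t => f t * g t).
Proof.
move=> [K K0 [fK fL]] [K' K'0 [gK gL]]; exists (K * K' + K * K').
  by rewrite addr_ge0// mulr_ge0.
have KK : 0 <= K * K' by exact: mulr_ge0.
split=> [t tP|s t sP tP].
  by rewrite normrM; apply: le_trans (ler_pM _ _ (fK _ tP) (gK _ tP)) _ => //; rewrite lerDl.
have -> : f t * g t - f s * g s = f t * (g t - g s) + (f t - f s) * g s by ring.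
apply: le_trans (ler_normD _ _) _; rewrite [leRHS]mulrDl lerD// normrM.
  by rewrite -mulrA; apply: ler_pM => //; [exact: fK|exact: gL].
by rewrite [leRHS]mulrAC; apply: ler_pM => //; [exact: fL|exact: gK].
Qed.

Lemma lipbX u v f n : lipb u v f -> lipb u v (fun t => f t ^+ n).
Proof.
move=> fL; elim: n => [|n IH]; first exact: (lipb_cst u v 1).
rewrite (_ : (fun t => _) = (fun t => f t * f t ^+ n)); first exact: lipbM.
by apply/funext => t; rewrite exprS.
Qed.

Lemma lipbV u v f e : 0 < e -> (forall t, u <= t <= v -> e <= f t) ->
  lipb u v f -> lipb u v (fun t => (f t)^-1).
Proof.
move=> e0 ef [K K0 [fK fL]].
have f0 t : u <= t <= v -> 0 < f t by move=> /ef; exact: lt_le_trans.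
have fV t : u <= t <= v -> `|(f t)^-1| <= e^-1.
  by move=> tP; rewrite normfV gtr0_norm ?f0// lef_pV2 ?posrE ?f0// ef.
exists (e^-1 + K * (e^-1 * e^-1)).
  by rewrite addr_ge0 ?invr_ge0 ?(ltW e0)// mulr_ge0// mulr_ge0 ?invr_ge0 ?(ltW e0).
split=> [t tP|s t sP tP].
  apply: le_trans (fV _ tP) _; rewrite lerDl.
  by rewrite mulr_ge0// mulr_ge0 ?invr_ge0 ?(ltW e0).
have -> : (f t)^-1 - (f s)^-1 = (f s - f t) * ((f t)^-1 * (f s)^-1).
  by field; rewrite !gt_eqF ?f0.
rewrite normrM [leRHS]mulrDl; apply: le_trans (_ : K * (e^-1 * e^-1) * `|t - s| <= _); last first.
  by rewrite lerDr mulr_ge0// invr_ge0 ltW.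
rewrite [leRHS]mulrAC ler_pM//; first by rewrite distrC fL.
by rewrite normrM ler_pM// fV.
Qed.

Lemma lipb_comp u v a b f g : (forall t, u <= t <= v -> a <= g t <= b) ->
  lipb a b f -> (exists2 K, 0 <= K & forall s t, u <= s <= v -> u <= t <= v ->
     `|g t - g s| <= K * `|t - s|) -> lipb u v (fun t => f (g t)).
Proof.
move=> gab [K K0 [fK fL]] [K' K'0 gL]; exists (K + K * K').
  by rewrite addr_ge0// mulr_ge0.
split=> [t tP|s t sP tP].
  by apply: le_trans (fK _ (gab _ tP)) _; rewrite lerDl mulr_ge0.
apply: le_trans (fL _ _ (gab _ sP) (gab _ tP)) _.
apply: le_trans (_ : K * (K' * `|t - s|) <= _); first by rewrite ler_wpM2l// gL.
by rewrite mulrDl mulrA lerDr mulr_ge0.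
Qed.

Lemma lipb_sin u v : lipb u v sin.
Proof.
by exists 1 => //; split=> [t _|s t _ _]; [exact: sin_max|rewrite mul1r sin_lipschitz].
Qed.

Lemma lipb_cos u v : lipb u v cos.
Proof.
by exists 1 => //; split=> [t _|s t _ _]; [exact: cos_max|rewrite mul1r cos_lipschitz].
Qed.

End lipschitz_bounded.

(** It is applied with [a] = -1, so that two-sided derivatives are available on all of [0, pi / 2],
    in particular at 0. *)
Lemma primitive_exists (R : realType) (f : R -> R) (a : R) : continuous f ->
  exists F : R -> R, forall x, a < x -> is_derive x 1 F (f x).
Proof.
move=> cf; exists (fun x => \int[lebesgue_measure]_(t in `[a, x]) f t)%R => x ax.
have [||dF F'] := @continuous_FTC1_closed R f a x (x + 1) _ _ ax (cf x).
- lra.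
- apply: continuous_compact_integrable; first exact: segment_compact.
  exact: continuous_subspaceT.
- by apply: DeriveDef; [exact: dF|rewrite -derive1E F'].
Qed.

Lemma cube_root_continuous (R : realType) (x : R) : 0 < x ->
  {for x, continuous (@cube_root R)}.
Proof. by move=> x0; apply: is_derive_continuous; exact: is_derive1_powR. Qed.

Lemma ler_cube_root (R : realType) (x y : R) : 0 <= x -> x <= y ->
  cube_root x <= cube_root y.
Proof.
move=> x0 xy; apply: ler_cube_cancel; first exact: cube_root_ge0.
by rewrite !cube_rootK// (le_trans x0).
Qed.

Lemma cube_root_gt0 (R : realType) (x : R) : 0 < x -> 0 < cube_root x.
Proof. exact: powR_gt0. Qed.

Lemma near_gtr (R : realType) (a x : R) : a < x -> \forall z \near x, a < z.
Proof.
move=> ax; apply/nbhs_ballP; exists (x - a) => /=; first by rewrite subr_gt0.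
by move=> z; rewrite /ball/= ltr_norml; lra.
Qed.

Section change_of_variable.
Context {R : realType}.
Variables (kap : R -> R) (k0 k1 : R).
Hypotheses (kc : continuous kap) (k00 : 0 < k0) (kb : forall x, k0 <= kap x <= k1).

(** [Phi] is a primitive of [kap], bi-Lipschitz because [kap] lies between positive constants;
    [Theta] is its inverse on []-1, +oo[], picked by [xget]. The last clause is surjectivity from
    [0, A] onto [0, Phi A]. *)
Lemma change_of_variable_exists : exists Phi Theta : R -> R,
  [/\ Phi 0 = 0,
      forall x : R, -1 < x -> is_derive x 1 Phi (kap x),
      forall x : R, -1 < x -> Theta (Phi x) = x,
      forall x : R, -1 < x -> is_derive (Phi x) 1 Theta (kap x)^-1 &
      (forall x y : R, -1 < x -> x <= y ->
        k0 * (y - x) <= Phi y - Phi x <= k1 * (y - x)) /\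
      (forall A y : R, 0 <= A -> 0 <= y <= Phi A -> exists2 x, 0 <= x <= A & Phi x = y)].
Proof.
have [F0 F0d] := primitive_exists (-1) kc.
pose Phi x := F0 x - F0 0.
have Phid (x : R) : -1 < x -> is_derive x 1 Phi (kap x).
  move=> /F0d dF; have -> : Phi = F0 - cst (F0 0) by apply/funext.
  by apply: is_derive_eq; rewrite subr0.
have Phib (x y : R) : -1 < x -> x <= y -> k0 * (y - x) <= Phi y - Phi x <= k1 * (y - x).
  move=> x1 xy; have [|c cP ->] := @mean_value _ Phi kap x y xy.
    by move=> z zP; apply: Phid; lra.
  by have := kb c => /andP[? ?]; rewrite !ler_wpM2r// subr_ge0.
have Phi_lt (x y : R) : -1 < x -> x < y -> Phi x < Phi y.
  move=> x1 xy; have /andP[+ _] := Phib x y x1 (ltW xy); rewrite -subr_gt0.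
  by apply: lt_le_trans; rewrite mulr_gt0// subr_gt0.
have Phi_inj (x y : R) : -1 < x -> -1 < y -> Phi x = Phi y -> x = y.
  move=> x1 y1 E; have [xy|yx|//] := ltgtP x y.
    by have := Phi_lt _ _ x1 xy; rewrite E ltxx.
  by have := Phi_lt _ _ y1 yx; rewrite E ltxx.
pose Theta y := xget 0 [set x | -1 < x /\ Phi x = y].
have ThetaK (x : R) : -1 < x -> Theta (Phi x) = x.
  move=> x1; rewrite /Theta; case: xgetP => [z _ [z1 zE]|/(_ x)[]//].
  exact: Phi_inj.
exists Phi, Theta; split => //.
- by rewrite /Phi subrr.
- move=> x x1; apply: is_derive_inverse.
  + near=> z; apply: ThetaK; near: z; exact: near_gtr x1.
  + near=> z; apply: is_derive_continuous (Phid _ _); near: z; exact: near_gtr x1.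
  + exact: Phid.
  + by rewrite gt_eqF// (lt_le_trans k00)//; case/andP: (kb x).
- split=> // A y A0 yP; have [|||x xP xE] := @IVT _ Phi 0 A y.
  + by [].
  + apply: continuous_in_subspaceT => z; rewrite inE/= in_itv/= => zP.
    have z1 : -1 < z by lra.
    exact: is_derive_continuous (Phid z z1).
  + have P0 : Phi 0 = 0 by rewrite /Phi subrr.
    by case/andP: yP => y0 yA; rewrite P0 ge_min le_max y0 yA orbT.
  + by exists x => //; move: xP; rewrite inE/= in_itv.
Unshelve. all: by end_near. Qed.

End change_of_variable.

(** * Trigonometric bounds and the coefficients of the equation *)

Section trig.
Context {R : realType}.
Implicit Types x t : R.

Lemma sin_compl x : sin (pi / 2 - x) = cos x.
Proof. by rewrite sinB sin_pihalf cos_pihalf mul1r mul0r subr0. Qed.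

Lemma cos_compl x : cos (pi / 2 - x) = sin x.
Proof. by rewrite cosB sin_pihalf cos_pihalf mul1r mul0r add0r. Qed.

Lemma sin_cos_ge0 t : 0 <= t <= pi / 2 -> 0 <= sin t /\ 0 <= cos t.
Proof.
move=> tP; have pi0 := pi_gt0 R; split; last by apply: cos_ge0_pihalf; lra.
by apply: sin_ge0_pi; lra.
Qed.

Lemma sin_cos_gt0 t : 0 < t < pi / 2 -> 0 < sin t /\ 0 < cos t.
Proof.
by move=> tP; split; [exact: sin_gt0_pihalf|apply: cos_gt0_pihalf; have := pi_gt0 R; lra].
Qed.

Lemma ler_sin s t : 0 <= s -> s <= t -> t <= pi / 2 -> sin s <= sin t.
Proof.
move=> s0 st tp; have pi0 := pi_gt0 R.
by rewrite leNgt ltr_sin -?leNgt// in_itv/=; lra.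
Qed.

Lemma ler_cos s t : 0 <= s -> s <= t -> t <= pi / 2 -> cos t <= cos s.
Proof.
move=> s0 st tp; have pi0 := pi_gt0 R.
by rewrite leNgt ltr_cos -?leNgt// in_itv/=; lra.
Qed.

Lemma sin_le_id x : 0 <= x -> sin x <= x.
Proof.
by move=> x0; have := sin_lipschitz 0 x; rewrite sin0 !subr0 (ger0_norm x0) ler_norml => /andP[].
Qed.

Lemma sin_cos_half x : 0 <= x <= 2^-1 -> x / 2 <= sin x /\ 2^-1 <= cos x.
Proof.
move=> xP; have p1 := pihalf_ge1 R.
have cosh (z : R) : 0 <= z <= 2^-1 -> 2^-1 <= cos z.
  move=> zP; have [s0 c0] := sin_cos_ge0 (t := z) ltac:(lra).
  have sz := sin_le_id (x := z) ltac:(lra).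
  have s2 : sin z ^+ 2 <= 4^-1 by rewrite expr2; nra.
  have := cos2Dsin2 z; rewrite leNgt => H; apply/negP => c2.
  have : cos z ^+ 2 < 4^-1 by rewrite expr2; nra.
  by lra.
split; last exact: cosh.
have x0 : 0 <= x by lra.
have [ci ciP] := @mean_value _ sin cos 0 x x0 (fun z _ => is_derive_sin z).
rewrite sin0 !subr0 => ->; have := cosh ci ltac:(lra); nra.
Qed.

Lemma bracket_lower_bound (al be T : R) : 0 < al -> 0 < be -> 0 < T -> T < pi / 2 ->
  exists2 x1, 0 < x1 <= 2^-1 & forall x t : R, 0 <= x <= x1 -> T <= t < pi / 2 ->
    x / 4 <= sin x * cos x /\
    al / 2 <= al * (cos x ^+ 2 / cos t ^+ 4) - be * (sin x ^+ 2 / sin t ^+ 4).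
Proof.
move=> al0 be0 T0 Tpi; have p1 := pihalf_ge1 R.
have [sT cT] := sin_cos_gt0 (t := T) ltac:(lra).
pose K := al + be / sin T ^+ 4.
have K0 : 0 < K by rewrite addr_gt0// divr_gt0// exprn_gt0.
have y0 : 0 < al / (2 * K) by rewrite divr_gt0// mulr_gt0.
exists (Num.min 2^-1 (al / (2 * K))); first by rewrite lt_min y0 ge_min lexx !andbT; lra.
move=> x t; rewrite le_min => /andP[x0 /andP[x2 xK]] tP.
have [st ct] := sin_cos_gt0 (t := t) ltac:(lra).
have [sx cx] := sin_cos_half (x := x) ltac:(lra).
split; first nra.
have sxx := sin_le_id x0.
have s2 : sin x ^+ 2 <= x by rewrite expr2; nra.
have c2 : cos x ^+ 2 = 1 - sin x ^+ 2 by exact: cos2sin2.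
have sq0 := sqr_ge0 (sin x).
have cT1 : cos x ^+ 2 <= cos x ^+ 2 / cos t ^+ 4.
  rewrite ler_pdivlMr ?exprn_gt0//; apply: ler_piMr; first exact: sqr_ge0.
  by apply: exprn_ile1; [exact: ltW|exact: cos_le1].
have sT1 : sin x ^+ 2 / sin t ^+ 4 <= sin x ^+ 2 / sin T ^+ 4.
  rewrite ler_wpM2l// lef_pV2 ?posrE ?exprn_gt0//.
  by rewrite lerXn2r ?nnegrE ?(ltW st) ?(ltW sT)// ler_sin//; lra.
have xKE : x * K <= al / 2.
  by apply: le_trans (ler_wpM2r (ltW K0) xK) _; rewrite le_eqVlt; apply/orP; left; apply/eqP; field; rewrite gt_eqF.
have sK : sin x ^+ 2 * K <= al / 2 by apply: le_trans (ler_wpM2r (ltW K0) s2) xKE.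
apply: le_trans (_ : al * cos x ^+ 2 - be * (sin x ^+ 2 / sin T ^+ 4) <= _); last first.
  by apply: lerB; rewrite ler_pM2l.
have -> : al * cos x ^+ 2 - be * (sin x ^+ 2 / sin T ^+ 4) = al - sin x ^+ 2 * K.
  by rewrite c2 /K; ring.
lra.
Qed.

Lemma cosX4_derive x : is_derive x 1 (fun z => cos z ^+ 4 / 4) (- (cos x ^+ 3 * sin x)).
Proof.
have -> : (fun z : R => cos z ^+ 4 / 4) = 4^-1 \*: (cos ^+ 4).
  by apply/funext => z; rewrite /= fctE /GRing.scale/= mulrC.
by apply: is_derive_eq; rewrite /GRing.scale/=; field.
Qed.

Lemma sinX4_derive x : is_derive x 1 (fun z => sin z ^+ 4 / 4) (sin x ^+ 3 * cos x).
Proof.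
have -> : (fun z : R => sin z ^+ 4 / 4) = 4^-1 \*: (sin ^+ 4).
  by apply/funext => z; rewrite /= fctE /GRing.scale/= mulrC.
by apply: is_derive_eq; rewrite /GRing.scale/=; field.
Qed.

(** The square of [ell p q]; the equation involves [ell] essentially through this polynomial in sine
    and cosine. *)
Definition quad (p q t : R) : R := p ^+ 2 * sin t ^+ 2 + q ^+ 2 * cos t ^+ 2.

Lemma quad_bounds (p q : R) : 0 < p -> 0 < q -> exists m M : R, 0 < m /\
  forall t, m <= quad p q t <= M.
Proof.
move=> p0 q0; exists (Num.min (p ^+ 2) (q ^+ 2)), (p ^+ 2 + q ^+ 2).
have [p2 q2] : 0 < p ^+ 2 /\ 0 < q ^+ 2 by rewrite !exprn_gt0.
split=> [|t]; first by rewrite lt_min p2.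
have m1 : Num.min (p ^+ 2) (q ^+ 2) <= p ^+ 2 by rewrite ge_min lexx.
have m2 : Num.min (p ^+ 2) (q ^+ 2) <= q ^+ 2 by rewrite ge_min lexx orbT.
rewrite /quad; have := sqr_ge0 (sin t); have := sqr_ge0 (cos t); have := cos2Dsin2 t.
move: (Num.min _ _) m1 m2 (sin t ^+ 2) (cos t ^+ 2) => m m1 m2 S C E C0 S0.
have -> : S = 1 - C by lra.
have C1 : C <= 1 by lra.
nra.
Qed.

Lemma quad_lipb (p q u v : R) : lipb u v (quad p q).
Proof.
exact: (lipbD (lipbM (lipb_cst u v (p ^+ 2)) (lipbX 2 (lipb_sin u v)))
              (lipbM (lipb_cst u v (q ^+ 2)) (lipbX 2 (lipb_cos u v)))).
Qed.

Lemma quad_continuous (p q : R) : continuous (quad p q).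
Proof.
move=> t; rewrite /quad.
apply: cvgD; (apply: cvgM; first exact: cvg_cst).
  exact: (continuous_comp (@continuous_sin R t) (@exprn_continuous _ 2 _)).
exact: (continuous_comp (@continuous_cos R t) (@exprn_continuous _ 2 _)).
Qed.

Lemma weight_lipb m1 m2 (u v : R) : lipb u v (weight m1 m2).
Proof.
exact: (lipbM (lipbX m1 (lipb_cos u v)) (lipbX m2 (lipb_sin u v))).
Qed.

Lemma weight_itv m1 m2 t : 0 <= t <= pi / 2 -> 0 <= weight m1 m2 t <= 1.
Proof.
move=> /sin_cos_ge0[s0 c0]; rewrite /weight mulr_ge0 ?exprn_ge0//=.
by rewrite mulr_ile1 ?exprn_ge0 ?exprn_ile1// ?cos_le1 ?sin_le1.
Qed.

Lemma weight_ge m1 m2 (u v t : R) : 0 < u -> v < pi / 2 -> u <= t <= v ->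
  cos v ^+ m1 * sin u ^+ m2 <= weight m1 m2 t.
Proof.
move=> u0 vp tP; have [sv cv] := sin_cos_gt0 (t := v) ltac:(lra).
have [su cu] := sin_cos_gt0 (t := u) ltac:(lra).
have [st ct] := sin_cos_gt0 (t := t) ltac:(lra).
have cvt : cos v <= cos t by apply: ler_cos; lra.
have sut : sin u <= sin t by apply: ler_sin; lra.
by apply: ler_pM; rewrite ?exprn_ge0 ?(ltW cv) ?(ltW su)// lerXn2r ?nnegrE ?(ltW cv) ?(ltW su) ?(ltW ct) ?(ltW st).
Qed.

End trig.

Section coefficients.
Context {R : realType}.
Variables (m1 m2 : nat) (a b al be : R).
Hypotheses (m1_gt0 : (0 < m1)%N) (m2_gt0 : (0 < m2)%N).
Hypotheses (a0 : 0 < a) (b0 : 0 < b) (al0 : 0 < al) (be0 : 0 < be).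

Let L : R := pi / 2.

Definition stiffness (t : R) : R := quad a b t * weight m1 m2 t.
(** The coefficients of the force after multiplication by h^4 w, the factor that gives the equation
    its divergence form. At the endpoint where the denominator vanishes, the value is 0. *)
Definition coef1 (t : R) : R :=
  quad a b t ^+ 2 * weight m1 m2 t * (al * (cos t ^+ 4)^-1).
Definition coef2 (t : R) : R :=
  quad a b t ^+ 2 * weight m1 m2 t * (be * (sin t ^+ 4)^-1).

Let L0 : 0 < L. Proof. by rewrite divr_gt0// pi_gt0. Qed.

Lemma weight_endpoints : weight m1 m2 0 = 0 :> R /\ weight m1 m2 (pi / 2) = 0 :> R.
Proof.
by rewrite /weight sin0 cos_pihalf !expr0n/= !eqn0Ngt m1_gt0 m2_gt0 mulr0 mul0r.
Qed.

Lemma stiffness_bounds : exists bmax : R, forall t, 0 <= t <= L -> 0 <= stiffness t <= bmax.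
Proof.
have [m [M [m0 mM]]] := quad_bounds a0 b0; exists M => t tP.
have := mM t; have := weight_itv m1 m2 tP; rewrite /stiffness => ? ?.
by apply/andP; split; nra.
Qed.

Lemma coef_ge0 t : 0 <= t <= L -> 0 <= coef1 t /\ 0 <= coef2 t.
Proof.
move=> tP; have [m [M [m0 mM]]] := quad_bounds a0 b0.
have /andP[w0 _] := weight_itv m1 m2 tP; have [s0 c0] := sin_cos_ge0 tP.
by split; rewrite mulr_ge0//; [apply: mulr_ge0|apply: mulr_ge0; [exact: ltW|]
   |apply: mulr_ge0|apply: mulr_ge0; [exact: ltW|]] => //; rewrite ?sqr_ge0 ?invr_ge0 ?exprn_ge0.
Qed.

(** The fourth power compensates the pole exactly, which keeps the potential bounded along phi(t) =
    t. *)
Lemma coef_times : exists K : R, 0 <= K /\ forall t, 0 <= t <= L ->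
  coef1 t * cos t ^+ 4 <= K /\ coef2 t * sin t ^+ 4 <= K.
Proof.
have [m [M [m0 mM]]] := quad_bounds a0 b0.
have M0 : 0 <= M by have := mM 0; lra.
exists (M ^+ 2 * (al + be)); split; first by rewrite mulr_ge0 ?sqr_ge0// addr_ge0 ?ltW.
move=> t tP; have wP := weight_itv m1 m2 tP.
have Q2 : 0 <= quad a b t ^+ 2 * weight m1 m2 t <= M ^+ 2.
  have := mM t => qP; have /andP[w0 w1] := wP.
  have q2 : quad a b t ^+ 2 <= M ^+ 2 by rewrite lerXn2r ?nnegrE//; lra.
  rewrite mulr_ge0 ?sqr_ge0//=; apply: le_trans q2.
  by rewrite ler_piMr ?sqr_ge0.
have main (g r : R) : 0 < g -> g <= al + be ->
    quad a b t ^+ 2 * weight m1 m2 t * (g * (r ^+ 4)^-1) * r ^+ 4 <= M ^+ 2 * (al + be).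
  move=> g0 gle; have [->|r0] := eqVneq r 0.
    rewrite [0 ^+ 4]expr0n/= mulr0 mulr_ge0 ?sqr_ge0// addr_ge0 ?ltW//.
  rewrite -[leLHS]mulrA divfK ?expf_neq0//.
  by case/andP: Q2 => q0 qM; exact: ler_pM q0 (ltW g0) qM gle.
by split; apply: main => //; rewrite ?lerDl ?lerDr ltW.
Qed.

Lemma coefs_lipb u v : 0 < u -> u < v -> v < L ->
  [/\ lipb u v stiffness, lipb u v coef1 & lipb u v coef2].
Proof.
move=> u0 uv vL.
have qw := lipbM (lipbX 2 (quad_lipb a b u v)) (weight_lipb m1 m2 u v).
have [su cu] := sin_cos_gt0 (t := u) ltac:(rewrite -/L; lra).
have [sv cv] := sin_cos_gt0 (t := v) ltac:(rewrite -/L; lra).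
split.
- exact: lipbM (quad_lipb a b u v) (weight_lipb m1 m2 u v).
- apply: (lipbM qw (lipbM (lipb_cst u v al) _)).
  apply: (lipbV (e := cos v ^+ 4)); [exact: exprn_gt0| |exact: lipbX (lipb_cos u v)].
  move=> t tP; have [st ct] := sin_cos_gt0 (t := t) ltac:(rewrite -/L; lra).
  by rewrite lerXn2r ?nnegrE ?(ltW ct) ?(ltW cv)// ler_cos// -/L; lra.
- apply: (lipbM qw (lipbM (lipb_cst u v be) _)).
  apply: (lipbV (e := sin u ^+ 4)); [exact: exprn_gt0| |exact: lipbX (lipb_sin u v)].
  move=> t tP; have [st ct] := sin_cos_gt0 (t := t) ltac:(rewrite -/L; lra).
  by rewrite lerXn2r ?nnegrE ?(ltW st) ?(ltW su)// ler_sin// -/L; lra.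
Qed.

Lemma coefs_locally_controlled (M : R) (S1 S2 : R -> R) : 0 <= M ->
  lipb 0 M S1 -> lipb 0 M S2 -> forall u v, 0 < u -> u < v -> v < L ->
  exists b0 b1 lB w1 lW, locally_controlled M stiffness
    (fun y t => - coef1 t * S1 y + coef2 t * S2 y) u v b0 b1 lB w1 lW.
Proof.
move=> M0 [K1 K10 [S1b S1l]] [K2 K20 [S2b S2l]] u v u0 uv vL.
have [[KB KB0 [Bb Bl]] [KA KA0 [Ab Al]] [KC KC0 [Cb Cl]]] := coefs_lipb u0 uv vL.
have [m [MM [m0 mM]]] := quad_bounds a0 b0.
have [su cu] := sin_cos_gt0 (t := u) ltac:(rewrite -/L; lra).
have [sv cv] := sin_cos_gt0 (t := v) ltac:(rewrite -/L; lra).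
have w0 : 0 < cos v ^+ m1 * sin u ^+ m2 by rewrite mulr_gt0// exprn_gt0.
exists (m * (cos v ^+ m1 * sin u ^+ m2)), KB, KB, (KA * K1 + KC * K2), (KA * K1 + KC * K2).
split.
- have KK : 0 <= KA * K1 + KC * K2 by rewrite addr_ge0// mulr_ge0.
  by split => //; exact: mulr_gt0.
- move=> t tP; apply/andP; split; last by apply: le_trans (Bb t tP); exact: ler_norm.
  apply: ler_pM; [exact: ltW|exact: ltW|by case/andP: (mM t)|].
  by apply: weight_ge.
- exact: Bl.
- move=> y t yP tP; apply: le_trans (ler_normD _ _) _.
  rewrite [`|- coef1 t * _|]normrM [`|coef2 t * _|]normrM normrN.
  by apply: lerD; apply: ler_pM => //; [exact: Ab|exact: S1b|exact: Cb|exact: S2b].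
- move=> y z s t yP zP sP tP.
  have -> : - coef1 t * S1 z + coef2 t * S2 z - (- coef1 s * S1 y + coef2 s * S2 y) =
    (- (coef1 t * (S1 z - S1 y)) - (coef1 t - coef1 s) * S1 y) +
    (coef2 t * (S2 z - S2 y) + (coef2 t - coef2 s) * S2 y) by ring.
  have e1 : `|coef1 t * (S1 z - S1 y)| <= KA * K1 * `|z - y|.
    by rewrite normrM -mulrA ler_pM// ?Ab ?S1l.
  have e2 : `|(coef1 t - coef1 s) * S1 y| <= KA * K1 * `|t - s|.
    by rewrite normrM mulrAC ler_pM// ?Al ?S1b.
  have e3 : `|coef2 t * (S2 z - S2 y)| <= KC * K2 * `|z - y|.
    by rewrite normrM -mulrA ler_pM// ?Cb ?S2l.
  have e4 : `|(coef2 t - coef2 s) * S2 y| <= KC * K2 * `|t - s|.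
    by rewrite normrM mulrAC ler_pM// ?Cl ?S2b.
  apply: le_trans (ler_normD _ _) _.
  have n1 := ler_normB (- (coef1 t * (S1 z - S1 y))) ((coef1 t - coef1 s) * S1 y).
  have n2 := ler_normD (coef2 t * (S2 z - S2 y)) ((coef2 t - coef2 s) * S2 y).
  rewrite normrN in n1; apply: le_trans (lerD n1 n2) _.
  apply: le_trans (lerD (lerD e1 e2) (lerD e3 e4)) _.
  by rewrite le_eqVlt; apply/orP; left; apply/eqP; ring.
Qed.

Lemma coef_force (x t : R) :
  - coef1 t * (cos x ^+ 3 * sin x) + coef2 t * (sin x ^+ 3 * cos x) =
  - (quad a b t ^+ 2 * weight m1 m2 t) * (sin x * cos x) *
    (al * (cos x ^+ 2 / cos t ^+ 4) - be * (sin x ^+ 2 / sin t ^+ 4)).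
Proof. rewrite /coef1 /coef2; ring. Qed.

End coefficients.

(** * The integrated equation for phi *)

Section solution.
Context {R : realType}.
Variables (m1 m2 : nat) (a b c d al be : R).
Hypotheses (m1_gt0 : (0 < m1)%N) (m2_gt0 : (0 < m2)%N).
Hypotheses (a0 : 0 < a) (b0 : 0 < b) (c0 : 0 < c) (d0 : 0 < d).
Hypotheses (al0 : 0 < al) (be0 : 0 < be).

Local Notation Bw := (stiffness m1 m2 a b).
Local Notation A1 := (coef1 m1 m2 a b al).
Local Notation A2 := (coef2 m1 m2 a b be).
Local Notation k2 := (quad c d).

Let kap (x : R) : R := cube_root (k2 x).

Let pi0 : 0 < pi :> R. Proof. exact: pi_gt0. Qed.

Section variables.
Variables (ka0 ka1 : R) (Phi Th P Q : R -> R).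
Hypotheses (ka00 : 0 < ka0) (ka10 : 0 < ka1) (kapb : forall x, ka0 <= kap x <= ka1).
Hypothesis Phi0 : Phi 0 = 0.
Hypothesis Phid : forall x : R, -1 < x -> is_derive x 1 Phi (kap x).
Hypothesis ThetaK : forall x : R, -1 < x -> Th (Phi x) = x.
Hypothesis Thetad : forall x : R, -1 < x -> is_derive (Phi x) 1 Th (kap x)^-1.
Hypothesis Phib : forall x y : R, -1 < x -> x <= y ->
  ka0 * (y - x) <= Phi y - Phi x <= ka1 * (y - x).
Hypothesis Phis : forall A y : R, 0 <= A -> 0 <= y <= Phi A ->
  exists2 x : R, 0 <= x <= A & Phi x = y.
Hypothesis Pd : forall x : R, -1 < x ->
  is_derive x 1 P (kap x * (- (cos x ^+ 3 * sin x))).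
Hypothesis Qd : forall x : R, -1 < x ->
  is_derive x 1 Q (kap x * (sin x ^+ 3 * cos x)).
Hypotheses (P_pihalf : P (pi / 2) = 0) (Q_0 : Q 0 = 0).

Let M := Phi (pi / 2).

Let kapgt x : 0 < kap x. Proof. by apply: lt_le_trans ka00 _; case/andP: (kapb x). Qed.

Let pihalf0 : 0 <= pi / 2 :> R. Proof. by rewrite divr_ge0// ltW. Qed.

Let gtN1 (x : R) : 0 <= x -> -1 < x. Proof. lra. Qed.

Let Phi_ge x : 0 <= x -> ka0 * x <= Phi x <= ka1 * x.
Proof. by move=> x0; have := Phib (gtN1 (lexx 0)) x0; rewrite Phi0 !subr0. Qed.

Let Phi_compl x : 0 <= x <= pi / 2 ->
  ka0 * (pi / 2 - x) <= M - Phi x <= ka1 * (pi / 2 - x).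
Proof. by move=> /andP[x0 xp]; exact: Phib (gtN1 x0) xp. Qed.

Let M0 : 0 < M.
Proof.
have /andP[+ _] := Phi_ge pihalf0; apply: lt_le_trans.
by rewrite mulr_gt0// divr_gt0.
Qed.

Let onto y : 0 <= y <= M -> exists2 x, 0 <= x <= pi / 2 & Phi x = y.
Proof. exact: Phis. Qed.

Let ThK x : 0 <= x -> Th (Phi x) = x. Proof. by move=> /gtN1; exact: ThetaK. Qed.

(** [P] and [ka1 * (cos x ^+ 4 / 4)] both vanish at pi/2, and [P] as well as their difference are
    nonincreasing on [0, pi/2], since 0 < kap <= ka1. *)
Let P_bounds x : 0 <= x <= pi / 2 -> 0 <= P x <= ka1 * (cos x ^+ 4 / 4).
Proof.
move=> /andP[x0 xp].
have trigz (z : R) : x <= z <= pi / 2 -> 0 <= cos z ^+ 3 * sin z.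
  by move=> zP; have [? ?] := sin_cos_ge0 (t := z) ltac:(lra); rewrite mulr_ge0 ?exprn_ge0.
have [z zP] := @mean_value _ P _ x (pi / 2) xp (fun (z : R) zP => Pd (x := z) ltac:(lra)).
rewrite P_pihalf sub0r => Pz.
have d2 (z' : R) : x <= z' <= pi / 2 -> is_derive z' 1 (fun y : R => ka1 * (cos y ^+ 4 / 4) - P y)
    (ka1 * (- (cos z' ^+ 3 * sin z')) - kap z' * (- (cos z' ^+ 3 * sin z'))).
  move=> zP'; have := Pd (x := z') ltac:(lra); have := cosX4_derive z' => dc dP.
  have -> : (fun y : R => ka1 * (cos y ^+ 4 / 4) - P y) =
    ka1 \*: (fun z => cos z ^+ 4 / 4) - P by apply/funext.
  exact: is_deriveB.
have [z2 zP2] := @mean_value _ _ _ x (pi / 2) xp d2.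
rewrite cos_pihalf expr0n/= mul0r mulr0 P_pihalf subr0 => E2.
have t1 := trigz _ zP; have t2 := trigz _ zP2.
have /andP[_ kz2] := kapb z2; have kz := kapgt z.
have s1 : 0 <= kap z * (cos z ^+ 3 * sin z) * (pi / 2 - x).
  by apply: mulr_ge0; [exact: mulr_ge0 (ltW kz) t1|lra].
have s2 : 0 <= (ka1 - kap z2) * (cos z2 ^+ 3 * sin z2) * (pi / 2 - x).
  by apply: mulr_ge0; [apply: mulr_ge0; [lra|exact: t2]|lra].
by apply/andP; split; lra.
Qed.

Let Q_bounds x : 0 <= x <= pi / 2 -> 0 <= Q x <= ka1 * (sin x ^+ 4 / 4).
Proof.
move=> /andP[x0 xp].
have trigz (z : R) : 0 <= z <= x -> 0 <= sin z ^+ 3 * cos z.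
  by move=> zP; have [? ?] := sin_cos_ge0 (t := z) ltac:(lra); rewrite mulr_ge0 ?exprn_ge0.
have [z zP] := @mean_value _ Q _ 0 x x0 (fun (z : R) zP => Qd (x := z) ltac:(lra)).
rewrite Q_0 subr0 => Qz.
have d2 (z' : R) : 0 <= z' <= x -> is_derive z' 1 (fun y : R => ka1 * (sin y ^+ 4 / 4) - Q y)
    (ka1 * (sin z' ^+ 3 * cos z') - kap z' * (sin z' ^+ 3 * cos z')).
  move=> zP'; have := Qd (x := z') ltac:(lra); have := sinX4_derive z' => dc dQ.
  have -> : (fun y : R => ka1 * (sin y ^+ 4 / 4) - Q y) =
    ka1 \*: (fun z => sin z ^+ 4 / 4) - Q by apply/funext.
  exact: is_deriveB.
have [z2 zP2] := @mean_value _ _ _ 0 x x0 d2.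
rewrite sin0 expr0n/= mul0r mulr0 Q_0 !subr0 => E2.
have t1 := trigz _ zP; have t2 := trigz _ zP2.
have /andP[_ kz2] := kapb z2; have kz := kapgt z.
have s1 : 0 <= kap z * (sin z ^+ 3 * cos z) * x.
  by apply: mulr_ge0 => //; exact: mulr_ge0 (ltW kz) t1.
have s2 : 0 <= (ka1 - kap z2) * (sin z2 ^+ 3 * cos z2) * x.
  by apply: mulr_ge0 => //; apply: mulr_ge0; [lra|exact: t2].
by apply/andP; split; lra.
Qed.

(** In the variable psi, the derivative of [P \o Th] is P' / kap: the factor [kap] built into [P]
    and [Q] cancels, and [W] is the force. The normalisations P(pi/2) = 0 and Q(0) = 0 make [V]
    nonnegative and give [P] and [Q] the order of cos^4 and sin^4. *)
Let V y t := A1 t * P (Th y) + A2 t * Q (Th y).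
Let S1 y := cos (Th y) ^+ 3 * sin (Th y).
Let S2 y := sin (Th y) ^+ 3 * cos (Th y).
Let W y t := - A1 t * S1 y + A2 t * S2 y.

Let WE x t : 0 <= x -> W (Phi x) t = - (quad a b t ^+ 2 * weight m1 m2 t) * (sin x * cos x) *
    (al * (cos x ^+ 2 / cos t ^+ 4) - be * (sin x ^+ 2 / sin t ^+ 4)).
Proof. by move=> x0; rewrite /W /S1 /S2 (ThK x0) coef_force. Qed.

Let potential_derive y t : 0 <= y <= M -> 0 <= t <= pi / 2 ->
  0 <= V y t /\ is_derive y 1 (V^~ t) (W y t).
Proof.
move=> /onto[x xP <-] tP; have /andP[x0 _] := xP; have x1 := gtN1 x0.
have [c1 c2] := coef_ge0 m1 m2 a0 b0 al0 be0 tP.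
rewrite /V (ThK x0).
have /andP[Px _] := P_bounds xP; have /andP[Qx _] := Q_bounds xP.
split; first by rewrite addr_ge0// mulr_ge0.
have dTh := Thetad x1.
have dP : is_derive (Phi x) 1 (P \o Th) (kap x * (- (cos x ^+ 3 * sin x)) * (kap x)^-1).
  by apply: is_derive1_comp; rewrite (ThK x0); exact: Pd.
have dQ : is_derive (Phi x) 1 (Q \o Th) (kap x * (sin x ^+ 3 * cos x) * (kap x)^-1).
  by apply: is_derive1_comp; rewrite (ThK x0); exact: Qd.
have -> : (fun y => A1 t * P (Th y) + A2 t * Q (Th y)) =
  A1 t \*: (P \o Th) + A2 t \*: (Q \o Th) by apply/funext.
apply: is_derive_eq; rewrite /W /S1 /S2 (ThK x0).
by rewrite /GRing.scale/= ![kap x * _]mulrC !mulfK ?gt_eqF//; ring.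
Qed.

Let Theta_lipschitz : exists2 K, 0 <= K & forall s t, 0 <= s <= M -> 0 <= t <= M ->
  `|Th t - Th s| <= K * `|t - s|.
Proof.
exists ka0^-1; first by rewrite invr_ge0 ltW.
move=> s t /onto[x /andP[x0 _] <-] /onto[z /andP[z0 _] <-]; rewrite !ThK//.
rewrite mulrC ler_pdivlMr// mulrC.
have [xz|/ltW zx] := leP x z.
  have /andP[H _] := Phib (gtN1 x0) xz.
  by rewrite (ger0_norm (x := z - x)) ?subr_ge0//; apply: le_trans H _; exact: ler_norm.
have /andP[H _] := Phib (gtN1 z0) zx.
by rewrite distrC (distrC (Phi z)) (ger0_norm (x := x - z)) ?subr_ge0//; apply: le_trans H _; exact: ler_norm.
Qed.

Let force_lipb : lipb 0 M S1 /\ lipb 0 M S2.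
Proof.
have ThI y : 0 <= y <= M -> 0 <= Th y <= pi / 2.
  by move=> /onto[x xP <-]; rewrite ThK//; case/andP: xP.
split.
  exact: (lipb_comp ThI (lipbM (lipbX 3 (lipb_cos 0 (pi / 2))) (lipb_sin 0 (pi / 2))) Theta_lipschitz).
exact: (lipb_comp ThI (lipbM (lipbX 3 (lipb_sin 0 (pi / 2))) (lipb_cos 0 (pi / 2))) Theta_lipschitz).
Qed.

(** The competitor is [Phi], that is phi(t) = t in the original variable. *)
Let potential_Phi : exists C, forall t, 0 <= t <= pi / 2 -> V (Phi t) t <= C.
Proof.
have [K [K0 KP]] := coef_times m1 m2 a0 b0 al0 be0.
exists (ka1 * K) => t tP; have /andP[t0 _] := tP; rewrite /V (ThK t0).
have [k1 k2'] := KP t tP; have [c1 c2] := coef_ge0 m1 m2 a0 b0 al0 be0 tP.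
have /andP[_ Pt] := P_bounds tP; have /andP[_ Qt] := Q_bounds tP.
have e1 : A1 t * P t <= A1 t * (ka1 * (cos t ^+ 4 / 4)) by rewrite ler_wpM2l.
have e2 : A2 t * Q t <= A2 t * (ka1 * (sin t ^+ 4 / 4)) by rewrite ler_wpM2l.
have e3 : ka1 * (A1 t * cos t ^+ 4) <= ka1 * K by rewrite ler_pM2l.
have e4 : ka1 * (A2 t * sin t ^+ 4) <= ka1 * K by rewrite ler_pM2l.
have e5 : 0 <= ka1 * K by rewrite mulr_ge0// ltW.
by move: c1 c2 e1 e2 e3 e4 e5 {k1 k2' Pt Qt KP tP t0}; lra.
Qed.

Let Phi_test t : 0 <= t <= pi / 2 -> ka0 * t <= Phi t <= M - ka0 * (pi / 2 - t).
Proof.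
move=> tP; have /andP[t0 _] := tP; have /andP[-> _] /= := Phi_ge t0.
by have /andP[+ _] := Phi_compl tP; lra.
Qed.

Let Phi_lipschitz s t : 0 <= s <= pi / 2 -> 0 <= t <= pi / 2 ->
  `|Phi t - Phi s| <= ka1 * `|t - s|.
Proof.
apply: (@derive_bounded_lipschitz _ _ kap) => z /andP[z0 _].
split; first by apply: Phid; exact: gtN1.
by rewrite gtr0_norm//; case/andP: (kapb z).
Qed.

Let force_constants t : 0 <= t <= pi / 2 -> W 0 t = 0 /\ W M t = 0.
Proof.
by move=> tP; rewrite -{1}Phi0 !WE// sin0 cos_pihalf mul0r mulr0 !mulr0 !mul0r.
Qed.

Let qw_ge0 t : 0 <= t <= pi / 2 -> 0 <= quad a b t ^+ 2 * weight m1 m2 t.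
Proof. by move=> tP; rewrite mulr_ge0 ?sqr_ge0//; case/andP: (weight_itv m1 m2 tP). Qed.

Let qw_pos u v : 0 < u -> u < v -> v < pi / 2 -> exists2 g, 0 < g &
  forall t, u <= t <= v -> g <= quad a b t ^+ 2 * weight m1 m2 t.
Proof.
move=> u0 uv vL; have [mh [Mh [mh0 mhM]]] := quad_bounds a0 b0.
have [su cu] := sin_cos_gt0 (t := u) ltac:(lra).
have [sv cv] := sin_cos_gt0 (t := v) ltac:(lra).
exists (mh ^+ 2 * (cos v ^+ m1 * sin u ^+ m2)).
  by apply: mulr_gt0; [exact: exprn_gt0|apply: mulr_gt0; exact: exprn_gt0].
move=> t tP; apply: ler_pM; [exact: sqr_ge0| | |exact: weight_ge].
  by apply: mulr_ge0; apply: exprn_ge0; exact: ltW.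
by have /andP[q1 _] := mhM t; rewrite lerXn2r ?nnegrE ?(ltW mh0)// (le_trans (ltW mh0)).
Qed.

Let small_left x1 y : 0 <= x1 -> 0 <= y <= ka0 * x1 ->
  exists x, [/\ 0 <= x <= x1, Phi x = y & y <= ka1 * x].
Proof.
move=> x10 /andP[y0 yx]; have /andP[x1g _] := Phi_ge x10.
have [|x xP xE] := Phis (A := x1) (y := y) x10; first by rewrite y0 (le_trans yx).
have /andP[x0 _] := xP.
by exists x; split => //; have /andP[_] := Phi_ge x0; rewrite xE.
Qed.

Let small_right x1 y : 0 <= x1 <= pi / 2 -> 0 <= y <= ka0 * x1 ->
  exists x, [/\ 0 <= x <= x1, Phi (pi / 2 - x) = M - y & y <= ka1 * x].
Proof.
move=> /andP[x10 x1p] /andP[y0 yx]; have /andP[Mg _] := Phi_ge pihalf0.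
have kx : ka0 * x1 <= ka0 * (pi / 2) by rewrite ler_pM2l.
have yM : y <= M by exact: le_trans (le_trans yx kx) Mg.
have [|z zP zE] := onto (y := M - y); first by rewrite subr_ge0 yM gerBl.
have := Phi_compl zP; rewrite zE subKr => /andP[h1 h2].
exists (pi / 2 - z); split => //; last by rewrite subKr.
apply/andP; split; first by rewrite subr_ge0; case/andP: zP.
by rewrite -(ler_pM2l ka00) (le_trans h1 yx).
Qed.

Let pi8 : 0 < pi / 8 :> R /\ pi / 8 < pi / 4 :> R. Proof. by move: pi0; lra. Qed.
Let pi4 : pi / 4 < pi / 2 :> R /\ pi / 8 < pi / 2 :> R. Proof. by move: pi0; lra. Qed.

(** The lower barrier rises on [pi/8, pi/4] and the upper one on the mirror image, so that the first
    acts on ]pi/4, pi/2[ and the second on ]0, pi/4[. *)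
Let lower_force : exists y1 cW, [/\ 0 < y1, 0 < cW,
  forall y t, pi / 8 <= t <= pi / 2 -> 0 <= y <= y1 -> W y t <= 0 &
  forall y t, pi / 8 <= t <= pi / 4 -> 0 <= y <= y1 -> W y t <= - cW * y].
Proof.
have [T10 T14] := pi8; have [T4L T1L] := pi4.
have [x1 /andP[x10 _] br] := bracket_lower_bound al0 be0 T10 T1L.
have [g g0 gP] := qw_pos T10 T14 T4L.
(* [y <= ka0 * x1] forces x <= x1 for y = Phi x; as y <= ka1 x, the product g (x / 4) (al / 2) of
   lower bounds is at least g al y / (8 ka1). *)
exists (ka0 * x1), (g * al / (8 * ka1)); split.
- exact: mulr_gt0.
- by rewrite divr_gt0 ?mulr_gt0.
- move=> y t tP /(small_left (ltW x10))[x [xP <- _]]; have /andP[x0 _] := xP.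
  (* The bound on the bracket stops short of t = pi/2, where the weight vanishes. *)
  rewrite (WE _ x0); have [->|tL] := eqVneq t (pi / 2).
    by rewrite (weight_endpoints m1_gt0 m2_gt0).2 mulr0 oppr0 !mul0r.
  have /andP[t8 t2] := tP; have tL' : t < pi / 2 by rewrite lt_neqAle tL.
  have [s1 s2] := br x t xP ltac:(by rewrite t8 tL').
  rewrite -mulrA mulNr oppr_le0 mulr_ge0 ?qw_ge0//; first by rewrite t2 (le_trans (ltW T10)).
  by rewrite mulr_ge0// ?(le_trans _ s1) ?(le_trans _ s2)// divr_ge0// ltW.
- move=> y t tP /(small_left (ltW x10))[x [xP <- yx]]; have /andP[x0 _] := xP.
  have /andP[t8 t4] := tP; have tL' : t < pi / 2 by exact: le_lt_trans t4 T4L.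
  have [s1 s2] := br x t xP ltac:(by rewrite t8 tL').
  rewrite (WE _ x0) -mulrA !mulNr lerN2.
  apply: le_trans (_ : g * ((x / 4) * (al / 2)) <= _).
    have -> : g * (x / 4 * (al / 2)) = g * al / (8 * ka1) * (ka1 * x) by field; rewrite gt_eqF.
    by rewrite ler_wpM2l// divr_ge0 ?mulr_ge0 ?(ltW g0) ?(ltW al0) ?(ltW ka10).
  have x4 : 0 <= x / 4 by rewrite divr_ge0.
  have a2 : 0 <= al / 2 by rewrite divr_ge0 ?ltW.
  apply: ler_pM; [exact: ltW|exact: mulr_ge0|exact: gP|].
  exact: ler_pM.
Qed.

(** Reflecting both x and t exchanges sine and cosine, hence [al] and [be], and reverses the sign:
    the upper barrier needs the same bracket bound with the two constants exchanged. *)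
Let WEr x t : 0 <= x <= pi / 2 -> W (Phi (pi / 2 - x)) (pi / 2 - t) =
    (quad a b (pi / 2 - t) ^+ 2 * weight m1 m2 (pi / 2 - t)) * ((sin x * cos x) *
    (be * (cos x ^+ 2 / cos t ^+ 4) - al * (sin x ^+ 2 / sin t ^+ 4))).
Proof.
by move=> /andP[x0 xp]; rewrite WE ?subr_ge0// !sin_compl !cos_compl; ring.
Qed.

Let upper_force : exists y1 cW, [/\ 0 < y1, 0 < cW,
  forall y t, pi / 8 <= t <= pi / 2 -> 0 <= y <= y1 -> 0 <= W (M - y) (pi / 2 - t) &
  forall y t, pi / 8 <= t <= pi / 4 -> 0 <= y <= y1 -> cW * y <= W (M - y) (pi / 2 - t)].
Proof.
have [T10 T14] := pi8; have [T4L T1L] := pi4.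
have [x1 /andP[x10 x1h] br] := bracket_lower_bound be0 al0 T10 T1L.
have x1P : 0 <= x1 <= pi / 2.
  by rewrite (ltW x10) (le_trans x1h)//; have := pihalf_ge1 R; lra.
(* The mirror image of [pi/8, pi/4], because the weight is evaluated at [pi / 2 - t]. *)
have [g g0 gP] := @qw_pos (pi / 4) (pi / 2 - pi / 8)
  ltac:(by rewrite divr_gt0) ltac:(by move: pi0; lra) ltac:(by move: T10; lra).
have small_in x : 0 <= x <= x1 -> 0 <= x <= pi / 2.
  by case/andP: x1P => _ xp /andP[-> /le_trans->].
exists (ka0 * x1), (g * be / (8 * ka1)); split.
- exact: mulr_gt0.
- by rewrite divr_gt0 ?mulr_gt0.
- move=> y t tP /(small_right x1P)[x [xP <- _]]; have /andP[x0 _] := xP.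
  rewrite WEr ?small_in//; have [->|tL] := eqVneq t (pi / 2).
    by rewrite subrr (weight_endpoints m1_gt0 m2_gt0).1 mulr0 !mul0r.
  have /andP[t8 t2] := tP; have tL' : t < pi / 2 by rewrite lt_neqAle tL.
  have [s1 s2] := br x t xP ltac:(by rewrite t8 tL').
  rewrite mulr_ge0 ?qw_ge0//.
    by rewrite subr_ge0 t2 gerBl (le_trans (ltW T10)).
  by rewrite mulr_ge0// ?(le_trans _ s1) ?(le_trans _ s2)// divr_ge0// ltW.
- move=> y t tP /(small_right x1P)[x [xP <- yx]]; have /andP[x0 _] := xP.
  have /andP[t8 t4] := tP; have tL' : t < pi / 2 by exact: le_lt_trans t4 T4L.
  have [s1 s2] := br x t xP ltac:(by rewrite t8 tL').
  rewrite WEr ?small_in//.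
  apply: le_trans (_ : g * ((x / 4) * (be / 2)) <= _).
    have -> : g * (x / 4 * (be / 2)) = g * be / (8 * ka1) * (ka1 * x) by field; rewrite gt_eqF.
    by rewrite ler_wpM2l// divr_ge0 ?mulr_ge0 ?(ltW g0) ?(ltW be0) ?(ltW ka10).
  have x4 : 0 <= x / 4 by rewrite divr_ge0.
  have a2 : 0 <= be / 2 by rewrite divr_ge0 ?ltW.
  apply: ler_pM; [exact: ltW|exact: mulr_ge0| |exact: ler_pM].
  by apply: gP; move: t8 t4; lra.
Qed.

Lemma solution_in_psi : exists (psi D F : R -> R) (C delta : R),
    [/\ 0 < delta,
        forall t, 0 < t < pi / 2 -> 0 <= psi t <= M /\ 0 <= F t <= C,
        forall t, 0 < t < pi / 2 -> [/\ is_derive t 1 psi (D t),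
          is_derive t 1 (fun s => Bw s * D s ^+ 3) (W (psi t) t) &
          is_derive t 1 F (Bw t * D t ^+ 4)],
        forall t, pi / 4 < t < pi / 2 -> delta <= psi t &
        forall t, 0 < t < pi / 2 - pi / 4 -> psi t <= M - delta].
Proof.
have [T10 T14] := pi8; have [T4L _] := pi4.
have L0 : 0 < pi / 2 :> R by rewrite divr_gt0.
have [S1L S2L] := force_lipb.
have loc := coefs_locally_controlled m1 m2 al be a0 b0 (ltW M0) S1L S2L.
have [bmax Bb] := stiffness_bounds m1 m2 a0 b0.
have [C1 VT] := potential_Phi.
have [y1 [cW [y10 cW0 Wle Wlt]]] := lower_force.
have [z1 [cZ [z10 cZ0 Zle Zlt]]] := upper_force.
have [psi [D [F [C [delta H]]]]] :=
  variational_solution L0 M0 Bb loc potential_derive VT ka00 Phi_test Phi_lipschitz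
    force_constants T10 T14 T4L y10 cW0 Wle Wlt T10 T14 T4L z10 cZ0 Zle Zlt.
by exists psi, D, F, C, delta.
Qed.

Lemma solution_in_phi : exists (phi dphi F : R -> R) (C delta : R),
  [/\ 0 < delta,
      forall t, 0 < t < pi / 2 -> 0 <= phi t <= pi / 2 /\ 0 <= F t <= C,
      forall t, 0 < t < pi / 2 ->
        [/\ is_derive t 1 phi (dphi t),
            is_derive t 1 (fun s => Bw s * (k2 (phi s) * dphi s ^+ 3))
              (- A1 t * (cos (phi t) ^+ 3 * sin (phi t))
               + A2 t * (sin (phi t) ^+ 3 * cos (phi t))) &
            is_derive t 1 F (Bw t * (k2 (phi t) * kap (phi t)) * dphi t ^+ 4)],
      forall t, pi / 4 < t < pi / 2 -> delta <= phi t &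
      forall t, 0 < t < pi / 4 -> phi t <= pi / 2 - delta].
Proof.
have [psi [D [F [C [delta [delta0 bounds deriv psige psile]]]]]] := solution_in_psi.
have kap3 x : kap x ^+ 3 = k2 x.
  have [mk [Mk [mk0 mkM]]] := quad_bounds c0 d0.
  by rewrite cube_rootK// (le_trans (ltW mk0))//; case/andP: (mkM x).
have [_ T14] := pi8; have [T4L _] := pi4.
have T44 : pi / 2 - pi / 4 = pi / 4 :> R by field.
pose phi t := Th (psi t); pose dphi t := D t / kap (phi t).
have psiE t : 0 < t < pi / 2 -> 0 <= phi t <= pi / 2 /\ Phi (phi t) = psi t.
  move=> /bounds[pb _]; have [x xP xE] := onto pb.
  by rewrite /phi -xE ThK//; case/andP: xP.
have dphi3 s : Bw s * (k2 (phi s) * dphi s ^+ 3) = Bw s * D s ^+ 3.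
  by rewrite /dphi -kap3; congr (_ * _); field; rewrite gt_eqF.
(* Dividing by [ka1], a Lipschitz constant of [Phi], turns distances in psi into distances in
   phi. *)
exists phi, dphi, F, C, (delta / ka1); split.
- exact: divr_gt0.
- by move=> t tP; split; [exact: (psiE t tP).1|exact: (bounds t tP).2].
- move=> t tP; have [d1 d2 d3] := deriv t tP; have [/andP[p0 _] pE] := psiE t tP.
  split.
  + have -> : dphi t = (kap (phi t))^-1 * D t by rewrite mulrC.
    by apply: (is_derive1_comp (f := Th)) => //; rewrite -pE; apply: Thetad; exact: gtN1.
  + by rewrite (_ : (fun s => _) = (fun s => Bw s * D s ^+ 3))//; apply/funext => s.
  + by apply: is_derive_eq d3 _; rewrite /dphi -kap3; field; rewrite gt_eqF.
- move=> t /andP[t4 t2].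
  have tP : 0 < t < pi / 2 by rewrite t2 (lt_trans _ t4)// divr_gt0.
  have [/andP[p0 _] pE] := psiE t tP.
  rewrite ler_pdivrMr// mulrC; apply: le_trans (psige t _) _; first by rewrite t4.
  by rewrite -pE; case/andP: (Phi_ge p0).
- move=> t /andP[t0 t4].
  have tP : 0 < t < pi / 2 by rewrite t0 (lt_trans t4).
  have [pb pE] := psiE t tP.
  have pl : psi t <= M - delta by apply: psile; rewrite T44 t0.
  rewrite lerBrDl -lerBrDr ler_pdivrMr// mulrC.
  have /andP[_] := Phi_compl pb; rewrite pE; apply: le_trans.
  by rewrite lerBrDl -lerBrDr.
Qed.

End variables.

(* The integrated form of the equation: multiplied by [h^4 w], its first three terms add
   up to the derivative of [h^2 w k(phi)^2 phi'^3]. *)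
Lemma equation_solution_exists : exists (phi dphi F : R -> R) (C delta : R),
  [/\ 0 < delta,
      forall t, 0 < t < pi / 2 -> 0 <= phi t <= pi / 2 /\ 0 <= F t <= C,
      forall t, 0 < t < pi / 2 ->
        [/\ is_derive t 1 phi (dphi t),
            is_derive t 1 (fun s => Bw s * (k2 (phi s) * dphi s ^+ 3))
              (- A1 t * (cos (phi t) ^+ 3 * sin (phi t))
               + A2 t * (sin (phi t) ^+ 3 * cos (phi t))) &
            is_derive t 1 F
              (Bw t * (k2 (phi t) * cube_root (k2 (phi t))) * dphi t ^+ 4)],
      forall t, pi / 4 < t < pi / 2 -> delta <= phi t &
      forall t, 0 < t < pi / 4 -> phi t <= pi / 2 - delta].
Proof.
have [mk [Mk [mk0 mkM]]] := quad_bounds c0 d0.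
have k2gt x : 0 < k2 x by case/andP: (mkM x) => + _; exact: lt_le_trans.
have ka00 : 0 < cube_root mk by exact: cube_root_gt0.
have kapb x : cube_root mk <= kap x <= cube_root Mk.
  by case/andP: (mkM x) => ? ?; rewrite !ler_cube_root// ltW.
have ka10 : 0 < cube_root Mk.
  by apply: lt_le_trans ka00 _; case/andP: (kapb 0) => h1 h2; exact: le_trans h1 h2.
have kapc : continuous kap.
  by move=> x; apply: (continuous_comp (@quad_continuous R c d x)); exact: cube_root_continuous.
have [Phi [ Theta [Phi0 Phid ThetaK Thetad [Phib Phis]]]] :=
  change_of_variable_exists kapc ka00 kapb.
have [P0 P0d] := @primitive_exists R (fun x => kap x * (- (cos x ^+ 3 * sin x))) (-1)
  ltac:(by move=> x; apply: cvgM; [exact: kapc|apply: cvgN; apply: cvgM;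
    [exact: (continuous_comp (@continuous_cos R x) (@exprn_continuous _ 3 _))|exact: continuous_sin]]).
have [Q0 Q0d] := @primitive_exists R (fun x => kap x * (sin x ^+ 3 * cos x)) (-1)
  ltac:(by move=> x; apply: cvgM; [exact: kapc|apply: cvgM;
    [exact: (continuous_comp (@continuous_sin R x) (@exprn_continuous _ 3 _))|exact: continuous_cos]]).
have derC (f : R -> R) (l k x : R) : is_derive x 1 f l -> is_derive x 1 (fun z => f z - k) l.
  move=> df; have -> : (fun z => f z - k) = f - cst k by apply/funext.
  by apply: is_derive_eq; rewrite subr0.
by apply: (@solution_in_phi _ _ Phi Theta (fun x => P0 x - P0 (pi / 2)) (fun x => Q0 x - Q0 0)
  ka00 ka10 kapb Phi0 Phid ThetaK Thetad Phib Phis) => //;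
  [move=> x /P0d; exact: derC|move=> x /Q0d; exact: derC|exact: subrr|exact: subrr].
Qed.

End solution.

(** * From the integrated equation to the displayed one; constants strictly between 0 and pi/2 *)

Lemma derive1_val (R : realType) (f : R -> R) (x l : R) :
  is_derive x 1 f l -> derive1 f x = l.
Proof. by move=> df; rewrite derive1E derive_val. Qed.

Section ode.
Context {R : realType}.
Implicit Types p q t : R.

Definition quad' p q t : R := 2 * (p ^+ 2 - q ^+ 2) * (sin t * cos t).

Lemma quad_derive p q t : is_derive t 1 (quad p q) (quad' p q t).
Proof.
have -> : quad p q = p ^+ 2 \*: (sin ^+ 2) + q ^+ 2 \*: (cos ^+ 2) by apply/funext.
by apply: is_derive_eq; rewrite /quad' /GRing.scale/=; ring.
Qed.

Lemma quad_gt0 p q t : 0 < p -> 0 < q -> 0 < quad p q t.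
Proof.
by move=> p0 q0; have [m [M [m0 mM]]] := quad_bounds p0 q0; apply: lt_le_trans m0 _; case/andP: (mM t).
Qed.

Lemma ell_sqr p q t : 0 < p -> 0 < q -> ell p q t ^+ 2 = quad p q t.
Proof. by move=> p0 q0; rewrite sqr_sqrtr// ltW// quad_gt0. Qed.

Lemma ell_gt0 p q t : 0 < p -> 0 < q -> 0 < ell p q t.
Proof. by move=> p0 q0; rewrite sqrtr_gt0 quad_gt0. Qed.

Lemma ell_derive1 p q t : 0 < p -> 0 < q ->
  derive1 (ell p q) t = quad' p q t / (2 * ell p q t).
Proof.
move=> p0 q0.
have dq := quad_derive p q t; have ds := is_derive1_sqrt (quad_gt0 t p0 q0).
have -> : ell p q = Num.sqrt \o quad p q by [].
by rewrite (derive1_val (is_derive1_comp ds dq)) mulrC.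
Qed.

Lemma weight_derive m1 m2 t : (0 < m1)%N -> (0 < m2)%N -> 0 < t < pi / 2 ->
  is_derive t 1 (weight m1 m2)
    (weight m1 m2 t * (m2%:R * (cos t / sin t) - m1%:R * (sin t / cos t))).
Proof.
move=> m10 m20 /sin_cos_gt0[s0 c0].
have -> : weight m1 m2 = (cos ^+ m1 * sin ^+ m2 : R -> R) by apply/funext => x; rewrite /= !fctE.
apply: is_derive_eq; rewrite /weight /GRing.scale/= !fctE.
have -> : cos t ^+ m1 = cos t * cos t ^+ m1.-1 by rewrite -exprS prednK.
have -> : sin t ^+ m2 = sin t * sin t ^+ m2.-1 by rewrite -exprS prednK.
move: (cos t ^+ m1.-1) (sin t ^+ m2.-1) m1%:R m2%:R => C S k1 k2.
by field; rewrite !gt_eqF.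
Qed.

Lemma arc_near t : 0 < t < pi / 2 -> \forall s \near t, 0 < (s : R) < pi / 2.
Proof.
move=> tP; have tI : t \in `]0, pi / 2[ by rewrite in_itv.
by apply: filterS (near_in_itvoo tI) => s; rewrite in_itv.
Qed.

End ode.

(** Here q1 = h^2, q2 = k(phi)^2, D = phi', l = (phi'^3)', w T = w', and br S is the force: the
    product rule for h^2 w k(phi)^2 phi'^3, divided by h^4 w. *)
Lemma expanded_equation (R : realType) (q1 q1' q2 q2' w l D T br S : R) :
  q1 != 0 -> w != 0 ->
  q1 * w * q2 * l + D ^+ 3 * ((q1' * w + q1 * (w * T)) * q2 + q1 * w * (q2' * D))
    = - (q1 ^+ 2 * w) * S * br ->
  q2 / q1 * l - q2 / q1 * (- T - q1' / q1) * D ^+ 3 + q2' / q1 * D ^+ 4 + br * S = 0.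
Proof.
move=> q0 w0 E.
have -> : q2 / q1 * l - q2 / q1 * (- T - q1' / q1) * D ^+ 3 + q2' / q1 * D ^+ 4 + br * S
  = (q1 * w * q2 * l + D ^+ 3 * ((q1' * w + q1 * (w * T)) * q2 + q1 * w * (q2' * D))
     - - (q1 ^+ 2 * w) * S * br) / (q1 ^+ 2 * w) by field; rewrite q0 w0.
by rewrite E subrr mul0r.
Qed.

Section ode_of_integrated_equation.
Context {R : realType}.
Variables (m1 m2 : nat) (a b c d al be : R) (phi dphi : R -> R).
Hypotheses (m1_gt0 : (0 < m1)%N) (m2_gt0 : (0 < m2)%N).
Hypotheses (a0 : 0 < a) (b0 : 0 < b) (c0 : 0 < c) (d0 : 0 < d).
Hypothesis dphiE : forall t, 0 < t < pi / 2 -> is_derive t 1 phi (dphi t).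

Let G s := stiffness m1 m2 a b s * (quad c d (phi s) * dphi s ^+ 3).

Hypothesis dG : forall t, 0 < t < pi / 2 -> is_derive t 1 G
  (- coef1 m1 m2 a b al t * (cos (phi t) ^+ 3 * sin (phi t))
   + coef2 m1 m2 a b be t * (sin (phi t) ^+ 3 * cos (phi t))).

Let Cf s := stiffness m1 m2 a b s * quad c d (phi s).

Let Cf_gt0 s : 0 < s < pi / 2 -> 0 < Cf s.
Proof.
move=> sP; have [? ?] := sin_cos_gt0 sP.
by rewrite !mulr_gt0 ?quad_gt0// exprn_gt0.
Qed.

Let dCf t : 0 < t < pi / 2 -> is_derive t 1 Cf
  ((quad' a b t * weight m1 m2 t + quad a b t *
     (weight m1 m2 t * (m2%:R * (cos t / sin t) - m1%:R * (sin t / cos t))))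
     * quad c d (phi t)
   + stiffness m1 m2 a b t * (quad' c d (phi t) * dphi t)).
Proof.
move=> tP; have d1 := quad_derive a b t; have d2 := weight_derive m1_gt0 m2_gt0 tP.
have d3 := dphiE tP; have d4 := quad_derive c d (phi t).
have d5 := is_derive1_comp d4 d3.
have -> : Cf = (quad a b * weight m1 m2) * (quad c d \o phi) by apply/funext.
apply: is_derive_eq; rewrite /GRing.scale/= /stiffness [(_ * _ : R -> R) t]/GRing.mul/=; ring.
Qed.

(** The cube of phi' is the quotient of the differentiable flux by the positive differentiable
    function [Cf]. No derivative of phi' itself is claimed, since the cube root is singular where
    phi' vanishes. *)
Let dcube t : 0 < t < pi / 2 -> exists l, is_derive t 1 (fun s => dphi s ^+ 3) l.
Proof.
move=> tP; have dc := is_deriveV (lt0r_neq0 (Cf_gt0 tP)) (dCf tP).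
have dg := dG tP.
have dd := is_deriveM dg dc.
eexists; apply: (near_eq_is_derive _ dd).
near=> s; have sP : 0 < s < pi / 2 by near: s; exact: arc_near.
by rewrite /= fctE /G mulrA -/(Cf s) mulrAC mulfV ?mul1r// gt_eqF// Cf_gt0.
Unshelve. all: by end_near. Qed.

(** The cube of phi' is continuous, and [cube_dist_le] removes the cube. *)
Lemma integrated_equation_continuous t : 0 < t < pi / 2 -> {for t, continuous dphi}.
Proof.
move=> tP; have [l dl] := dcube tP.
have /cvgrPdist_lt dc := is_derive_continuous dl.
apply/cvgrPdist_lt => e e0.
have e3 : 0 < e ^+ 3 / 4 by rewrite divr_gt0 ?exprn_gt0.
apply: filterS (dc _ e3) => s; rewrite ltr_pdivlMr// mulrC => se.
by apply: ltr_cube_cancel; apply: le_lt_trans (cube_dist_le _ _) se.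
Qed.

Lemma integrated_equation_ode t e1 e2 : 0 < t < pi / 2 ->
  al = c ^+ 4 / a ^+ 4 * e1 -> be = d ^+ 4 / b ^+ 4 * e2 ->
  [/\ derivable phi t 1, derivable (fun s => derive1 phi s ^+ 3) t 1 &
      ode_lhs m1 m2 a b c d e1 e2 phi t = 0].
Proof.
move=> tP alE beE; have [l dl] := dcube tP; have dp := dphiE tP.
have near_dphi : \forall s \near t, dphi s ^+ 3 = derive1 phi s ^+ 3.
  near=> s; have sP : 0 < s < pi / 2 by near: s; exact: arc_near.
  by rewrite (derive1_val (dphiE sP)).
have dl' := near_eq_is_derive near_dphi dl.
split; [by case: dp|by case: dl'|].
have phi'E : derive1 phi t = dphi t by exact: derive1_val.
have cubeE : derive1 (fun s => derive1 phi s ^+ 3) t = l by exact: derive1_val.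
have [st ct] := sin_cos_gt0 tP.
have GE : G = Cf * (fun s => dphi s ^+ 3) by apply/funext => s; rewrite /G mulrA.
have main := derive1_val (dG tP).
rewrite GE (derive1_val (is_deriveM (dCf tP) dl)) /GRing.scale/= coef_force in main.
rewrite /ode_lhs phi'E cubeE !ell_derive1// !ell_sqr//.
have hN : ell a b t != 0 by rewrite gt_eqF// ell_gt0.
have kN : ell c d (phi t) != 0 by rewrite gt_eqF// ell_gt0.
have qN : quad a b t != 0 by rewrite gt_eqF// quad_gt0.
have wN : weight m1 m2 t != 0 by rewrite gt_eqF// mulr_gt0// exprn_gt0.
have -> : 2 * (quad' a b t / (2 * ell a b t) / ell a b t) = quad' a b t / quad a b t.
  by rewrite -(ell_sqr t a0 b0); field.
have -> : 2 * ell c d (phi t) * (quad' c d (phi t) / (2 * ell c d (phi t))) = quad' c d (phi t).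
  by field.
by rewrite -[RHS](expanded_equation qN wN main) alE beE; ring.
Unshelve. all: by end_near. Qed.

End ode_of_integrated_equation.

(** At t = pi/4, where sine and cosine agree, the equation forces al cos^2 x = be sin^2 x; at t =
    pi/8, where they differ, this is contradictory. *)
Lemma constant_not_solution (R : realType) (al be x : R) : 0 < al -> 0 < be ->
  0 < x < pi / 2 ->
  ~ (forall t, 0 < t < pi / 2 ->
      al * (cos x ^+ 2 / cos t ^+ 4) - be * (sin x ^+ 2 / sin t ^+ 4) = 0).
Proof.
move=> al0 be0 /sin_cos_gt0[sx cx] H; have p0 := pi_gt0 R.
have P4 : 0 < (pi : R) / 4 < pi / 2 by lra.
have P8 : 0 < (pi : R) / 8 < pi / 2 by lra.
have [s4 c4] := sin_cos_gt0 P4; have [s8 c8] := sin_cos_gt0 P8.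
have h4 := H _ P4; have h8 := H _ P8.
have sc4 : sin (pi / 4) = cos (pi / 4) :> R.
  by rewrite -sin_compl; congr sin; field.
have sc8 : sin (pi / 8) < cos (pi / 8) :> R.
  by rewrite -sin_compl ltr_sin ?in_itv/=; lra.
have X0 : be * sin x ^+ 2 != 0 by rewrite gt_eqF// mulr_gt0// exprn_gt0.
have k4 : (cos (pi / 4) ^+ 4)^-1 != 0 :> R by rewrite invr_eq0 gt_eqF// exprn_gt0.
have E : al * cos x ^+ 2 = be * sin x ^+ 2.
  by apply: (mulIf k4); rewrite -[LHS]mulrA -[RHS]mulrA; apply: subr0_eq; rewrite -{2}sc4.
have : (cos (pi / 8) ^+ 4)^-1 = (sin (pi / 8) ^+ 4)^-1 :> R.
  by apply: (mulfI X0); rewrite -{1}E -[LHS]mulrA -[RHS]mulrA; apply: subr0_eq.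
move/invr_inj.
have : sin (pi / 8) ^+ 4 < cos (pi / 8) ^+ 4 :> R by apply: ltrXn2r => //; exact: ltW.
by move=> /[swap] ->; rewrite ltxx.
Qed.

(** * Integrals over the arc, weak derivatives *)

(** The integral of a nonnegative function is a supremum over the simple functions below it, hence
    monotone for arbitrary functions. This allows comparison of iterated sphere integrals without
    measurability of the slices. *)
Lemma ge0_le_integral_nomeasurability d (T : measurableType d) (R : realType)
    (mu : {measure set T -> \bar R}) (D : set T) (f g : T -> \bar R) :
  (forall x, D x -> 0 <= f x /\ f x <= g x)%E ->
  (\int[mu]_(x in D) f x <= \int[mu]_(x in D) g x)%E.
Proof.
move=> fg; rewrite !ge0_integralE; first last.
- by move=> x /fg[].
- by move=> x /fg[f0 fg']; exact: le_trans f0 fg'.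
apply: ereal_sup_le => _ [h hf <-]; exists h => // x.
apply: le_trans (hf x) _; rewrite /patch; case: ifPn => // xD.
by rewrite inE in xD; case: (fg x xD).
Qed.

Lemma near_ltr (R : realType) (a x : R) : x < a -> \forall z \near x, z < a.
Proof.
move=> ax; apply/nbhs_ballP; exists (a - x) => /=; first by rewrite subr_gt0.
by move=> z; rewrite /ball/= ltr_norml; lra.
Qed.

Section arc_integrals.
Context {R : realType}.
Local Notation mu := (@lebesgue_measure R).

Lemma arcE (t : R) : Defs.arc t = (0 < t < pi / 2) :> Prop.
Proof. by rewrite /Defs.arc/= in_itv. Qed.

Lemma open_arc : open (@Defs.arc R).
Proof. exact: interval_open. Qed.

Lemma measurable_arc : measurable (@Defs.arc R).
Proof. exact: measurable_itv. Qed.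

Lemma arc_continuous_measurable (f : R -> R) :
  (forall t : R, 0 < t < pi / 2 -> {for t, continuous f}) -> measurable_fun (@Defs.arc R) f.
Proof.
move=> fc; apply: open_continuous_measurable_fun; first exact: open_arc.
by move=> t; rewrite inE arcE => /fc.
Qed.

Lemma compact_subarc_integrable (f : R -> R) (K : set R) :
  (forall t : R, 0 < t < pi / 2 -> {for t, continuous f}) -> K `<=` @Defs.arc R -> compact K ->
  mu.-integrable K (EFin \o f).
Proof.
move=> fc KA cK; apply: continuous_compact_integrable => //.
by apply: continuous_in_subspaceT => t; rewrite inE => /KA; rewrite arcE => /fc.
Qed.

Lemma arc_continuous_locally_integrable (f : R -> R) :
  (forall t : R, 0 < t < pi / 2 -> {for t, continuous f}) -> locally_integrable (@Defs.arc R) f.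
Proof.
move=> fc; split; [exact: arc_continuous_measurable|exact: open_arc|].
move=> K KA cK; have /integrableP[_] := compact_subarc_integrable fc KA cK.
by apply: le_lt_trans; under eq_integral do rewrite -abse_EFin.
Qed.

Lemma FTC_subarc (F f : R -> R) (u v : R) : 0 < u -> u < v -> v < pi / 2 ->
  (forall t : R, 0 < t < pi / 2 -> is_derive t 1 F (f t)) ->
  (forall t : R, 0 < t < pi / 2 -> {for t, continuous f}) ->
  (\int[mu]_(t in `[u, v]) (f t)%:E = (F v - F u)%:E)%E.
Proof.
move=> u0 uv vL dF fc.
have inarc t : t \in `[u, v] -> 0 < t < pi / 2 by rewrite in_itv/=; lra.
rewrite EFinB; apply: continuous_FTC2 => //.
- by apply: continuous_in_subspaceT => t; rewrite inE/= => /inarc/fc.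
- have Fc t : t \in `[u, v] -> {for t, continuous F}.
    by move=> /inarc/dF; exact: is_derive_continuous.
  split.
  + by move=> t tuv; have [] := dF t (inarc _ (subset_itv_oo_cc tuv)).
  + by apply: cvg_at_right_filter; apply: Fc; rewrite in_itv/= lexx ltW.
  + by apply: cvg_at_left_filter; apply: Fc; rewrite in_itv/= lexx ltW.
- by move=> t tuv; rewrite (derive1_val (dF t (inarc _ (subset_itv_oo_cc tuv)))).
Qed.

(** Monotone convergence along compact subintervals, on each of which the integral is a difference
    of two values of [F]. *)
Lemma arc_integral_bounded_primitive (F f : R -> R) (C : R) :
  (forall t : R, 0 < t < pi / 2 -> `|F t| <= C /\ 0 <= f t) ->
  (forall t : R, 0 < t < pi / 2 -> is_derive t 1 F (f t)) ->
  (forall t : R, 0 < t < pi / 2 -> {for t, continuous f}) ->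
  (\int[mu]_(t in @Defs.arc R) (f t)%:E <= (2 * C)%:E)%E.
Proof.
move=> Ff dF fc; have L0 : 0 < pi / 2 :> R by rewrite divr_gt0// pi_gt0.
(* With [n.+3] the margin is at most a third of the arc, so every [I n] is a proper interval. *)
pose e (n : nat) : R := pi / 2 / n.+3%:R.
pose I n := `[e n, pi / 2 - e n]%classic : set R.
have e0 n : 0 < e n by rewrite divr_gt0.
have e3 n : e n <= pi / 2 / 3 by rewrite ler_pM2l// lef_pV2 ?posrE// ler_nat.
have ede n m : (n <= m)%N -> e m <= e n by move=> nm; rewrite ler_pM2l// lef_pV2 ?posrE// ler_nat.
have Iarc n t : I n t -> 0 < t < pi / 2.
  rewrite /I/= in_itv/= => /andP[h1 h2]; apply/andP; split; first exact: lt_le_trans h1.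
  by apply: le_lt_trans h2 _; rewrite gtrBl.
have arcI : @Defs.arc R = \bigcup_n I n.
  apply/seteqP; split=> t; last by case=> n _ /Iarc; rewrite arcE.
  rewrite arcE => tP.
  have m0 : 0 < Num.min t (pi / 2 - t) by rewrite lt_min; lra.
  have [n _ /(_ n (leqnn n))] := mesh_cvg (pi / 2) m0.
  rewrite /mesh lt_min => /andP[n1 n2].
  have en : e n <= pi / 2 / n.+1%:R by rewrite ler_pM2l// lef_pV2 ?posrE// ler_nat -addn2 leq_addr.
  have tI : e n <= t <= pi / 2 - e n.
    by rewrite (le_trans en (ltW n1))/= lerBrDr -lerBrDl (le_trans en (ltW n2)).
  by exists n => //; rewrite /I/= in_itv.
have cvgI : (\int[mu]_(t in I i) (f t)%:E @[i --> \oo]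
    --> \int[mu]_(t in \bigcup_i I i) (f t)%:E)%E.
  apply: ge0_nondecreasing_set_cvg_integral.
  - apply/nondecreasing_seqP => n; rewrite subsetEset => t; rewrite /I/= !in_itv/= => tI.
    have en := ede n n.+1 (leqnSn n); apply/andP; split; first by case/andP: tI => /(le_trans en).
    by case/andP: tI => _ /le_trans; apply; rewrite lerB.
  - by move=> n; exact: measurable_itv.
  - move=> n; apply/measurable_EFinP.
    apply: measurable_funS (arc_continuous_measurable fc); first exact: measurable_arc.
    by move=> t /Iarc; rewrite arcE.
  - by move=> n t /Iarc/Ff[_]; rewrite lee_fin.
rewrite arcI; apply: (cvge_to_le cvgI); apply: nearW => n.
have en : 0 < e n < pi / 2 - e n by have := e3 n; have := e0 n; move: (e n) => z z0 z3; lra.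
have /andP[en1 en2] := en.
rewrite /I (FTC_subarc (F := F)) //; last by rewrite gtrBl.
rewrite lee_fin.
have [|H1 _] := Ff (e n); first by rewrite en1 (lt_trans en2)// gtrBl.
have [|H2 _] := Ff (pi / 2 - e n); first by rewrite (lt_trans en1 en2) gtrBl.
by move: H1 H2; rewrite !ler_norml; lra.
Qed.

Lemma smooth_derive1_continuous (eta : R -> R) : smooth_on setT eta ->
  (forall t : R, is_derive t 1 eta (derive1 eta t)) /\ continuous (derive1 eta).
Proof.
move=> /(_ 1%N)[de dc]; split=> [t|t].
  by apply: DeriveDef; [apply/derivable1_diffP; exact: de|rewrite derive1E].
have -> : derive1 eta = 'D_1 eta by apply/funext => s; rewrite derive1E.
exact: (dc 1 t I).
Qed.

Lemma arc_weak_derivative (phi dphi : R -> R) :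
  (forall t : R, 0 < t < pi / 2 -> is_derive t 1 phi (dphi t)) ->
  (forall t : R, 0 < t < pi / 2 -> {for t, continuous dphi}) ->
  weak_derivative phi dphi.
Proof.
move=> dphiE dphic.
have phic (t : R) : 0 < t < pi / 2 -> {for t, continuous phi}.
  by move=> /dphiE; exact: is_derive_continuous.
split; [exact: arc_continuous_locally_integrable|exact: arc_continuous_locally_integrable|].
move=> eta [etaS [u [v [u0 vL eta0]]]].
have [deta detac] := smooth_derive1_continuous etaS.
have etac : continuous eta by move=> t; exact: is_derive_continuous (deta t).
have deta0 (t : R) : t < u \/ v < t -> derive1 eta t = 0.
  move=> tuv; apply: derive1_val.
  have near0 : \forall s \near t, cst 0 s = eta s.
    case: tuv => tu; [apply: filterS (near_ltr tu)|apply: filterS (near_gtr tu)] => s su;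
      by rewrite eta0//; lra.
  exact: near_eq_is_derive near0 (is_derive_cst 0 t 1).
have p0 := pi_gt0 R.
(* The bounds u, v of the support come unordered; pi/4 separates them. The interval is then enlarged
   strictly, so that [eta] vanishes at its ends and [eta], with its derivative, outside: integration
   by parts has no boundary terms. *)
pose u1 : R := Num.min u (pi / 4); pose v1 : R := Num.max v (pi / 4).
have u1P : 0 < u1 <= u by rewrite lt_min ge_min lexx u0/=; lra.
have v1P : v <= v1 < pi / 2 by rewrite gt_max le_max lexx vL/=; lra.
have uv1 : u1 <= v1 by apply: le_trans (_ : pi / 4 <= _); rewrite ?ge_min ?le_max lexx orbT.
pose u' : R := u1 / 2; pose v' : R := (v1 + pi / 2) / 2.
have [u'0 v'L uv'] : [/\ 0 < u', v' < pi / 2 & u' < v'] by rewrite /u' /v'; split; lra.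
have [uu1 vv1] : u' < u1 /\ v1 < v' by rewrite /u' /v'; split; lra.
have outside (t : R) : ~ (u' <= t <= v') -> eta t = 0 /\ derive1 eta t = 0.
  move=> tuv; have tu : t < u \/ v < t.
    by have [|ut] := ltP t u; [left|right; rewrite ltNge; apply/negP => tv; apply: tuv; lra].
  by split; [apply: eta0; lra|exact: deta0].
have shrink (g : R -> R) : (forall t, ~ (u' <= t <= v') -> g t = 0) ->
    (\int[mu]_(t in @Defs.arc R) (g t)%:E = \int[mu]_(t in `[u', v']) (g t)%:E)%E.
  move=> g0; rewrite [LHS]integral_mkcond [RHS]integral_mkcond.
  apply: eq_integral => t _; rewrite /patch.
  have [tI|tI] := pselect (u' <= t <= v').
    by rewrite !mem_set ?arcE//= ?in_itv//=; lra.
  rewrite g0//; case: ifP => _; by case: ifP.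
rewrite !shrink; first last.
- by move=> t /outside[_ ->]; rewrite mulr0.
- by move=> t /outside[-> _]; rewrite mulr0.
have d_prod (t : R) : 0 < t < pi / 2 -> is_derive t 1 (phi * eta) (phi t * derive1 eta t + dphi t * eta t).
  move=> tP; have := is_deriveM (dphiE t tP) (deta t) => dM.
  by apply: is_derive_eq; rewrite /GRing.scale/= (mulrC (eta t)).
have c1 (t : R) : 0 < t < pi / 2 -> {for t, continuous (fun t => phi t * derive1 eta t)}.
  by move=> tP; apply: cvgM; [exact: phic|exact: detac].
have c2 (t : R) : 0 < t < pi / 2 -> {for t, continuous (fun t => dphi t * eta t)}.
  by move=> tP; apply: cvgM; [exact: dphic|exact: etac].
have c12 (t : R) : 0 < t < pi / 2 ->
    {for t, continuous (fun t => phi t * derive1 eta t + dphi t * eta t)}.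
  by move=> tP; apply: cvgD; [exact: c1|exact: c2].
have := FTC_subarc u'0 uv' v'L d_prod c12.
have Karc : `[u', v']%classic `<=` @Defs.arc R.
  by move=> t; rewrite arcE/= in_itv/=; lra.
have cK : compact (`[u', v']%classic : set R) by exact: segment_compact.
have i1 := compact_subarc_integrable c1 Karc cK.
have i2 := compact_subarc_integrable c2 Karc cK.
under eq_integral do rewrite EFinD.
rewrite integralD//.
have f1 : (\int[mu]_(t in `[u', v']) (phi t * derive1 eta t)%:E \is a fin_num)%E.
  exact: integrable_fin_num i1.
have f2 : (\int[mu]_(t in `[u', v']) (dphi t * eta t)%:E \is a fin_num)%E.
  exact: integrable_fin_num i2.
have z1 : (phi * eta) v' - (phi * eta) u' = 0.
  rewrite [(phi * eta) v']/GRing.mul/= [(phi * eta) u']/GRing.mul/= !eta0 ?mulr0 ?subrr//; lra.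
rewrite z1 -(fineK f1) -(fineK f2) -EFinD => -[] E.
by rewrite -EFinN; congr (_%:E); apply/eqP; rewrite -addr_eq0 E.
Qed.

End arc_integrals.

(** * Integration over spheres in polar coordinates *)

Lemma integral_ge_subinterval (R : realType) (f : R -> \bar R) (u v r1 r2 e : R) :
  u <= r1 -> r1 < r2 -> r2 <= v -> 0 <= e ->
  (forall r, (u <= r <= v)%R -> 0 <= f r)%E ->
  (forall r, (r1 <= r <= r2)%R -> e%:E <= f r)%E ->
  ((e * (r2 - r1))%:E <= \int[lebesgue_measure]_(r in `[u, v]) f r)%E.
Proof.
move=> ur r12 rv e0 f0 fe.
pose g r : R := if r1 <= r <= r2 then e else 0.
apply: le_trans (_ : (\int[lebesgue_measure]_(r in `[u, v]) (g r)%:E <= _)%E); last first.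
  apply: ge0_le_integral_nomeasurability => r; rewrite /= in_itv/= => rP.
  by rewrite /g; case: ifP => rr; rewrite lee_fin; split => //; [exact: fe|exact: f0].
have -> : (\int[lebesgue_measure]_(r in `[u, v]) (g r)%:E =
           \int[lebesgue_measure]_(r in `[r1, r2]) (cst e%:E) r)%E.
  rewrite [LHS]integral_mkcond [RHS]integral_mkcond; apply: eq_integral => r _.
  rewrite /patch; have [rI|rI] := boolP (r1 <= r <= r2).
    by rewrite !mem_set/= ?in_itv//=; [rewrite /g rI|lra].
  rewrite [X in _ = if X then _ else _]memNset/= ?in_itv/= ?(negbTE rI)//.
  by case: ifP; rewrite // /g (negbTE rI).
by rewrite integral_cst//= lebesgue_measure_itv/= lte_fin r12 EFinM EFinB.
Qed.

Section spheres.
Context {R : realType}.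

Lemma dotv_row_mx m n (x1 y1 : 'rV[R]_m) (x2 y2 : 'rV[R]_n) :
  dotv (row_mx x1 x2) (row_mx y1 y2) = dotv x1 y1 + dotv x2 y2.
Proof. by rewrite !dotvE tr_row_mx mul_row_col mxE. Qed.

Lemma dotvZ n (k l : R) (x y : 'rV[R]_n) : dotv (k *: x) (l *: y) = k * l * dotv x y.
Proof. by rewrite /dotv mulr_sumr; apply: eq_bigr => i _; rewrite !mxE; ring. Qed.

Lemma dotv_ge0 n (x : 'rV[R]_n) : 0 <= dotv x x.
Proof. by apply: sumr_ge0 => i _; rewrite -expr2 sqr_ge0. Qed.

Lemma dotv_eq0 n (x : 'rV[R]_n) : dotv x x = 0 -> x = 0.
Proof.
move=> /eqP; rewrite psumr_eq0 => [/allP x0|i _]; last by rewrite -expr2 sqr_ge0.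
apply/rowP => i; rewrite mxE; have := x0 i (mem_index_enum i).
by rewrite -expr2 sqrf_eq0 => /eqP.
Qed.

Lemma sphere_coord n (x : 'rV[R]_n.+1) i : sphere x -> `|x ord0 i| <= 1.
Proof.
move=> xS; rewrite -(ler_pXn2r (n := 2))// ?nnegrE// expr1n real_normK ?num_real//.
rewrite -xS /dotv (bigD1 i)//= expr2 lerDl.
by apply: sumr_ge0 => j _; rewrite -expr2 sqr_ge0.
Qed.

Definition polar m (r : R) (y : 'rV[R]_m.+1) : 'rV[R]_m.+2 :=
  row_mx (cos r)%:M (sin r *: y) : 'rV[R]_(1 + m.+1).

Lemma polar_dot m r (y : 'rV[R]_m.+1) :
  dotv (polar r y) (polar r y) = cos r ^+ 2 + sin r ^+ 2 * dotv y y.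
Proof.
rewrite (@dotv_row_mx 1 m.+1) dotvZ -expr2; congr (_ + _).
by rewrite /dotv big_ord1 mxE eqxx mulr1n.
Qed.

Lemma sphere_polar m r (y : 'rV[R]_m.+1) : sphere y -> sphere (polar r y).
Proof. by rewrite /sphere/= => yS; rewrite polar_dot yS mulr1 cos2Dsin2. Qed.

Lemma polar_coord m r r0 (y y0 : 'rV[R]_m.+1) (i : 'I_m.+2) :
  polar r y ord0 i - polar r0 y0 ord0 i = cos r - cos r0 \/
  exists j, polar r y ord0 i - polar r0 y0 ord0 i = sin r * y ord0 j - sin r0 * y0 ord0 j.
Proof.
have pl s z (j : 'I_1) : @polar m s z ord0 (lshift m.+1 j) = cos s.
  have -> : cos s = ((cos s)%:M : 'M[R]_1) ord0 j by rewrite mxE !ord1 eqxx mulr1n.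
  exact: row_mxEl.
have pr s z j : @polar m s z ord0 (rshift 1 j) = sin s * z ord0 j.
  have -> : sin s * z ord0 j = (sin s *: z) ord0 j by rewrite mxE.
  exact: row_mxEr.
case: (@fintype.split_ordP 1 m.+1 i) => j ->; first by left; rewrite !pl.
by right; exists j; rewrite !pr.
Qed.

Lemma sphere_nonempty m : exists x : 'rV[R]_m.+1, sphere x.
Proof.
exists (delta_mx ord0 ord0); rewrite /sphere/= /dotv (bigD1 ord0)//= mxE !eqxx mulr1.
by rewrite big1 ?addr0// => i /negbTE i0; rewrite mxE eqxx i0 mulr0.
Qed.

Lemma polar_surj m (x : 'rV[R]_m.+2) : sphere x ->
  exists r y, [/\ 0 <= r <= pi, sphere y & x = polar r y].
Proof.
move=> xS; have xE := @hsubmxK R 1 1 m.+1 x.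
set x1 := lsubmx _ in xE; set x2 := rsubmx _ in xE.
have x1E : x1 = (x1 ord0 ord0)%:M by exact: mx11_scalar.
have x12 : x1 ord0 ord0 ^+ 2 + dotv x2 x2 = 1.
  rewrite -[RHS]xS -xE (@dotv_row_mx 1 m.+1); congr (_ + _).
  by rewrite /dotv big_ord1 expr2.
have c1 : -1 <= x1 ord0 ord0 <= 1.
  rewrite -ler_norml -(ler_pXn2r (n := 2))// ?nnegrE// expr1n real_normK ?num_real//.
  by rewrite -x12 lerDl dotv_ge0.
pose r := acos (x1 ord0 ord0).
have rP : 0 <= r <= pi by rewrite acos_ge0// acos_lepi.
have cr : cos r = x1 ord0 ord0 by rewrite acosK// in_itv.
have sr : sin r ^+ 2 = dotv x2 x2 by rewrite sin2cos2 cr -x12; ring.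
(* At the poles the direction is undetermined and any point of the smaller sphere will do. *)
have [s0|s0] := eqVneq (sin r) 0.
  have [y yS] := sphere_nonempty m; exists r, y; split => //.
  have x20 : x2 = 0 by apply: dotv_eq0; rewrite -sr s0 expr0n.
  by rewrite /polar cr -x1E s0 scale0r -x20 xE.
exists r, ((sin r)^-1 *: x2); split => //.
  by rewrite /sphere/= dotvZ -sr; field.
by rewrite /polar cr -x1E scalerA divff// scale1r xE.
Qed.

Lemma sphere_integralS m (u : 'rV[R]_m.+2 -> \bar R) :
  sphere_integral u = (\int[lebesgue_measure]_(r in `[0%R, (pi : R)])
    ((sin r ^+ m)%:E * sphere_integral (fun y => u (polar r y))))%E.
Proof. by []. Qed.

Lemma sphere0 (x : 'rV[R]_1) : sphere x -> x = const_mx 1 \/ x = const_mx (-1).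
Proof.
rewrite /sphere/= /dotv big_ord1 -expr2 => /eqP; rewrite sqrf_eq1 => /orP[]/eqP x0;
  [left|right]; by apply/rowP => i; rewrite !mxE ord1.
Qed.

Lemma sphere0_poles : sphere (const_mx 1 : 'rV[R]_1) /\ sphere (const_mx (-1) : 'rV[R]_1).
Proof. by split; rewrite /sphere/= /dotv big_ord1 !mxE ?mulrNN mulr1. Qed.

Lemma sin_pow_ge0 m (r : R) : 0 <= r <= pi -> 0 <= sin r ^+ m.
Proof. by move=> rP; rewrite exprn_ge0// sin_ge0_pi. Qed.

(** Nonnegativity is carried through the same induction, because the comparison of the outer
    integrals relies on that of the inner ones. *)
Lemma sphere_integral_le m (u v : 'rV[R]_m.+1 -> \bar R) :
  (forall x, sphere x -> 0 <= u x /\ u x <= v x)%E ->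
  (0 <= sphere_integral u /\ sphere_integral u <= sphere_integral v)%E.
Proof.
elim: m u v => [|m IH] u v uv.
  have [p1 p2] := @sphere0_poles.
  have [u1 v1] := uv _ p1; have [u2 v2] := uv _ p2.
  by split; [exact: adde_ge0|exact: leeD].
rewrite !sphere_integralS.
have IHr r := IH (fun y => u (polar r y)) (fun y => v (polar r y))
  (fun y yS => uv _ (sphere_polar r yS)).
split.
  apply: integral_ge0 => r; rewrite /= in_itv/= => rP.
  by apply: mule_ge0; [rewrite lee_fin sin_pow_ge0|case: (IHr r)].
apply: ge0_le_integral_nomeasurability => r; rewrite /= in_itv/= => rP.
have s0 : (0 <= (sin r ^+ m)%:E)%E by rewrite lee_fin sin_pow_ge0.
by have [u0 uv'] := IHr r; split; [exact: mule_ge0|exact: lee_wpmul2l].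
Qed.

(** [V] is the volume. Only its positivity and finiteness matter, so the recursion over the
    dimension is left unevaluated. *)
Lemma sphere_integral_cst m : exists2 V : R, 0 < V &
  forall C : R, 0 <= C -> @sphere_integral R m (fun=> C%:E) = (C * V)%:E.
Proof.
elim: m => [|m [V V0 VE]].
  by exists 2 => // C C0; rewrite /= -EFinD; congr EFin; ring.
have pi0 := pi_gt0 R.
pose mu := @lebesgue_measure R.
have sc : continuous (fun r : R => sin r ^+ m).
  by move=> r; exact: (continuous_comp (@continuous_sin R r) (@exprn_continuous _ m _)).
have si : mu.-integrable `[0, pi] (EFin \o (fun r : R => sin r ^+ m)).
  apply: continuous_compact_integrable; first exact: segment_compact.
  exact: continuous_subspaceT.
have sfin : ((\int[mu]_(r in `[0%R, (pi : R)]) (sin r ^+ m)%:E)%E \is a fin_num).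
  exact: integrable_fin_num si.
pose S := fine (\int[mu]_(r in `[0%R, (pi : R)]) (sin r ^+ m)%:E)%E.
have SE : (\int[mu]_(r in `[0%R, (pi : R)]) (sin r ^+ m)%:E)%E = S%:E by rewrite fineK.
have S0 : 0 < S.
  have s4 : 0 < sin (pi / 4 : R) by apply: sin_gt0_pihalf; lra.
  have := @integral_ge_subinterval R (fun r => (sin r ^+ m)%:E) 0 pi (pi / 4) (pi / 2)
    (sin (pi / 4) ^+ m) ltac:(lra) ltac:(lra) ltac:(lra) (exprn_ge0 _ (ltW s4)).
  rewrite -/mu SE lee_fin => H; apply: lt_le_trans (H _ _).
  - by rewrite mulr_gt0 ?exprn_gt0//; lra.
  - by move=> r rP; rewrite lee_fin sin_pow_ge0.
  - move=> r rP; rewrite lee_fin; have sr : sin (pi / 4) <= sin r by apply: ler_sin; lra.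
    by apply: lerXn2r; rewrite ?nnegrE ?(ltW s4)// (le_trans (ltW s4)).
exists (V * S) => [|C C0]; first exact: mulr_gt0.
rewrite sphere_integralS.
under eq_integral do rewrite VE// muleC.
rewrite ge0_integralZl_EFin//.
- by rewrite -/mu SE -EFinM mulrA.
- by move=> r; rewrite /= in_itv/= => rP; rewrite lee_fin sin_pow_ge0.
- apply/measurable_EFinP; apply: measurable_funS (continuous_measurable_fun sc) => //.
- by rewrite mulr_ge0// ltW.
Qed.

(** A neighbourhood of x0 contains a polar box on which sine is bounded below. The constant depends
    only on x0 and the radii, not on [u], so the induction hypothesis applies with the same constant
    to all slices. The radius is split in three: one third suffices for the cosine coordinate, two
    for the product of sine and y. *)
Lemma sphere_integral_ge_local m (x0 : 'rV[R]_m.+1) (del eps : R) :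
  sphere x0 -> 0 < del -> 0 < eps -> exists2 eta : R, 0 < eta &
  forall u : 'rV[R]_m.+1 -> \bar R, (forall x, sphere x -> 0 <= u x)%E ->
   (forall x, sphere x -> (forall i, `|x ord0 i - x0 ord0 i| < del)%R -> eps%:E <= u x)%E ->
   (eta%:E <= sphere_integral u)%E.
Proof.
elim: m x0 del => [|m IH] x0 del x0S del0 eps0.
  exists eps => // u u0 ue; have ux0 : (eps%:E <= u x0)%E.
    by apply: ue => // i; rewrite subrr normr0.
  have [p1 p2] := @sphere0_poles.
  case: (sphere0 x0S) ux0 => -> ux0 /=; first by apply: le_trans ux0 _; rewrite leeDl// u0.
  by apply: le_trans ux0 _; rewrite leeDr// u0.
have [r0 [y0 [r0P y0S x0E]]] := polar_surj x0S.
have pi2 := pi_ge2 R.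
have d3 : 0 < del / 3 by rewrite divr_gt0.
have [eta eta0 etaP] := IH y0 (del / 3) y0S d3 eps0.
(* The point may be a pole, where the volume factor vanishes, so the interval is moved off [r0]
   towards the interior of [0, pi]. *)
have [r1 [r2 [r12 rin rclose]]] : exists r1 r2, [/\ r1 < r2, 0 < r1 /\ r2 < pi &
    forall r, r1 <= r <= r2 -> `|r - r0| <= del / 3].
  pose rho := Num.min (del / 3) (2^-1).
  have rho0 : 0 < rho by rewrite lt_min d3; lra.
  have rhod : rho <= del / 3 by rewrite ge_min lexx.
  have rho2 : rho <= 2^-1 by rewrite ge_min lexx orbT.
  have [r0h|r0h] := leP r0 (pi / 2).
    exists (r0 + rho / 2), (r0 + rho); split; [lra|split; lra|].
    by move=> r rP; rewrite ler_norml; lra.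
  exists (r0 - rho), (r0 - rho / 2); split; [lra|split; lra|].
  by move=> r rP; rewrite ler_norml; lra.
have [s s0 sP] : exists2 s, 0 < s & forall r, r1 <= r <= r2 -> s <= sin r.
  have sc : {within `[r1, r2], continuous (@sin R)}.
    by apply: continuous_subspaceT; exact: continuous_sin.
  have [z zP zmin] := EVT_min (ltW r12) sc.
  exists (sin z); first by apply: sin_gt0_pi; move: zP; rewrite in_itv/=; lra.
  by move=> r rP; apply: zmin; rewrite in_itv.
exists (s ^+ m * eta * (r2 - r1)).
  by rewrite !mulr_gt0 ?exprn_gt0// subr_gt0.
move=> u u0 ue; rewrite sphere_integralS.
apply: integral_ge_subinterval => //; try lra.
- by rewrite mulr_ge0 ?exprn_ge0// ltW.
- move=> r rP; apply: mule_ge0; first by rewrite lee_fin sin_pow_ge0.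
  have uu y (yS : sphere y) : (0 <= u (polar r y) /\ u (polar r y) <= u (polar r y))%E.
    by split; [apply: u0; exact: sphere_polar|].
  by have [] := sphere_integral_le uu.
- move=> r rP; rewrite EFinM; apply: lee_pmul; rewrite ?lee_fin ?exprn_ge0 ?(ltW s0) ?(ltW eta0)//.
    have sr := sP r rP; apply: lerXn2r => //; rewrite ?nnegrE ?(ltW s0)//.
    exact: le_trans (ltW s0) sr.
  apply: etaP => y yS; first by apply: u0; exact: sphere_polar.
  move=> yc.
  apply: (ue _ (sphere_polar r yS)) => i.
  have rc := rclose r rP.
  rewrite x0E; case: (polar_coord r r0 y y0 i) => [->|[j ->]].
    by apply: le_lt_trans (cos_lipschitz _ _) _; lra.
  have -> : sin r * y ord0 j - sin r0 * y0 ord0 j =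
    (sin r - sin r0) * y ord0 j + sin r0 * (y ord0 j - y0 ord0 j) by ring.
  apply: le_lt_trans (ler_normD _ _) _; rewrite !normrM.
  have h1 : `|sin r - sin r0| * `|y ord0 j| <= del / 3.
    rewrite -[leRHS]mulr1; apply: ler_pM => //; last exact: sphere_coord.
    exact: le_trans (sin_lipschitz _ _) rc.
  have h2 : `|sin r0| * `|y ord0 j - y0 ord0 j| <= 1 * (del / 3).
    by apply: ler_pM => //; [exact: sin_max|apply: ltW; exact: yc].
  by lra.
Qed.

End spheres.

(** * Nonconstant smooth maps of spheres have a nonzero pullback somewhere *)

Section smooth_sphere_maps.
Context {R : realType}.

Lemma continuous_at_dotv (T : topologicalType) n (f g : T -> 'rV[R]_n) (x : T) :
  {for x, continuous f} -> {for x, continuous g} ->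
  {for x, continuous (fun y => dotv (f y) (g y))}.
Proof.
move=> fx gx; apply: continuous_at_sum => i.
by apply: cvgM; apply: (@continuous_comp T _ _ _ (fun M : 'rV[R]_n => M ord0 i)) => //;
  exact: coord_continuous.
Qed.

Lemma sphere_neq0 m (x : 'rV[R]_m.+1) : sphere x -> x != 0.
Proof.
move=> xS; apply/eqP => x0; move: xS; rewrite /sphere /= x0 /dotv big1 => [/esym/eqP|i _].
  by rewrite oner_eq0.
by rewrite mxE mul0r.
Qed.

Lemma sphere_compact m : compact (@sphere R m).
Proof.
apply: bounded_closed_compact.
  exists 1; split=> [|M M1 x xS]; first exact: num_real.
  rewrite /= /Num.norm /= mx_normrE; apply: bigmax_le => [|[i j] _ /=]; first by lra.
  by rewrite ord1; apply: le_trans (sphere_coord j xS) _; exact: ltW.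
rewrite (_ : sphere (m:=m) = (fun x => dotv x x) @^-1` [set 1])//.
apply: closed_comp; last exact: closed_eq.
by move=> x _; apply: continuous_at_dotv; exact: cvg_id.
Qed.

Lemma enormZ m (k : R) (x : 'rV[R]_m) : 0 <= k -> enorm (k *: x) = k * enorm x.
Proof.
by move=> k0; rewrite /enorm dotvZ sqrtrM ?mulr_ge0// -expr2 sqrtr_sqr ger0_norm.
Qed.

Lemma enorm_gt0 m (x : 'rV[R]_m) : x != 0 -> 0 < enorm x.
Proof.
move=> x0; rewrite sqrtr_gt0 lt_neqAle dotv_ge0 andbT eq_sym.
by apply: contra_neq x0 => /dotv_eq0.
Qed.

Lemma sphere_normalize m (x : 'rV[R]_m.+1) : x != 0 -> sphere ((enorm x)^-1 *: x).
Proof.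
move=> x0; rewrite /sphere /= dotvZ -[dotv x x]sqr_sqrtr ?dotv_ge0// -/(enorm x).
by have /lt0r_neq0 e0 := enorm_gt0 x0; field.
Qed.

Variables (m n : nat) (f : 'rV[R]_m.+1 -> 'rV[R]_n.+1).

Lemma radialZ (k : R) x : 0 < k -> radial f (k *: x) = radial f x.
Proof.
move=> k0; rewrite /radial enormZ ?ltW// scalerA invfM mulrAC mulVf ?mul1r//.
exact: lt0r_neq0.
Qed.

Lemma radial_sphere x : sphere x -> radial f x = f x.
Proof. by move=> xS; rewrite /radial /enorm xS sqrtr1 invr1 scale1r. Qed.

(** The radial extension is homogeneous of degree 0. This carries the vanishing of derivatives from
    the sphere to the chords inside it. *)
Lemma derive_radialZ (k : R) (x v : 'rV[R]_m.+1) : 0 < k ->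
  'D_v (radial f) x = 'D_(k *: v) (radial f) (k *: x).
Proof.
move=> k0; rewrite /derive.
have -> // : (fun h : R => h^-1 *: ((radial f \o shift x) (h *: v) - radial f x)) =
  (fun h => h^-1 *: ((radial f \o shift (k *: x)) (h *: (k *: v)) - radial f (k *: x))).
apply/funext => h /=; rewrite [radial f (k *: x)]radialZ//; congr (_ *: (_ - _)).
by rewrite -[LHS](@radialZ k _ k0) scalerDr !scalerA [k * h]mulrC.
Qed.

Hypothesis fS : smooth_sphere_map f.

Let rdiff x : x != 0 -> differentiable (radial f) x.
Proof. by move=> x0; have [_ /(_ 1%N)[+ _]] := fS; exact. Qed.

Let rderc v x : x != 0 -> {for x, continuous ('D_v (radial f))}.
Proof. by move=> x0; have [_ /(_ 1%N)[_ /(_ v)]] := fS; apply. Qed.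

(** The pullback norm written with directional derivatives: their continuity is what [smooth_on]
    provides. *)
Definition derive_sqnorm (x : 'rV[R]_m.+1) : R :=
  \sum_(i < m.+1) \sum_(j < m.+1)
    dotv ('D_(delta_mx ord0 i) (radial f) x) ('D_(delta_mx ord0 j) (radial f) x) ^+ 2.

Lemma pullback_sqnormE x : x != 0 -> pullback_sqnorm f x = derive_sqnorm x.
Proof.
move=> /rdiff dx; apply: eq_bigr => i _; apply: eq_bigr => j _.
by rewrite /pullback !deriveE.
Qed.

Lemma derive_sqnorm_continuous x : x != 0 -> {for x, continuous derive_sqnorm}.
Proof.
move=> x0; do 2 apply: continuous_at_sum => ?.
apply: (@continuous_comp _ _ _ _ (fun z : R => z ^+ 2)); last exact: exprn_continuous.
by apply: continuous_at_dotv; exact: rderc.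
Qed.

Lemma pullback_sqnorm_ge0 x : 0 <= pullback_sqnorm f x.
Proof. by do 2 apply: sumr_ge0 => ? _; exact: sqr_ge0. Qed.

Lemma pullback_sqnorm_bounded : exists K : R, forall x, sphere x -> pullback_sqnorm f x <= K.
Proof.
have [x0 x0S] := @sphere_nonempty R m.
have gc : {within @sphere R m, continuous derive_sqnorm}.
  apply: continuous_in_subspaceT => x; rewrite inE => /sphere_neq0.
  exact: derive_sqnorm_continuous.
have [c _ cP] := EVT_max_rV (ex_intro _ x0 x0S) (@sphere_compact m) gc.
exists (derive_sqnorm c) => x xS; rewrite (pullback_sqnormE (sphere_neq0 xS)).
by apply: cP; rewrite inE.
Qed.

(** In a vanishing sum of squares the diagonal terms vanish, and these are the fourth powers of the
    lengths of the images of the basis vectors. *)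
Lemma derive_radial_eq0 :
  (forall x, sphere x -> pullback_sqnorm f x = 0) ->
  forall x v, x != 0 -> 'D_v (radial f) x = 0.
Proof.
move=> f0 x v x0.
rewrite (@derive_radialZ (enorm x)^-1) ?invr_gt0 ?enorm_gt0//.
have := f0 _ (sphere_normalize x0).
set y := (enorm x)^-1 *: x => fy0; have y0 : y != 0 by exact/sphere_neq0/sphere_normalize.
have de i : 'd (radial f) y (delta_mx ord0 i) = 0.
  apply/dotv_eq0/eqP; rewrite -sqrf_eq0 -[X in X == 0]/(pullback f y _ _ ^+ 2).
  move: fy0 => /eqP; rewrite psumr_eq0 => [/allP/(_ i (mem_index_enum i))|j _]; last first.
    by apply: sumr_ge0 => ? _; exact: sqr_ge0.
  rewrite /= psumr_eq0 => [/allP/(_ i (mem_index_enum i))//|j _]; exact: sqr_ge0.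
rewrite deriveE; last exact: rdiff.
rewrite [X in 'd _ _ X]row_sum_delta linear_sum big1// => i _.
by rewrite linearZ /= de scaler0.
Qed.

Lemma radial_segment (p q : 'rV[R]_m.+1) :
  (forall x v, x != 0 -> 'D_v (radial f) x = 0) ->
  (forall s : R, 0 <= s <= 1 -> s *: (q - p) + p != 0) -> radial f p = radial f q.
Proof.
move=> d0 pq0; set v := q - p; apply/rowP => i.
pose g (s : R) := radial f (s *: v + p) ord0 i.
have gd (s : R) : 0 <= s <= 1 -> is_derive s 1 g 0.
  move=> sP; have x0 := pq0 s sP; rewrite -/v in x0.
  have rd : derivable (radial f) (s *: v + p) v by exact: diff_derivable (rdiff x0).
  have gE : (fun h : R => h^-1 *: ((g \o shift s) (h *: 1) - g s)) =
    (fun h => h^-1 *: (((fun x => radial f x ord0 i) \o shift (s *: v + p)) (h *: v)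
      - radial f (s *: v + p) ord0 i)).
    apply/funext => h; rewrite /g /=; congr (_ *: (radial f _ _ _ - _)).
    by rewrite scalerDl addrA -scalerA scale1r.
  have cd : derivable (fun x => radial f x ord0 i) (s *: v + p) v.
    by move/derivable_mxP : rd; apply.
  apply: DeriveDef; first by rewrite /derivable gE.
  rewrite /derive gE -[LHS]/('D_v (fun x => radial f x ord0 i) (s *: v + p)).
  by have /rowP/(_ i) := derive_mx rd; rewrite (d0 _ _ x0) !mxE.
have [c _] := @mean_value R g (fun=> 0) 0 1 ler01 gd.
by rewrite mul0r => /eqP; rewrite subr_eq0 /g scale0r add0r scale1r subrK => /eqP.
Qed.

Lemma segment_neq0 (p q : 'rV[R]_m.+1) (s : R) : sphere p -> sphere q -> q <> - p ->
  0 <= s <= 1 -> s *: (q - p) + p != 0.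
Proof.
move=> pS qS qp sP; apply/eqP => s0; apply: qp.
have sq : s *: q = (s - 1) *: p.
  by apply/eqP; rewrite -subr_eq0 scalerBl scale1r opprB addrCA addrC -scalerBr s0.
have : dotv (s *: q) (s *: q) = dotv ((s - 1) *: p) ((s - 1) *: p) by rewrite sq.
rewrite !dotvZ pS qS => s2; have s12 : s = 2^-1 by lra.
have : 2 *: (s *: q) = 2 *: ((s - 1) *: p) by rewrite sq.
rewrite !scalerA s12 divff ?scale1r// => ->.
by rewrite (_ : 2 * (2^-1 - 1) = -1 :> R) ?scaleN1r//; lra.
Qed.

(** Otherwise the radial extension is constant on every segment that misses 0. Two points that are
    not antipodal are joined by such a chord; antipodal ones are linked through a third point, which
    exists since the sphere has positive dimension. *)
Lemma nonconstant_pullback_gt0 : (0 < m)%N -> nonconstant_sphere_map f ->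
  exists2 x, sphere x & 0 < pullback_sqnorm f x.
Proof.
move=> m0 [p [q [pS qS fpq]]]; apply: contrapT => noex; apply: fpq.
have /derive_radial_eq0 {}d0 : forall x, sphere x -> pullback_sqnorm f x = 0.
  move=> x xS; apply/eqP; rewrite eq_le pullback_sqnorm_ge0 andbT leNgt.
  by apply/negP => fx; apply: noex; exists x.
have conn x y : sphere x -> sphere y -> y <> - x -> f x = f y.
  move=> xS yS yx; rewrite -!radial_sphere//; apply: radial_segment => // s.
  exact: segment_neq0.
have [w [wS wp wNp]] : exists w, [/\ sphere w, w <> p & w <> - p].
  pose e i : 'rV[R]_m.+1 := delta_mx ord0 i.
  have eS i : sphere (e i).
    rewrite /sphere/= /dotv (bigD1 i)//= mxE !eqxx mulr1.
    by rewrite big1 ?addr0// => j /negbTE ji; rewrite mxE eqxx ji mulr0.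
  have e01 : e ord_max ord0 ord0 = 0.
    by rewrite mxE eqxx -val_eqE /= eq_sym (gtn_eqF m0).
  have e00 : e ord0 ord0 ord0 = 1 by rewrite mxE eqxx.
  have [pe|pe] := eqVneq (p ord0 ord0) 0.
    exists (e ord0); split => // [ep|ep].
      by move: e00; rewrite ep pe => /eqP; rewrite eq_sym oner_eq0.
    by move: e00; rewrite ep mxE pe oppr0 => /eqP; rewrite eq_sym oner_eq0.
  exists (e ord_max); split => // [ep|ep].
    by move: pe; rewrite -ep e01 eqxx.
  by move: e01; rewrite ep mxE => /eqP; rewrite oppr_eq0 (negbTE pe).
have [qp|qp] := pselect (q = - p); last exact: conn.
rewrite (conn p w)//; apply: conn => //.
by rewrite qp => /oppr_inj /esym.
Qed.

End smooth_sphere_maps.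

(** * The mean of the pullback norm *)

Section mean_sqnorm.
Context {R : realType}.

Lemma sphere_vol_gt0 m : 0 < @sphere_vol R m.
Proof.
have [V V0 VE] := @sphere_integral_cst R m.
by rewrite /sphere_vol VE//= mul1r.
Qed.

Variables (m n : nat) (f : 'rV[R]_m.+1 -> 'rV[R]_n.+1).

Lemma mean_sqnorm_ge0 : 0 <= mean_sqnorm f.
Proof.
rewrite divr_ge0 ?(ltW (sphere_vol_gt0 m))//; apply: fine_ge0.
have uu x (xS : sphere x) :
    (0%:E <= (pullback_sqnorm f x)%:E /\ (pullback_sqnorm f x)%:E <= (pullback_sqnorm f x)%:E)%E.
  by rewrite lee_fin pullback_sqnorm_ge0.
by have [] := sphere_integral_le uu.
Qed.

(** [fine] sends an infinite integral to 0, so finiteness, by compactness of the sphere, has to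
    accompany the local lower bound. *)
Lemma mean_sqnorm_gt0 : smooth_sphere_map f -> (0 < m)%N -> nonconstant_sphere_map f ->
  0 < mean_sqnorm f.
Proof.
move=> fS m0 fnc; rewrite divr_gt0 ?sphere_vol_gt0//; apply: fine_gt0.
have [K KP] := pullback_sqnorm_bounded fS.
have [x0 x0S fx0] := nonconstant_pullback_gt0 fS m0 fnc.
have K0 : 0 <= K by apply: le_trans (KP _ x0S); exact: ltW.
have [V V0 VE] := @sphere_integral_cst R m.
have uK x (xS : sphere x) : (0%:E <= (pullback_sqnorm f x)%:E /\ (pullback_sqnorm f x)%:E <= K%:E)%E.
  by rewrite !lee_fin pullback_sqnorm_ge0 KP.
have [_] := sphere_integral_le uK; rewrite VE// => IK.
apply/andP; split; last by apply: le_lt_trans IK _; rewrite ltry.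
have e0 : 0 < pullback_sqnorm f x0 / 2 by rewrite divr_gt0.
have := derive_sqnorm_continuous fS (sphere_neq0 x0S).
move=> /cvgrPdist_lt/(_ _ e0)/nbhs_ballP[del /= del0 delP].
have [eta eta0 etaP] := sphere_integral_ge_local x0S del0 e0.
apply: lt_le_trans (etaP _ _ _); first by rewrite lte_fin.
  by move=> x _; rewrite lee_fin pullback_sqnorm_ge0.
move=> x xS xx0; rewrite lee_fin.
have /delP : ball x0 del x.
  by split=> // i j; rewrite /ball /= ord1 distrC; exact: xx0.
rewrite (pullback_sqnormE fS (sphere_neq0 xS)) (pullback_sqnormE fS (sphere_neq0 x0S)).
move: (derive_sqnorm f x0) (derive_sqnorm f x) => u v; rewrite ltr_norml => /andP[_].
by clear; lra.
Qed.

(** The integrand is known to be constant on the sphere only, not on the ambient space; monotonicity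
    in both directions shows that other values do not count. *)
Lemma constant_mean_sqnorm x : constant_pullback_norm f -> sphere x ->
  pullback_sqnorm f x = mean_sqnorm f.
Proof.
move=> fC xS; have [V V0 VE] := @sphere_integral_cst R m.
have p0 := pullback_sqnorm_ge0 f x.
have H (u v : 'rV[R]_m.+1 -> \bar R) : (forall y, sphere y -> u y = (pullback_sqnorm f x)%:E) ->
    (forall y, sphere y -> v y = (pullback_sqnorm f x)%:E) ->
    (sphere_integral u <= sphere_integral v)%E.
  move=> ux vx; have uv y (yS : sphere y) : (0%:E <= u y /\ u y <= v y)%E.
    by rewrite ux// vx// lee_fin.
  by have [] := sphere_integral_le uv.
have IE : sphere_integral (fun y => (pullback_sqnorm f y)%:E) =
    @sphere_integral R m (fun=> (pullback_sqnorm f x)%:E).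
  by apply: le_anti; apply/andP; split; apply: H => y yS; rewrite ?(fC y x).
have vE : @sphere_vol R m = V by rewrite /sphere_vol (VE 1 ler01)/= mul1r.
have tE : total_sqnorm f = pullback_sqnorm f x * V by rewrite /total_sqnorm IE (VE _ p0).
rewrite /mean_sqnorm tE vE; apply/esym; exact: mulfK (lt0r_neq0 V0) _.
Qed.

End mean_sqnorm.

(** * The strict inequality c_0 < J(0) *)

Section infimum.
Context {R : realType}.
Notation mu := (@lebesgue_measure R).

Lemma arc_integral_le_cst (f : R -> R) (C : R) :
  (forall t, 0 < t < pi / 2 -> 0 <= f t <= C) ->
  (\int[mu]_(t in @Defs.arc R) (f t)%:E <= (C * (pi / 2))%:E)%E.
Proof.
move=> fC; have L0 : 0 < pi / 2 :> R by rewrite divr_gt0// pi_gt0.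
apply: le_trans (_ : (\int[mu]_(t in @Defs.arc R) (cst C%:E) t <= _)%E).
  by apply: ge0_le_integral_nomeasurability => t; rewrite arcE => /fC/andP[f0 fC']; rewrite !lee_fin.
rewrite integral_cst; last exact: measurable_arc.
by rewrite /Defs.arc /= lebesgue_measure_itv/= lte_fin L0 sube0.
Qed.

Lemma bounded_in_X0 m1 m2 (phi dphi : R -> R) (C : R) :
  (forall t : R, 0 < t < pi / 2 -> is_derive t 1 phi (dphi t)) ->
  (forall t : R, 0 < t < pi / 2 -> {for t, continuous dphi}) ->
  (forall t : R, 0 < t < pi / 2 -> `|dphi t| <= C) ->
  (forall t : R, 0 < t < pi / 2 -> 0 <= phi t <= pi / 2) ->
  in_X0 m1 m2 phi dphi.
Proof.
move=> dp dc dC pP; split; last by move=> t; rewrite arcE; exact: pP.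
split; first exact: arc_weak_derivative.
apply: le_lt_trans (ltry (((C ^+ 4 + (pi / 2) ^+ 4) * 1) * (pi / 2))).
apply: arc_integral_le_cst => t tP.
have /andP[w0 w1] : 0 <= weight m1 m2 t <= 1 by apply: weight_itv; move: tP; lra.
have /andP[p0 p1] := pP t tP.
have d4 : dphi t ^+ 4 <= C ^+ 4.
  rewrite -[leLHS]ger0_norm; last by rewrite (exprM _ 2 2) sqr_ge0.
  by rewrite normrX lerXn2r ?nnegrE ?dC// (le_trans _ (dC t tP)).
have d0 : 0 <= dphi t ^+ 4 by rewrite (exprM _ 2 2) sqr_ge0.
have p4 : phi t ^+ 4 <= (pi / 2) ^+ 4 by rewrite lerXn2r ?nnegrE// (le_trans p0).
have p40 := exprn_ge0 4 p0.
by rewrite mulr_ge0 ?addr_ge0//= ler_pM ?addr_ge0// lerD.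
Qed.

(** Since cos^4 p <= 1 - (p / 2)^2, the second term gains at least a1 e^2 s^4 / 4. The other two
    cost at most (16 K + a2) e^4 s^4, where 16 = 2^4 comes from |2 c^2 - s^2| <= 2; the condition on
    [e] makes this at most half of the gain. *)
Lemma trial_energy_density (kh K a1 a2 e s c p : R) :
  0 <= kh <= K -> 0 < a1 -> 0 <= a2 -> 0 < e -> e ^+ 2 * (16 * K + a2) <= a1 / 8 ->
  0 < s -> 0 < c -> s ^+ 2 + c ^+ 2 = 1 -> p = e * (s ^+ 2 * c) -> p <= 2^-1 ->
  kh * (e * (2 * s * c ^+ 2 - s ^+ 3)) ^+ 4 + a1 * (cos p ^+ 4 / c ^+ 4)
    + a2 * (sin p ^+ 4 / s ^+ 4) <= a1 / c ^+ 4 - a1 * e ^+ 2 / 8 * s ^+ 4.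
Proof.
move=> /andP[kh0 khK] a10 a20 e0 eK s0 c0 sc pE p1.
have s2 : s ^+ 2 <= 1 by rewrite -sc lerDl sqr_ge0.
have c2 : c ^+ 2 <= 1 by rewrite -sc lerDr sqr_ge0.
have c20 := exprn_gt0 2 c0; have c40 := exprn_gt0 4 c0; have s40 := exprn_gt0 4 s0.
have e40 := exprn_gt0 4 e0.
have p0 : 0 <= p by rewrite pE; do !apply: mulr_ge0 => //; rewrite ?sqr_ge0 ?ltW.
have [sp cp] : p / 2 <= sin p /\ 2^-1 <= cos p by apply: sin_cos_half; rewrite p0.
have t1 : kh * (e * (2 * s * c ^+ 2 - s ^+ 3)) ^+ 4 <= K * (16 * e ^+ 4 * s ^+ 4).
  apply: ler_pM => //; first by rewrite (exprM _ 2 2) sqr_ge0.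
  rewrite -[leLHS]ger0_norm; last by rewrite (exprM _ 2 2) sqr_ge0.
  have -> : 16 * e ^+ 4 * s ^+ 4 = (2 * e * s) ^+ 4 by ring.
  rewrite normrX lerXn2r ?nnegrE ?mulr_ge0 ?(ltW e0) ?(ltW s0)//.
  rewrite (_ : e * _ = e * s * (2 * c ^+ 2 - s ^+ 2)); last by ring.
  rewrite normrM gtr0_norm; last exact: mulr_gt0.
  rewrite (_ : 2 * e * s = e * s * 2); last by ring.
  apply: ler_pM => //; first by rewrite ltW// mulr_gt0.
  have H (x y : R) : 0 <= x -> x <= 1 -> 0 <= y -> y <= 1 -> `|2 * y - x| <= 2.
    by move=> *; rewrite ler_norml; lra.
  by apply: H; rewrite ?sqr_ge0.
have t2 : a1 * (cos p ^+ 4 / c ^+ 4) <= a1 / c ^+ 4 - a1 * e ^+ 2 / 4 * s ^+ 4.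
  have cs := cos2Dsin2 p.
  have p24 : (p / 2) ^+ 2 <= sin p ^+ 2 by rewrite lerXn2r ?nnegrE ?divr_ge0// (le_trans _ sp)// divr_ge0.
  have cp4 : cos p ^+ 4 <= 1 - (p / 2) ^+ 2.
    have -> : cos p ^+ 4 = cos p ^+ 2 * cos p ^+ 2 by ring.
    have c2p := sqr_ge0 (cos p); have s2p := sqr_ge0 (sin p).
    have H (x y z : R) : 0 <= x -> 0 <= y -> x + y = 1 -> z <= y -> x * x <= 1 - z.
      by clear; move=> *; nra.
    exact: H cs p24.
  apply: le_trans (_ : a1 * ((1 - (p / 2) ^+ 2) / c ^+ 4) <= _).
    by rewrite ler_pM2l// ler_pM2r// invr_gt0.
  have -> : a1 * ((1 - (p / 2) ^+ 2) / c ^+ 4) = a1 / c ^+ 4 - a1 * e ^+ 2 / 4 * s ^+ 4 * (c ^+ 2)^-1.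
    by rewrite pE; field; rewrite lt0r_neq0.
  rewrite lerB// -[leLHS]mulr1 ler_pM2l; first by rewrite -[1]invr1 lef_pV2// ?posrE.
  by rewrite !mulr_gt0// exprn_gt0.
have t3 : a2 * (sin p ^+ 4 / s ^+ 4) <= a2 * (e ^+ 4 * s ^+ 4).
  apply: ler_wpM2l => //; rewrite ler_pdivrMr//.
  apply: le_trans (_ : p ^+ 4 <= _).
    by rewrite lerXn2r ?nnegrE ?sin_le_id// (le_trans _ sp)// divr_ge0.
  have -> : p ^+ 4 = e ^+ 4 * s ^+ 4 * s ^+ 4 * c ^+ 4 by rewrite pE; ring.
  rewrite -[leRHS]mulr1; apply: ler_wpM2l; first by rewrite !mulr_ge0 ?ltW.
  by rewrite (exprM _ 2 2) exprn_ile1// ltW.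
have t4 : e ^+ 2 * s ^+ 4 * (e ^+ 2 * (16 * K + a2)) <= e ^+ 2 * s ^+ 4 * (a1 / 8).
  by apply: ler_wpM2l => //; rewrite mulr_ge0 ?sqr_ge0 ?ltW.
apply: le_trans (lerD (lerD t1 t2) t3) _; move: t4.
have -> : e ^+ 2 * s ^+ 4 * (e ^+ 2 * (16 * K + a2)) = K * (16 * e ^+ 4 * s ^+ 4) + a2 * (e ^+ 4 * s ^+ 4).
  by ring.
have H (w x y z u : R) : u * (a1 / 8) = a1 * z / 8 -> x + y <= u * (a1 / 8) ->
    x + (w - a1 * z / 4) + y <= w - a1 * z / 8.
  by clear; move=> ->; lra.
have E : a1 * e ^+ 2 / 8 * s ^+ 4 = a1 * (e ^+ 2 * s ^+ 4) / 8 by ring.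
have -> : a1 * e ^+ 2 / 4 * s ^+ 4 = a1 * (e ^+ 2 * s ^+ 4) / 4 by ring.
by rewrite E; apply: H; ring.
Qed.

Section comparison.
Variables (m1 m2 : nat) (a b c d a1 a2 : R).
Hypotheses (a0 : 0 < a) (b0 : 0 < b) (c0 : 0 < c) (d0 : 0 < d) (a10 : 0 < a1) (a20 : 0 <= a2).

Let density (phi dphi : R -> R) t :=
  (ell c d (phi t) ^+ 4 / ell a b t ^+ 4 * dphi t ^+ 4
   + a1 * (cos (phi t) ^+ 4 / cos t ^+ 4)
   + a2 * (sin (phi t) ^+ 4 / sin t ^+ 4)) * weight m1 m2 t.

Let density_ge0 phi dphi t : 0 < t < pi / 2 -> 0 <= density phi dphi t.
Proof.
move=> tP; have /andP[w0 _] : 0 <= weight m1 m2 t <= 1 by apply: weight_itv; move: tP; lra.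
have sq (x : R) : 0 <= x ^+ 4 by rewrite (exprM _ 2 2) sqr_ge0.
have sqV (x y : R) : 0 <= x ^+ 4 / y ^+ 4 by rewrite divr_ge0.
apply: mulr_ge0 => //; apply: addr_ge0; last exact: mulr_ge0.
by apply: addr_ge0; apply: mulr_ge0 => //; exact: ltW.
Qed.

Let Jge0 phi dphi : (0 <= J m1 m2 a b c d a1 a2 phi dphi)%E.
Proof.
apply: mule_ge0; first by rewrite lee_fin invr_ge0.
by apply: integral_ge0 => t; rewrite arcE lee_fin => tP; exact: density_ge0.
Qed.

Lemma J_inf_ge0 : (0 <= J_inf m1 m2 a b c d a1 a2)%E.
Proof. by apply: le_ereal_inf_tmp => _ [phi [dphi [_ ->]]]; exact: Jge0. Qed.

Let ratio_bounded : exists K, forall x t, 0 <= ell c d x ^+ 4 / ell a b t ^+ 4 <= K.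
Proof.
have [mh [Mh [mh0 hP]]] := quad_bounds a0 b0; have [mk [Mk [mk0 kP]]] := quad_bounds c0 d0.
exists (Mk ^+ 2 / mh ^+ 2) => x t.
rewrite ![_ ^+ 4](exprM _ 2 2) !ell_sqr// divr_ge0 ?sqr_ge0//=.
have /andP[h1 _] := hP t; have /andP[k1 k2] := kP x.
have q0 := le_trans (ltW mk0) k1.
apply: ler_pM; rewrite ?invr_ge0 ?sqr_ge0//.
  by rewrite lerXn2r// nnegrE (le_trans q0).
rewrite lef_pV2 ?posrE ?exprn_gt0//; last exact: quad_gt0.
by rewrite lerXn2r// nnegrE ltW// quad_gt0.
Qed.

(** When J(0) is infinite, any competitor of finite energy proves the strict inequality; for phi(t)
    = t the singular quotients are identically 1. *)
Lemma J_id_lt_pinfty : (J m1 m2 a b c d a1 a2 id (cst 1%R) < +oo)%E.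
Proof.
have [K KP] := ratio_bounded.
apply: (@le_lt_trans _ _ ((4^-1)%:E * ((K + a1 + a2) * (pi / 2))%:E)%E); last by rewrite -EFinM ltry.
apply: lee_wpmul2l; first by rewrite lee_fin invr_ge0.
apply: arc_integral_le_cst => t tP; rewrite -/(density id (cst 1) t) density_ge0//=.
have /andP[w0 w1] : 0 <= weight m1 m2 t <= 1 by apply: weight_itv; move: tP; lra.
have [s0 c0'] := sin_cos_gt0 tP; have /andP[k0 kK] := KP t t.
rewrite /density /= expr1n mulr1 !divff ?mulr1 ?lt0r_neq0 ?exprn_gt0//.
rewrite -[leRHS]mulr1; apply: ler_pM => //; first by rewrite !addr_ge0// ltW.
by rewrite !lerD2r.
Qed.

Lemma J_pihalf_eq0 : a2 = 0 -> J_cst m1 m2 a b c d a1 a2 (pi / 2) = 0%E.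
Proof.
move=> a2_0; rewrite /J_cst /J (_ : (\int[mu]_(t in _) _)%E = 0%E) ?mule0//.
apply: integral0_eq => t _.
by rewrite /= cos_pihalf a2_0 !expr0n/= !mul0r !mulr0 !addr0 mul0r.
Qed.

Lemma J_inf_lt_J0 : (J_inf m1 m2 a b c d a1 a2 < J_cst m1 m2 a b c d a1 a2 0%R)%E.
Proof.
have p1 := pihalf_ge1 R.
have [J0oo|J0fin] := eqVneq (J_cst m1 m2 a b c d a1 a2 0) +oo%E.
  rewrite J0oo; apply: le_lt_trans J_id_lt_pinfty; apply: ereal_inf_lbound.
  exists id, (cst 1); split => //; apply: (@bounded_in_X0 _ _ _ _ 1) => [t _|t _|t].
  - exact: cvg_cst.
  - by rewrite normr1.
  - by rewrite /=; lra.
have [K KP] := ratio_bounded.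
have K0 : 0 <= K by have /andP[+ _] := KP 0 0; move=> /le_trans; apply; have /andP[] := KP 0 0.
(* The bound 1/2 puts the trial function in the range of [sin_cos_half]; the other term gives the
   condition of [trial_energy_density], the 1 keeping its denominator positive. *)
pose e := Num.min (2^-1) (a1 / (8 * (16 * K + a2 + 1))).
have A0 : 0 < 16 * K + a2 + 1 by move: a20; lra.
have e0 : 0 < e by rewrite lt_min invr_gt0 ltr0n /= divr_gt0// mulr_gt0.
have e1 : e <= 2^-1 by rewrite ge_min lexx.
have eK : e ^+ 2 * (16 * K + a2) <= a1 / 8.
  have e2 : e * (16 * K + a2 + 1) <= a1 / 8.
    by rewrite -ler_pdivlMr// -mulrA -invfM ge_min lexx orbT.
  have KA : 0 <= 16 * K + a2 by rewrite addr_ge0// mulr_ge0.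
  apply: le_trans e2; rewrite expr2 -mulrA ler_pM2l// -[leRHS]mul1r.
  by apply: ler_pM; rewrite ?(ltW e0)// ?lerDl//; move: e1; lra.
pose phi t := e * (sin t ^+ 2 * cos t).
pose dphi t := e * (2 * sin t * cos t ^+ 2 - sin t ^+ 3).
have phiP t : 0 < t < pi / 2 -> 0 <= phi t <= 2^-1.
  move=> /sin_cos_gt0[s0 c0']; have sc0 : 0 <= sin t ^+ 2 * cos t by rewrite mulr_ge0 ?sqr_ge0// ltW.
  rewrite mulr_ge0 ?(ltW e0)//= -[leRHS]mulr1; apply: ler_pM => //; first exact: ltW.
  by rewrite mulr_ile1 ?sqr_ge0 ?(ltW c0')// ?cos_le1// exprn_ile1 ?sin_le1// ltW.
have dphiE (t : R) : is_derive t 1 phi (dphi t).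
  have -> : phi = e \*: (sin ^+ 2 * cos) by apply/funext.
  by apply: is_derive_eq; rewrite /dphi /GRing.scale/= ?fctE; ring.
have dphic (t : R) : {for t, continuous dphi}.
  apply: (@is_derive_continuous _ _ _
    (e * (2 * (cos t ^+ 3 - 2 * (sin t ^+ 2 * cos t)) - 3 * (sin t ^+ 2 * cos t)))).
  have -> : dphi = e \*: (2 \*: (sin * cos ^+ 2) - sin ^+ 3).
    by apply/funext => s; rewrite /dphi -[2 * sin s * _]mulrA.
  by apply: is_derive_eq; rewrite /GRing.scale/= !fctE; ring.
have phiX0 : in_X0 m1 m2 phi dphi.
  apply: (@bounded_in_X0 _ _ _ _ (e * 3)) => // t tP.
    have [s0 c0'] := sin_cos_gt0 tP; have [s1 c1] := (sin_le1 t, cos_le1 t).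
    rewrite normrM (gtr0_norm e0) ler_pM2l//.
    have h1 : 0 <= sin t * cos t ^+ 2 <= 1.
      by rewrite mulr_ge0 ?sqr_ge0 ?(ltW s0)//= mulr_ile1 ?sqr_ge0 ?(ltW s0) ?exprn_ile1 ?(ltW c0')//.
    have h2 : 0 <= sin t ^+ 3 <= 1 by rewrite exprn_ge0 ?exprn_ile1// ltW.
    by move: h1 h2; rewrite -[2 * sin t * _]mulrA ler_norml; move: (sin t * _) (_ ^+ 3) => x y; lra.
  by have := phiP t tP; lra.
have J_phi : (J_inf m1 m2 a b c d a1 a2 <= J m1 m2 a b c d a1 a2 phi dphi)%E.
  by apply: ereal_inf_lbound; exists phi, dphi.
apply: le_lt_trans J_phi _.
pose eta := a1 * e ^+ 2 / 8.
have eta0 : 0 < eta by rewrite divr_gt0// mulr_gt0// exprn_gt0.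
(* The density of J(0) is [G + H], and that of the trial function is at most [G]. Strictness follows
   from the positive integral of [H], once the integral of [G] is known to be finite because J(0)
   is. *)
pose G t := (a1 / cos t ^+ 4 - eta * sin t ^+ 4) * weight m1 m2 t.
pose H t := eta * sin t ^+ 4 * weight m1 m2 t.
have phiG t : 0 < t < pi / 2 -> density phi dphi t <= G t.
  move=> tP; have /andP[w0 _] : 0 <= weight m1 m2 t <= 1 by apply: weight_itv; move: tP; lra.
  have [s0 c0'] := sin_cos_gt0 tP; have /andP[_ p2] := phiP t tP.
  apply: ler_wpM2r => //; apply: trial_energy_density (KP _ _) _ _ _ eK _ _ _ _ _ => //.
  by rewrite addrC cos2Dsin2.
have G0 t : 0 < t < pi / 2 -> 0 <= G t.
  by move=> tP; apply: le_trans (phiG t tP); exact: density_ge0.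
have H0 t : 0 < t < pi / 2 -> 0 <= H t.
  move=> tP; have /andP[w0 _] : 0 <= weight m1 m2 t <= 1 by apply: weight_itv; move: tP; lra.
  have [s0 _] := sin_cos_gt0 tP.
  by rewrite mulr_ge0// mulr_ge0 ?(ltW eta0)// exprn_ge0// ltW.
have wc : continuous (weight m1 m2 : R -> R).
  move=> t; apply: cvgM; [have cc := @continuous_cos R t|have cc := @continuous_sin R t].
    exact: (continuous_comp cc (@exprn_continuous _ m1 _)).
  exact: (continuous_comp cc (@exprn_continuous _ m2 _)).
have s4c (t : R) : {for t, continuous (fun s => eta * sin s ^+ 4)}.
  by apply: cvgM; [exact: cvg_cst|exact: (continuous_comp (@continuous_sin R t) (@exprn_continuous _ 4 _))].
have Hm : measurable_fun (@Defs.arc R) (EFin \o H).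
  apply/measurable_EFinP; apply: arc_continuous_measurable => t _.
  by apply: cvgM; [exact: s4c|exact: wc].
have Gm : measurable_fun (@Defs.arc R) (EFin \o G).
  apply/measurable_EFinP; apply: arc_continuous_measurable => t /sin_cos_gt0[_ c0'].
  apply: cvgM; last exact: wc.
  apply: cvgB; last exact: s4c.
  apply: cvgM; first exact: cvg_cst.
  apply: cvgV; first by rewrite lt0r_neq0// exprn_gt0.
  exact: (continuous_comp (@continuous_cos R t) (@exprn_continuous _ 4 _)).
have J0E : J_cst m1 m2 a b c d a1 a2 0 =
    ((4^-1)%:E * (\int[mu]_(t in @Defs.arc R) (G t)%:E + \int[mu]_(t in @Defs.arc R) (H t)%:E))%E.
  rewrite /J_cst /J; congr (_ * _)%E.
  have Ge t : @Defs.arc R t -> (0 <= (G t)%:E)%E by rewrite arcE lee_fin; exact: G0.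
  have He t : @Defs.arc R t -> (0 <= (H t)%:E)%E by rewrite arcE lee_fin; exact: H0.
  rewrite -(ge0_integralD mu measurable_arc Ge Gm He Hm).
  apply: eq_integral => t _; rewrite -EFinD /G /H /= sin0 cos0 !expr0n !expr1n/=.
  by congr EFin; ring.
have GE : (\int[mu]_(t in @Defs.arc R) (density phi dphi t)%:E <= \int[mu]_(t in @Defs.arc R) (G t)%:E)%E.
  apply: ge0_le_integral_nomeasurability => t; rewrite arcE !lee_fin => tP.
  by split; [exact: density_ge0|exact: phiG].
have HI : (0 < \int[mu]_(t in @Defs.arc R) (H t)%:E)%E.
  have p0 := pi_gt0 R; pose u : R := pi / 6; pose v : R := pi / 3.
  have uP : 0 < u < pi / 2 by rewrite /u; lra.
  have vP : 0 < v < pi / 2 by rewrite /v; lra.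
  have uv : u < v by rewrite /u /v; lra.
  have [su _] := sin_cos_gt0 uP; have [_ cv] := sin_cos_gt0 vP.
  pose l := eta * sin u ^+ 4 * (cos v ^+ m1 * sin u ^+ m2).
  have l0 : 0 < l by rewrite !mulr_gt0 ?exprn_gt0.
  have uvP (t : R) : u <= t <= v -> 0 < t < pi / 2 by move: uP vP; lra.
  have HB : ((l * (v - u))%:E <= \int[mu]_(t in `[u, v]) (H t)%:E)%E.
    apply: integral_ge_subinterval => //; first exact: ltW.
      by move=> r /uvP; rewrite lee_fin; exact: H0.
    move=> r rP; rewrite lee_fin /l /H; have rP' := uvP r rP.
    have wl := weight_ge m1 m2 (proj1 (andP uP)) (proj2 (andP vP)) rP.
    have sur : sin u <= sin r by apply: ler_sin; move: rP rP' uP; lra.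
    apply: ler_pM => //; first by rewrite mulr_ge0 ?exprn_ge0 ?ltW.
      by rewrite mulr_ge0 ?exprn_ge0 ?ltW.
    by rewrite ler_pM2l// lerXn2r ?nnegrE ?(ltW su)// (le_trans (ltW su)).
  apply: lt_le_trans (_ : (\int[mu]_(t in `[u, v]) (H t)%:E <= _)%E).
    by apply: lt_le_trans HB; rewrite lte_fin mulr_gt0// subr_gt0.
  have He t : @Defs.arc R t -> (0 <= (H t)%:E)%E by rewrite arcE lee_fin; exact: H0.
  have sub : `[u, v]%classic `<=` @Defs.arc R.
    by move=> t; rewrite /= in_itv/= arcE; exact: uvP.
  have mI : measurable (`[u, v]%classic : set R) by exact: measurable_itv.
  exact: (@ge0_subset_integral _ _ _ mu _ _ mI measurable_arc _ Hm He sub).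
have q0 : (0 < (4^-1 : R)%:E)%E by rewrite lte_fin invr_gt0.
have Ge0 : (0 <= \int[mu]_(t in @Defs.arc R) (G t)%:E)%E.
  by apply: integral_ge0 => t; rewrite arcE lee_fin; exact: G0.
have Gfin : (\int[mu]_(t in @Defs.arc R) (G t)%:E)%E \is a fin_num.
  rewrite ge0_fin_numE// ltey; apply: contra_neq J0fin; rewrite J0E => ->.
  rewrite addye; first exact: gt0_muley.
  by rewrite gt_eqF// (lt_trans _ HI).
rewrite J0E lte_pmul2l//.
by apply: le_lt_trans GE _; rewrite lteDl.
Qed.

End comparison.

End infimum.

(** * The solution lies in X_0 and is nonconstant *)

Section solution.
Context {R : realType}.
Variables (m1 m2 : nat) (a b c d al be : R).
Hypotheses (m10 : (0 < m1)%N) (m20 : (0 < m2)%N).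
Hypotheses (a0 : 0 < a) (b0 : 0 < b) (c0 : 0 < c) (d0 : 0 < d) (al0 : 0 < al) (be0 : 0 < be).
Notation mu := (@lebesgue_measure R).

(** Away from the weight, all factors of F' are bounded below by positive constants, so phi'^4 w is
    at most a multiple of F'. Adding a constant for the term phi^4 w gives a majorant with an
    explicit bounded primitive. *)
Let finite_energy (phi dphi F : R -> R) (C : R) :
  (forall t : R, 0 < t < pi / 2 -> 0 <= phi t <= pi / 2 /\ 0 <= F t <= C) ->
  (forall t : R, 0 < t < pi / 2 -> is_derive t 1 phi (dphi t)) ->
  (forall t : R, 0 < t < pi / 2 -> {for t, continuous dphi}) ->
  (forall t : R, 0 < t < pi / 2 -> is_derive t 1 F
     (stiffness m1 m2 a b t * (quad c d (phi t) * cube_root (quad c d (phi t))) * dphi t ^+ 4)) ->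
  in_X0 m1 m2 phi dphi.
Proof.
move=> phiF dp dc dF; have p0 := pi_gt0 R.
split; last by move=> t; rewrite arcE => /phiF[].
split; first exact: arc_weak_derivative.
have [mh [Mh [mh0 hP]]] := quad_bounds a0 b0; have [mk [Mk [mk0 kP]]] := quad_bounds c0 d0.
pose K (x : R) := x * cube_root x.
have K0 x : 0 < x -> 0 < K x by move=> x0; rewrite mulr_gt0// cube_root_gt0.
have Kmono x : mk <= x -> K mk <= K x.
  move=> kx; apply: ler_pM => //; [exact: ltW|exact: cube_root_ge0|].
  by apply: ler_cube_root => //; exact: ltW.
pose m := mh * K mk; have m0 : 0 < m by rewrite mulr_gt0// K0.
pose g t := m^-1 * (stiffness m1 m2 a b t * K (quad c d (phi t)) * dphi t ^+ 4) + (pi / 2) ^+ 4.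
have weight01 (t : R) : 0 < t < pi / 2 -> 0 <= weight m1 m2 t <= 1.
  by move=> tP; apply: weight_itv; move: tP; lra.
have d4 t : 0 <= dphi t ^+ 4 by rewrite (exprM _ 2 2) sqr_ge0.
have fg t : 0 < t < pi / 2 -> 0 <= (dphi t ^+ 4 + phi t ^+ 4) * weight m1 m2 t <= g t.
  move=> tP; have /andP[w0 w1] := weight01 t tP; have [/andP[ph0 ph1] _] := phiF t tP.
  have ph4 := exprn_ge0 4 ph0; rewrite mulr_ge0 ?addr_ge0//= mulrDl; apply: lerD; last first.
    by rewrite -[leRHS]mulr1; apply: ler_pM => //; rewrite lerXn2r ?nnegrE// (le_trans ph0).
  rewrite mulrC -ler_pdivrMl ?invr_gt0// invrK.
  have -> : m * (weight m1 m2 t * dphi t ^+ 4) = (mh * weight m1 m2 t * K mk) * dphi t ^+ 4.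
    by rewrite /m; ring.
  apply: ler_wpM2r => //; have /andP[h1 _] := hP t; have /andP[k1 _] := kP (phi t).
  apply: ler_pM; [by rewrite mulr_ge0// ltW|by rewrite ltW// K0| |exact: Kmono].
  by apply: ler_wpM2r.
pose H t := m^-1 * F t + (pi / 2) ^+ 4 * t.
apply: le_lt_trans (ltry (2 * (m^-1 * C + (pi / 2) ^+ 4 * (pi / 2)))).
apply: le_trans (_ : (\int[mu]_(t in @Defs.arc R) (g t)%:E <= _)%E).
  apply: ge0_le_integral_nomeasurability => t; rewrite arcE => /fg/andP[f0 fg'].
  by rewrite !lee_fin.
apply: (@arc_integral_bounded_primitive R H) => t tP.
- split; last by case/andP: (fg t tP) => f0 /(le_trans f0).
  have [_ /andP[F0 FC]] := phiF t tP; have q0 : 0 <= (pi / 2) ^+ 4 :> R by rewrite exprn_ge0// divr_ge0// ltW.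
  have t0 : 0 <= t <= pi / 2 by move: tP; lra.
  have /andP[t1 t2] := t0; have mi : 0 <= m^-1 by rewrite invr_ge0 ltW.
  have H0 : 0 <= H t by rewrite /H addr_ge0// mulr_ge0.
  by rewrite (ger0_norm H0); apply: lerD; apply: ler_wpM2l.
- have dFt := dF t tP.
  have -> : H = m^-1 \*: F + (pi / 2) ^+ 4 \*: id by apply/funext.
  by apply: is_derive_eq; rewrite /GRing.scale/= mulr1.
- apply: cvgD; last exact: cvg_cst.
  apply: cvgM; first exact: cvg_cst.
  have q0 := quad_gt0 (phi t) c0 d0.
  have kc : {for t, continuous (fun s => quad c d (phi s))}.
    exact: (continuous_comp (is_derive_continuous (dp t tP)) (@quad_continuous R c d _)).
  apply: cvgM; [apply: cvgM|].
  - exact: (is_derive_continuous (is_deriveM (quad_derive a b t) (weight_derive m10 m20 tP))).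
  - by apply: cvgM => //; exact: (continuous_comp kc (cube_root_continuous q0)).
  - exact: (continuous_comp (dc t tP) (@exprn_continuous _ 4 _)).
Qed.

Lemma solution_exists : exists phi dphi : R -> R,
  [/\ in_X0 m1 m2 phi dphi, nonconstant_on_arc phi &
   forall e1 e2, al = c ^+ 4 / a ^+ 4 * e1 -> be = d ^+ 4 / b ^+ 4 * e2 ->
     ode_solution m1 m2 a b c d e1 e2 phi].
Proof.
have [phi [dphi [F [C [delta [delta0 phiF der phiR phiL]]]]]] :=
  equation_solution_exists m10 m20 a0 b0 c0 d0 al0 be0.
have dp (t : R) : 0 < t < pi / 2 -> is_derive t 1 phi (dphi t) by case/der.
have dG (t : R) : 0 < t < pi / 2 ->
    is_derive t 1 (fun s => stiffness m1 m2 a b s * (quad c d (phi s) * dphi s ^+ 3))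
     (- coef1 m1 m2 a b al t * (cos (phi t) ^+ 3 * sin (phi t))
      + coef2 m1 m2 a b be t * (sin (phi t) ^+ 3 * cos (phi t))) by case/der.
have dc := integrated_equation_continuous m10 m20 a0 b0 c0 d0 dp dG.
exists phi, dphi; split.
- by apply: finite_energy phiF dp dc _ => t /der[].
- have p0 := pi_gt0 R; apply: contrapT => noconst.
  have L4 : 0 < (pi : R) / 4 < pi / 2 by lra.
  set x := phi (pi / 4).
  have phix t : 0 < t < pi / 2 -> phi t = x.
    move=> tP; apply: contrapT => tx; apply: noconst; exists t, (pi / 4).
    by rewrite !arcE.
  have dphi0 t : 0 < t < pi / 2 -> dphi t = 0.
    move=> tP; have dt := dp t tP.
    have cx : is_derive t 1 phi 0.
      apply: (near_eq_is_derive _ (is_derive_cst x t 1)).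
      by apply: filterS (arc_near tP) => s /phix.
    by rewrite -(derive1_val dt) (derive1_val cx).
  have xP : delta <= x <= pi / 2 - delta.
    have h1 := phiR (pi / 3) ltac:(lra); have h2 := phiL (pi / 6) ltac:(lra).
    by rewrite !phix in h1 h2; [rewrite h1 h2|lra|lra].
  have xP' : 0 < x < pi / 2 by move: xP delta0; lra.
  apply: (constant_not_solution al0 be0 xP') => t tP.
  have [st ct] := sin_cos_gt0 tP; have [sx cx] := sin_cos_gt0 xP'.
  (* For a constant phi the flux vanishes identically, hence so does its derivative, the force; of
     the factors of the force only the bracket can be zero. *)
  have G0 : is_derive t 1 (fun s => stiffness m1 m2 a b s * (quad c d (phi s) * dphi s ^+ 3)) 0.
    apply: (near_eq_is_derive _ (is_derive_cst 0 t 1)).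
    by apply: filterS (arc_near tP) => s /dphi0 ds /=; rewrite ds expr0n/= !mulr0.
  have := derive1_val (dG t tP); rewrite (derive1_val G0) phix// coef_force => /esym/eqP.
  rewrite mulf_eq0 mulf_eq0 oppr_eq0 mulf_eq0 => /orP[/orP[/orP[]|]|/eqP//].
  + by rewrite gt_eqF// exprn_gt0// quad_gt0.
  + by rewrite gt_eqF// mulr_gt0// exprn_gt0.
  + by rewrite gt_eqF// mulr_gt0.
- move=> e1 e2 alE beE t; rewrite arcE => tP.
  exact: (integrated_equation_ode m10 m20 a0 b0 c0 d0 dp dG tP alE beE).
Qed.

End solution.

Unset Implicit Arguments.
Set Strict Implicit.
Set Printing Implicit Defensive.

Theorem corollary2p2 (R : realType) (m1 m2 n1 n2 : nat) (a b c d : R)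
    (f1 : 'rV[R]_m1.+1 -> 'rV[R]_n1.+1) (f2 : 'rV[R]_m2.+1 -> 'rV[R]_n2.+1)
    (hm1 : (1 <= m1)%N) (hm2 : (1 <= m2)%N)
    (hn1 : (1 <= n1)%N) (hn2 : (1 <= n2)%N)
    (ha : 0 < a) (hb : 0 < b) (hc : 0 < c) (hd : 0 < d)
    (hf1 : symphonic f1) (hf2 : symphonic f2)
    (hf1nc : nonconstant_sphere_map f1) :
  let a1 := c ^+ 4 / a ^+ 4 * (total_sqnorm f1 / sphere_vol m1) in
  let a2 := d ^+ 4 / b ^+ 4 * (total_sqnorm f2 / sphere_vol m2) in
  (J_cst m1 m2 a b c d a1 a2 0%R <= J_cst m1 m2 a b c d a1 a2 (pi / 2)%R)%E ->
  (J_inf m1 m2 a b c d a1 a2 < J_cst m1 m2 a b c d a1 a2 0%R)%E /\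
  exists phi dphi : R -> R,
    [/\ in_X0 m1 m2 phi dphi,
        nonconstant_on_arc phi,
        ode_solution m1 m2 a b c d (mean_sqnorm f1) (mean_sqnorm f2) phi &
        constant_pullback_norm f1 -> constant_pullback_norm f2 ->
        forall x1 x2, sphere x1 -> sphere x2 ->
          ode_solution m1 m2 a b c d
            (pullback_sqnorm f1 x1) (pullback_sqnorm f2 x2) phi].
Proof.
move=> a1 a2 J0_le.
have mean1 : 0 < mean_sqnorm f1 by apply: mean_sqnorm_gt0 hf1nc => //; case: hf1.
have a1_gt0 : 0 < a1 by rewrite mulr_gt0// divr_gt0// exprn_gt0.
have a2_ge0 : 0 <= a2.
  apply: mulr_ge0; last exact: mean_sqnorm_ge0.
  by apply: divr_ge0; apply: exprn_ge0; exact: ltW.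
have J_lt := J_inf_lt_J0 m1 m2 ha hb hc hd a1_gt0 a2_ge0.
split=> //.
have a2_gt0 : 0 < a2.
  rewrite lt_neqAle a2_ge0 andbT; apply/eqP => /esym a2_eq0.
  have := le_lt_trans (J_inf_ge0 m1 m2 a b c d a1_gt0 a2_ge0) J_lt.
  by move=> /lt_le_trans/(_ J0_le); rewrite J_pihalf_eq0// ltxx.
have [phi [dphi [phiX phi_nc phiS]]] := solution_exists hm1 hm2 ha hb hc hd a1_gt0 a2_gt0.
(* [a1] and [a2] are the force constants belonging to the means; constant pullback norms coincide
   with their means. *)
exists phi, dphi; split=> // [|C1 C2 x1 x2 x1S x2S]; first exact: phiS.
by apply: phiS; rewrite constant_mean_sqnorm.
Qed.
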